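(* Let $F(s)=\zeta(s)\,\Gamma\!\left(\tfrac{s}{2}\right)\pi^{-s/2}=\dfrac{\xi(s)}{s(s-1)}$ (a function whose zeroes exactly coincide with the non-trivial zeroes of the Riemann zeta function $\zeta$). Then for every real number $\sigma$, both of the following hold: there are infinitely many real $t$ (with $\sigma+it\notin\{0,1\}$) such that $\operatorname{Re}F(\sigma+it)=0$, and there are infinitely many real $t$ (with $\sigma+it\notin\{0,1\}$) such that $\operatorname{Im}F(\sigma+it)=0$.
   Context: Here $\zeta$ is the Riemann zeta function and $\Gamma$ is the Gamma function. The function $\xi$ is normalized as $\xi(s)=\zeta(s)\,\Gamma\!\left(\tfrac{s}{2}\right)\pi^{-s/2}\,s(s-1)$ (no factor $\tfrac12$). The function $F(s)=\zeta(s)\Gamma(s/2)\pi^{-s/2}$ is understood as its meromorphic continuation to $\mathbb{C}$: it is holomorphic except for simple poles at $s=0$ and $s=1$, with residues $-1$ and $1$ respectively. In particular, the removable singularities of the product at $s=-2,-4,-6,\dots$ (trivial zeroes of $\zeta$ against poles of $\Gamma(s/2)$) are filled in by continuity. The non-trivial zeroes of $\zeta$ are the zeroes other than $s=-2,-4,-6,\dots$. *)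

(* Defs.v *)
From Stdlib Require Import Reals Finite_sets.
From Coquelicot Require Import Coquelicot.
Open Scope R_scope.
Open Scope C_scope.

Definition Cexp (z : C) : C := (exp (Re z) * cos (Im z), exp (Re z) * sin (Im z))%R.

(* [x ^ s] with the real logarithm; meaningful for [0 < x] only. *)
Definition Rcpow (x : R) (s : C) : C := Cexp (s * ln x).

(* Complex differentiability; no claim about [f] on the set [P], where the
   value of the total function [f] is junk. *)
Definition holomorphic_off (P : C -> Prop) (f : C -> C) : Prop :=
  forall s : C, ~ P s -> ex_derive (K := C_AbsRing) (V := C_NormedModule) f s.

(* Used with [r <> 0] only, for [f] holomorphic on a punctured neighbourhood of
   [p]: then the limit says exactly that the pole is simple with residue [r]. *)
Definition simple_pole_with_residue (f : C -> C) (p r : C) : Prop :=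
  filterlim (fun s : C => (s - p) * f s) (locally' p) (locally r).

(* A holomorphic function on the complement of a discrete closed set is
   determined there by its values on a half-plane, so the next two predicates
   pin down [zeta] and [Gamma] as the usual meromorphic continuations,
   everywhere except for the junk values at their poles. *)
Definition is_zeta (zeta : C -> C) : Prop :=
  holomorphic_off (fun s => s = 1) zeta /\
  forall s : C, (1 < Re s)%R ->
    is_series (K := C_AbsRing) (V := C_NormedModule)
      (fun n : nat => Rcpow (INR (S n)) (- s)) (zeta s).

Definition is_Gamma (Gamma : C -> C) : Prop :=
  holomorphic_off (fun s => exists n : nat, s = - RtoC (INR n)) Gamma /\
  forall s : C, (0 < Re s)%R ->
    is_RInt_gen (V := C_R_NormedModule)
      (fun t : R => Rcpow t (s - 1) * RtoC (exp (- t)))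
      (at_right 0) (Rbar_locally p_infty) (Gamma s).

(* The product formula is imposed wherever both factors are finite: [s = 1] is
   the pole of [zeta] and [s = 0, -2, -4, ...] are the poles of [Gamma (s / 2)].
   Holomorphy at [-2, -4, ...] fills in the removable singularities there. *)
Definition is_completed_zeta (zeta Gamma F : C -> C) : Prop :=
  (forall s : C, s <> 1 -> (forall n : nat, s <> - RtoC (2 * INR n)) ->
     F s = zeta s * Gamma (s / 2) * Rcpow PI (- s / 2)) /\
  holomorphic_off (fun s => s = 0 \/ s = 1) F /\
  simple_pole_with_residue F 0 (- (1)) /\
  simple_pole_with_residue F 1 1.

(* Main.v *)
(** Let Theta(w) be the sum of exp(- pi n^2 w) over n >= 1. For Re s > 1, F is the Mellin
    transform of Theta, and the ray of integration may be rotated: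
      F(s) e^{- i beta s} = 2 int_R Theta(e^{2(v + i beta)}) e^{s v} dv   for |beta| < pi/4.
    A linear combination in beta multiplies F by an exponential polynomial W(s). If W vanishes
    at 0 and 1, then F W is entire and, by Euler-Maclaurin summation and the identity theorem,
    the formula holds for every s. As in Hardy's theorem, Theta + 1/2 vanishes to infinite
    order at the cusp w = i, that is at v = 0 as beta tends to pi/4.

    Suppose that the real (or imaginary) part A(t) of F(sigma + i t) has constant signs for
    large t and for large - t. Take for W on the line Re s = sigma the weight
      [(2 cosh(d t) - 2 cos(sigma d)) (2 cosh(d t) - 2 cos((1 - sigma) d))]^N,
    which is positive, times cosh(alpha t) or sinh(alpha t) according to the two signs, with
    alpha = pi/4 - 3 N d. Fejer's kernel bounds the mean of A W by the value of the theta
    combination at v = 0, which is O(d^M) for every M. But A W is nonnegative for |t| >= T0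
    and at least c (C d^4)^N on some interval, while its negative part, carried by |t| < T0, is
    O((C d^4 / 2)^N): a contradiction for N large and d small. *)

Require Import Defs.
From Stdlib Require Import Reals Rcomplete Finite_sets Lra Lia Psatz.
From Stdlib Require Import Classical ClassicalEpsilon FunctionalExtensionality List.
From Stdlib Require Import ssreflect.
From Coquelicot Require Import Coquelicot.
Local Open Scope R_scope.

(** * Complex differentiability and the exponential *)

(** Both assertions are instances of one statement about Re (lam F): lam = 1 gives the real part,
    lam = -i the imaginary part. The factors [2 cosh (d t) - 2 cos (g d)] are modified second
    differences in the angle beta. For small d they have the size of d^2 (t^2 + g^2), so their N-th
    powers take over the role of the high derivatives in beta in Hardy's argument, while only finite
    sums of rotated kernels occur. As a function of s such a factor is
    [2 cos (d (s - sigma)) - 2 cos (g d)], with zeros at s = sigma + g and s = sigma - g; g = sigma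
    and g = 1 - sigma put zeros at 0 and 1. On the line the same two values turn t^2 + g^2 into
    |s|^2 and |s - 1|^2, so the weight also compensates the poles when the line passes through one
    of them. The order of the choices matters: the interval that yields the lower bound depends on
    T0 and sigma alone, N is then fixed by the minimum of A on it, and d comes last. Fejer means
    enter because the weighted function on the line is not known to be integrable. *)

(* Coquelicot's [is_derive] on [C] restated with the modulus: its product and its
   composition rules live on different uniform structures of [C]. *)
Definition cder (f : C -> C) (s l : C) : Prop :=
  forall eps, 0 < eps -> exists del, 0 < del /\
    forall h : C, Cmod h < del -> Cmod (f (s + h) - f s - l * h)%C <= eps * Cmod h.

Lemma Cmod_triangle' (a b : C) : Cmod (a - b)%C <= Cmod a + Cmod b.
Proof. rewrite -(Cmod_opp b); apply Cmod_triangle. Qed.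

Lemma Cmod_rev_triangle (a b : C) : Cmod a - Cmod b <= Cmod (a - b)%C.
Proof.
  have := Cmod_triangle (a - b)%C b.
  have -> : (a - b + b = a)%C by ring.
  lra.
Qed.

Lemma im_le_Cmod (c : C) : Rabs (Im c) <= Cmod c.
Proof. apply Rle_trans with (2 := Rmax_Cmod c); apply Rmax_r. Qed.

Lemma Cmod_le_re_im (c : C) : Cmod c <= Rabs (Re c) + Rabs (Im c).
Proof.
  have h1 := Rabs_pos (Re c). have h2 := Rabs_pos (Im c).
  apply Rsqr_incr_0_var; last lra.
  rewrite /Rsqr. have -> : Cmod c * Cmod c = Cmod c ^ 2 by ring.
  rewrite Cmod2_alt. rewrite -(pow2_abs (Re c)) -(pow2_abs (Im c)). nra.
Qed.

Lemma Ceq_of_minus (x y : C) : (x - y)%C = RtoC 0 -> x = y.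
Proof. move=> H. have -> : (x = x - y + y)%C by ring. rewrite H. ring. Qed.

Lemma Ceq_eps (x y : C) : (forall eps, 0 < eps -> Cmod (x - y)%C <= eps) -> x = y.
Proof.
  move=> H. apply Ceq_of_minus, Cmod_eq_0, Rle_antisym; last by apply Cmod_ge_0.
  apply le_epsilon => e he. rewrite Rplus_0_l. exact: H.
Qed.

Lemma locally_Cmod (l : C) (eps : R) : 0 < eps -> locally (T := C_UniformSpace) l (fun z => Cmod (z - l)%C < eps).
Proof.
  move=> he. exists (mkposreal (eps / 2) ltac:(lra)) => z hz.
  have := C_NormedModule_mixin_compat2 l z _ hz. rewrite /= /minus /plus /opp /= => h.
  apply Rlt_le_trans with (1 := h).
  have h2 : sqrt 2 <= 2. { rewrite -{2}(sqrt_pow2 2); last lra. apply sqrt_le_1_alt. lra. }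
  nra.
Qed.

Lemma ex_derive_cder (f : C -> C) (s : C) :
  ex_derive (K := C_AbsRing) (V := C_NormedModule) f s -> exists l, cder f s l.
Proof.
  move=> [l [_ H]]. exists l => eps Heps.
  have := H s (fun P HP => HP) (mkposreal _ Heps).
  move=> /locally_C [d Hd]. 
  exists (d/2); split; first by case: (d) => /= ? ?; lra.
  move=> h Hh.
  have := Hd (s + h)%C.
  have Hb : ball s d (s + h)%C.
  { apply C_NormedModule_mixin_compat1.
    have -> : minus (s + h)%C s = h by rewrite /minus /plus /opp /=; ring.
    have := cond_pos d. lra. }
  move=> /(_ Hb) /=.
  rewrite /minus /plus /opp /scal /= /mult /= /norm /= /abs /=.
  have -> : (s + h + - s = h)%C by ring.
  have -> : (f (s + h) + - f s + - (h * l) = f (s + h) - f s - l * h)%C by ring.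
  by [].
Qed.

Lemma cder_const (c s : C) : cder (fun _ => c) s 0.
Proof.
  move=> eps He; exists 1; split; first lra.
  move=> h _. have -> : (c - c - 0 * h = 0)%C by ring.
  rewrite Cmod_0. have := Cmod_ge_0 h. nra.
Qed.

Lemma cder_id (s : C) : cder (fun z => z) s 1.
Proof.
  move=> eps He; exists 1; split; first lra.
  move=> h _. have -> : (s + h - s - 1 * h = 0)%C by ring.
  rewrite Cmod_0. have := Cmod_ge_0 h. nra.
Qed.

Lemma cder_plus (f g : C -> C) (s l m : C) :
  cder f s l -> cder g s m -> cder (fun z => f z + g z)%C s (l + m)%C.
Proof.
  move=> Hf Hg eps He.
  have [d1 [hd1 H1]] := Hf (eps/2) ltac:(lra).
  have [d2 [hd2 H2]] := Hg (eps/2) ltac:(lra).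
  exists (Rmin d1 d2); split; first by apply Rmin_pos.
  move=> h Hh.
  have h1 := H1 h (Rlt_le_trans _ _ _ Hh (Rmin_l _ _)).
  have h2 := H2 h (Rlt_le_trans _ _ _ Hh (Rmin_r _ _)).
  have -> : (f (s + h) + g (s + h) - (f s + g s) - (l + m) * h
     = (f (s + h) - f s - l * h) + (g (s + h) - g s - m * h))%C by ring.
  apply Rle_trans with (1 := Cmod_triangle _ _). lra.
Qed.

Lemma cder_ext (f g : C -> C) (s l : C) : (forall z, f z = g z) -> cder f s l -> cder g s l.
Proof.
  move=> E Hf eps He. have [d [hd H]] := Hf eps He.
  exists d; split => // h Hh. rewrite -!E. exact: H.
Qed.

Lemma cder_lip (f : C -> C) (s l : C) : cder f s l ->
  exists del, 0 < del /\ forall h : C, Cmod h < del -> Cmod (f (s + h) - f s)%C <= (Cmod l + 1) * Cmod h.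
Proof.
  move=> Hf. have [d [hd H]] := Hf 1 ltac:(lra).
  exists d; split => // h Hh.
  have -> : (f (s + h) - f s = (f (s + h) - f s - l * h) + l * h)%C by ring.
  apply Rle_trans with (1 := Cmod_triangle _ _).
  rewrite Cmod_mult. have := H h Hh. lra.
Qed.

Lemma cder_cont (f : C -> C) (s l : C) : cder f s l ->
  forall eps, 0 < eps -> exists del, 0 < del /\ forall h : C, Cmod h < del -> Cmod (f (s + h) - f s)%C < eps.
Proof.
  move=> /cder_lip [d [hd H]] eps He.
  have hl := Cmod_ge_0 l.
  exists (Rmin d (eps / (Cmod l + 1))); split.
  { apply Rmin_pos => //. apply Rdiv_lt_0_compat; lra. }
  move=> h Hh.
  have h1 := H h (Rlt_le_trans _ _ _ Hh (Rmin_l _ _)).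
  have h2 := Rlt_le_trans _ _ _ Hh (Rmin_r _ _).
  apply Rle_lt_trans with (1 := h1).
  apply Rlt_le_trans with ((Cmod l + 1) * (eps / (Cmod l + 1))).
  - apply Rmult_lt_compat_l; lra.
  - apply Req_le; field; lra.
Qed.

Lemma cder_mult (f g : C -> C) (s l m : C) :
  cder f s l -> cder g s m -> cder (fun z => f z * g z)%C s (l * g s + f s * m)%C.
Proof.
  move=> Hf Hg eps He.
  set Kf := Cmod (f s) + 1. set Kg := Cmod (g s) + 1.
  have hKf : 0 < Kf by rewrite /Kf; have := Cmod_ge_0 (f s); lra.
  have hKg : 0 < Kg by rewrite /Kg; have := Cmod_ge_0 (g s); lra.
  have [d1 [hd1 H1]] := Hf (eps / (3 * Kg)) ltac:(apply Rdiv_lt_0_compat; lra).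
  have [d2 [hd2 H2]] := Hg (eps / (3 * Kf)) ltac:(apply Rdiv_lt_0_compat; lra).
  have [d3 [hd3 H3]] := cder_lip _ _ _ Hf.
  have hl := Cmod_ge_0 l.
  have [d4 [hd4 H4]] := cder_cont _ _ _ Hg (eps / (3 * (Cmod l + 1))) ltac:(apply Rdiv_lt_0_compat; lra).
  exists (Rmin (Rmin d1 d2) (Rmin d3 d4)); split; first by repeat apply Rmin_pos.
  move=> h Hh.
  have e12 := Rlt_le_trans _ _ _ Hh (Rmin_l _ _).
  have e34 := Rlt_le_trans _ _ _ Hh (Rmin_r _ _).
  have h1 := H1 h (Rlt_le_trans _ _ _ e12 (Rmin_l _ _)).
  have h2 := H2 h (Rlt_le_trans _ _ _ e12 (Rmin_r _ _)).
  have h3 := H3 h (Rlt_le_trans _ _ _ e34 (Rmin_l _ _)).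
  have h4 := H4 h (Rlt_le_trans _ _ _ e34 (Rmin_r _ _)).
  have -> : (f (s + h) * g (s + h) - f s * g s - (l * g s + f s * m) * h
    = (f (s + h) - f s - l * h) * g s + f s * (g (s + h) - g s - m * h)
      + (f (s+h) - f s) * (g (s + h) - g s))%C by ring.
  apply Rle_trans with (1 := Cmod_triangle _ _).
  apply Rle_trans with (1 := Rplus_le_compat_r _ _ _ (Cmod_triangle _ _)).
  rewrite !Cmod_mult.
  have p0 := Cmod_ge_0 h.
  have hg0 := Cmod_ge_0 (g s). have hf0 := Cmod_ge_0 (f s).
  have a1 : Cmod (f (s + h) - f s - l * h)%C * Cmod (g s) <= eps / 3 * Cmod h.
  { apply Rle_trans with (eps / (3 * Kg) * Cmod h * Kg).
    - apply Rmult_le_compat => //; try apply Cmod_ge_0. rewrite /Kg; lra.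
    - apply Req_le; field; lra. }
  have a2 : Cmod (f s) * Cmod (g (s + h) - g s - m * h)%C <= eps / 3 * Cmod h.
  { apply Rle_trans with (Kf * (eps / (3 * Kf) * Cmod h)).
    - apply Rmult_le_compat => //; try apply Cmod_ge_0. rewrite /Kf; lra.
    - apply Req_le; field; lra. }
  have a3 : Cmod (f (s + h) - f s)%C * Cmod (g (s + h) - g s)%C <= eps / 3 * Cmod h.
  { apply Rle_trans with ((Cmod l + 1) * Cmod h * (eps / (3 * (Cmod l + 1)))).
    - apply Rmult_le_compat; try apply Cmod_ge_0; lra.
    - apply Req_le; field; lra. }
  lra.
Qed.

Lemma cder_scal (c : C) (f : C -> C) (s l : C) :
  cder f s l -> cder (fun z => c * f z)%C s (c * l)%C.
Proof.
  move=> H. have := cder_mult _ _ _ _ _ (cder_const c s) H.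
  by have -> : (0 * f s + c * l = c * l)%C by ring.
Qed.

Lemma cder_comp (f g : C -> C) (s l m : C) :
  cder g s m -> cder f (g s) l -> cder (fun z => f (g z)) s (l * m)%C.
Proof.
  move=> Hg Hf eps He.
  have [d3 [hd3 H3]] := cder_lip _ _ _ Hg.
  set K := Cmod m + 1.
  have hK : 0 < K by rewrite /K; have := Cmod_ge_0 m; lra.
  have hl := Cmod_ge_0 l.
  have [d1 [hd1 H1]] := Hf (eps / (2 * K)) ltac:(apply Rdiv_lt_0_compat; lra).
  have [d2 [hd2 H2]] := Hg (eps / (2 * (Cmod l + 1))) ltac:(apply Rdiv_lt_0_compat; lra).
  exists (Rmin (d1 / K) (Rmin d2 d3)); split.
  { repeat apply Rmin_pos => //. by apply Rdiv_lt_0_compat. }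
  move=> h Hh.
  have e1 := Rlt_le_trans _ _ _ Hh (Rmin_l _ _).
  have e23 := Rlt_le_trans _ _ _ Hh (Rmin_r _ _).
  have h2 := H2 h (Rlt_le_trans _ _ _ e23 (Rmin_l _ _)).
  have h3 := H3 h (Rlt_le_trans _ _ _ e23 (Rmin_r _ _)).
  set k := (g (s + h) - g s)%C.
  have Ek : g (s + h)%C = (g s + k)%C by rewrite /k; ring.
  have hk : Cmod k < d1.
  { apply Rle_lt_trans with (1 := h3).
    have -> : d1 = K * (d1 / K) by field; lra.
    by apply Rmult_lt_compat_l. }
  have h1 := H1 k hk.
  rewrite Ek.
  have -> : (f (g s + k) - f (g s) - l * m * h = (f (g s + k) - f (g s) - l * k) + l * (k - m * h))%C by ring.
  apply Rle_trans with (1 := Cmod_triangle _ _).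
  rewrite Cmod_mult.
  have p0 := Cmod_ge_0 h.
  have a1 : eps / (2 * K) * Cmod k <= eps / 2 * Cmod h.
  { apply Rle_trans with (eps / (2 * K) * (K * Cmod h)).
    - apply Rmult_le_compat_l => //. apply Rlt_le, Rdiv_lt_0_compat; lra.
    - apply Req_le; field; lra. }
  have a2 : Cmod l * Cmod (k - m * h)%C <= eps / 2 * Cmod h.
  { apply Rle_trans with ((Cmod l + 1) * (eps / (2 * (Cmod l + 1)) * Cmod h)).
    - apply Rmult_le_compat => //; try apply Cmod_ge_0. lra.
    - apply Req_le; field; lra. }
  lra.
Qed.

(** * The complex exponential and its quadratic remainder *)

Lemma Cexp_plus (a b : C) : Cexp (a + b)%C = (Cexp a * Cexp b)%C.
Proof.
  rewrite /Cexp. apply injective_projections => /=;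
  rewrite /Re /Im /= exp_plus ?cos_plus ?sin_plus; ring.
Qed.

Lemma Cmod_Cexp (a : C) : Cmod (Cexp a) = exp (Re a).
Proof.
  rewrite /Cmod /Cexp /=.
  have -> : (exp (Re a) * cos (Im a) * (exp (Re a) * cos (Im a) * 1) +
     exp (Re a) * sin (Im a) * (exp (Re a) * sin (Im a) * 1)
     = (exp (Re a))^2 * (Rsqr (sin (Im a)) + Rsqr (cos (Im a)))) by rewrite /Rsqr; ring.
  rewrite sin2_cos2 Rmult_1_r. apply sqrt_pow2. apply Rlt_le, exp_pos.
Qed.

Lemma Cexp_R (x : R) : Cexp (RtoC x) = RtoC (exp x).
Proof. rewrite /Cexp /RtoC /= cos_0 sin_0. f_equal; ring. Qed.

Lemma Cexp_0 : Cexp (RtoC 0) = RtoC 1.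
Proof. by rewrite Cexp_R exp_0. Qed.

Lemma mvt_bound (f df : R -> R) (a b M : R) : a <= b ->
  (forall t, a <= t <= b -> is_derive f t (df t)) ->
  (forall t, a <= t <= b -> Rabs (df t) <= M) -> Rabs (f b - f a) <= M * (b - a).
Proof.
  move=> Hab Hd HM.
  have [c [Hc ->]] : exists c, a <= c <= b /\ f b - f a = df c * (b - a).
  { have := MVT_gen f a b df. rewrite Rmin_left // Rmax_right //.
    case.
    - move=> x Hx; apply Hd; lra.
    - move=> x Hx. apply continuity_pt_filterlim.
      apply: ex_derive_continuous. exists (df x). apply Hd; lra.
    - move=> c Hc. by exists c. }
  rewrite Rabs_mult (Rabs_pos_eq (b - a)); last lra.
  apply Rmult_le_compat_r; [lra | by apply HM].
Qed.

Lemma mvt_bound_sym (f df : R -> R) (x M : R) :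
  (forall t, Rabs t <= Rabs x -> is_derive f t (df t)) ->
  (forall t, Rabs t <= Rabs x -> Rabs (df t) <= M) -> Rabs (f x - f 0) <= M * Rabs x.
Proof.
  move=> Hd HM.
  case: (Rle_lt_dec 0 x) => hx.
  - have := mvt_bound f df 0 x M hx.
    rewrite (Rabs_pos_eq x hx) Rminus_0_r in Hd HM *.
    apply => t Ht; [apply Hd|apply HM]; rewrite Rabs_pos_eq; lra.
  - have := mvt_bound f df x 0 M (Rlt_le _ _ hx).
    rewrite (Rabs_left x hx) in Hd HM *.
    have -> : 0 - x = - x by ring.
    rewrite Rabs_minus_sym.
    apply => t Ht; [apply Hd|apply HM]; rewrite Rabs_left1; lra.
Qed.

Lemma exp_le_abs (t x : R) : Rabs t <= Rabs x -> exp t <= exp (Rabs x).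
Proof. move=> H. have := Rle_abs t => H1. case: (Rle_lt_or_eq_dec t (Rabs x)); first lra.
  - move=> h; left; by apply exp_increasing.
  - move=> ->; lra. Qed.

Lemma exp_m1_bound (x : R) : Rabs (exp x - 1) <= exp (Rabs x) * Rabs x.
Proof.
  have -> : exp x - 1 = exp x - exp 0 by rewrite exp_0.
  apply (mvt_bound_sym exp exp x) => t Ht.
  - auto_derive => //. ring.
  - rewrite Rabs_pos_eq; [by apply exp_le_abs | apply Rlt_le, exp_pos].
Qed.

Lemma exp_m1x_bound (x : R) : Rabs (exp x - 1 - x) <= exp (Rabs x) * Rabs x * Rabs x.
Proof.
  have -> : exp x - 1 - x = (fun t => exp t - t) x - (fun t => exp t - t) 0 by rewrite /= exp_0; ring.
  apply (mvt_bound_sym (fun t => exp t - t) (fun t => exp t - 1) x) => t Ht.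
  - auto_derive => //. ring.
  - apply Rle_trans with (1 := exp_m1_bound t).
    apply Rmult_le_compat => //; try apply Rabs_pos; try (apply Rlt_le, exp_pos).
    apply exp_le_abs. by rewrite Rabs_Rabsolu.
Qed.

Lemma Rabs_cos_le (t : R) : Rabs (cos t) <= 1.
Proof. apply Rabs_le. have := COS_bound t; lra. Qed.
Lemma Rabs_sin_le (t : R) : Rabs (sin t) <= 1.
Proof. apply Rabs_le. have := SIN_bound t; lra. Qed.

Lemma Rabs_sin_le_id (x : R) : Rabs (sin x) <= Rabs x.
Proof.
  have -> : sin x = sin x - sin 0 by rewrite /= ?sin_0; ring.
  apply Rle_trans with (1 * Rabs x); last lra.
  apply (mvt_bound_sym sin cos x) => t Ht.
  - auto_derive => //; ring.
  - apply Rabs_cos_le.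
Qed.

Lemma cos_m1_bound (x : R) : Rabs (cos x - 1) <= Rabs x * Rabs x.
Proof.
  have -> : cos x - 1 = cos x - cos 0 by rewrite cos_0.
  apply (mvt_bound_sym cos (fun t => - sin t) x) => t Ht.
  - auto_derive => //; ring.
  - rewrite Rabs_Ropp. have := Rabs_sin_le_id t; lra.
Qed.

Lemma sin_mx_bound (x : R) : Rabs (sin x - x) <= 2 * (Rabs x * Rabs x).
Proof.
  have -> : sin x - x = (fun t => sin t - t) x - (fun t => sin t - t) 0 by rewrite /= ?sin_0; ring.
  have [h|h] := Rle_lt_dec (Rabs x) 1; last first.
  { apply Rle_trans with (2 * Rabs x); last (have := Rabs_pos x; nra).
    apply Rle_trans with (2 * Rabs x); last lra.
    apply (mvt_bound_sym (fun t => sin t - t) (fun t => cos t - 1) x) => t Ht.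
    - auto_derive => //; ring.
    - apply Rle_trans with (1 := Rabs_triang _ _). rewrite Rabs_Ropp Rabs_R1.
      have := Rabs_cos_le t; lra. }
  apply Rle_trans with ((Rabs x * Rabs x) * Rabs x); last (have := Rabs_pos x; nra).
  apply (mvt_bound_sym (fun t => sin t - t) (fun t => cos t - 1) x) => t Ht.
  - auto_derive => //; ring.
  - apply Rle_trans with (1 := cos_m1_bound t). have := Rabs_pos t. nra.
Qed.

Lemma exp_le_mono (x y : R) : x <= y -> exp x <= exp y.
Proof. case=> [h|->]; [left; by apply exp_increasing | lra]. Qed.

(** The bound has to be global, hence the factor [exp (Cmod z)]: besides the derivative of [Cexp] it
    serves for differentiation under the half-line integral, where z = h v is unbounded. The four
    pieces add up to 5, which 8 covers. *)
Lemma Cexp_m1z_bound (z : C) : Cmod (Cexp z - 1 - z)%C <= 8 * (Cmod z * Cmod z * exp (Cmod z)).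
Proof.
  set x := Re z. set y := Im z.
  have Ez : z = (x, y) by rewrite /x /y; case: (z).
  have hx : Rabs x <= Cmod z by apply re_le_Cmod.
  have hy : Rabs y <= Cmod z by apply im_le_Cmod.
  have px := Rabs_pos x. have py := Rabs_pos y.
  apply Rle_trans with (1 := Cmod_le_re_im _).
  have -> : Re (Cexp z - 1 - z)%C = (exp x - 1 - x) + exp x * (cos y - 1).
  { rewrite Ez /Cexp /Re /Im /=. ring. }
  have -> : Im (Cexp z - 1 - z)%C = exp x * (sin y - y) + y * (exp x - 1).
  { rewrite Ez /Cexp /Re /Im /=. ring. }
  set m := Cmod z in hx hy *.
  have he : exp (Rabs x) <= exp m by apply exp_le_mono.
  have he' : exp x <= exp m by apply exp_le_mono; have := Rle_abs x; lra.
  have pe := exp_pos m. have pe2 := exp_pos (Rabs x). have pe3 := exp_pos x.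
  have pm : 0 <= m by lra.
  have b1 : Rabs (exp x - 1 - x) <= exp m * (m * m).
  { apply Rle_trans with (1 := exp_m1x_bound x). rewrite Rmult_assoc.
    apply Rmult_le_compat; try lra; try nra. }
  have b2 : Rabs (exp x * (cos y - 1)) <= exp m * (m * m).
  { rewrite Rabs_mult (Rabs_pos_eq (exp x)); last lra.
    apply Rmult_le_compat; try lra; try apply Rabs_pos.
    apply Rle_trans with (1 := cos_m1_bound y). nra. }
  have b3 : Rabs (exp x * (sin y - y)) <= exp m * (2 * (m * m)).
  { rewrite Rabs_mult (Rabs_pos_eq (exp x)); last lra.
    apply Rmult_le_compat; try lra; try apply Rabs_pos.
    apply Rle_trans with (1 := sin_mx_bound y). nra. }
  have b4 : Rabs (y * (exp x - 1)) <= exp m * (m * m).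
  { rewrite Rabs_mult. 
    have h := exp_m1_bound x.
    apply Rle_trans with (m * (exp m * m)); last nra.
    apply Rmult_le_compat; try lra; try apply Rabs_pos.
    apply Rle_trans with (1 := h). apply Rmult_le_compat; lra. }
  have t1 := Rabs_triang (exp x - 1 - x) (exp x * (cos y - 1)).
  have t2 := Rabs_triang (exp x * (sin y - y)) (y * (exp x - 1)).
  have : 0 <= exp m * (m * m) by nra.
  lra.
Qed.

Lemma cder_Cexp (s : C) : cder Cexp s (Cexp s).
Proof.
  move=> eps He.
  set K := 8 * exp (Re s) * exp 1.
  have hK : 0 < K by rewrite /K; have := exp_pos (Re s); have := exp_pos 1; nra.
  exists (Rmin 1 (eps / K)); split.
  { apply Rmin_pos; [lra| by apply Rdiv_lt_0_compat]. }
  move=> h Hh.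
  have h1 := Rlt_le_trans _ _ _ Hh (Rmin_l _ _).
  have h2 := Rlt_le_trans _ _ _ Hh (Rmin_r _ _).
  rewrite Cexp_plus.
  have -> : (Cexp s * Cexp h - Cexp s - Cexp s * h = Cexp s * (Cexp h - 1 - h))%C by ring.
  rewrite Cmod_mult Cmod_Cexp.
  have p0 := Cmod_ge_0 h.
  have e1 : exp (Cmod h) <= exp 1 by apply exp_le_mono; lra.
  apply Rle_trans with (exp (Re s) * (8 * (Cmod h * Cmod h * exp 1))).
  { apply Rmult_le_compat_l; first by apply Rlt_le, exp_pos.
    apply Rle_trans with (1 := Cexp_m1z_bound h).
    apply Rmult_le_compat_l; first lra.
    apply Rmult_le_compat_l => //; nra. }
  have -> : exp (Re s) * (8 * (Cmod h * Cmod h * exp 1)) = (K * Cmod h) * Cmod h by rewrite /K; ring.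
  apply Rmult_le_compat_r => //.
  have -> : eps = K * (eps / K) by field; lra.
  apply Rmult_le_compat_l; lra.
Qed.

Lemma cder_line_re (f : C -> C) (p q l : C) (t : R) : cder f (p + q * t)%C l ->
  is_derive (fun x : R => Re (f (p + q * x)%C)) t (Re (l * q)%C).
Proof.
  move=> H. apply is_derive_Reals => eps He.
  set K := Cmod q + 1. have hq := Cmod_ge_0 q.
  have [d [hd Hd]] := H (eps / 2 / K) ltac:(apply Rdiv_lt_0_compat; rewrite /K; lra).
  have hdk : 0 < d / K by apply Rdiv_lt_0_compat; rewrite /K; lra.
  exists (mkposreal _ hdk) => h hn /= hh.
  have ph := Rabs_pos h. have ph' : 0 < Rabs h by apply Rabs_pos_lt.
  have := Hd (q * h)%C.
  have -> : (p + q * t + q * h = p + q * RtoC (t + h))%C by rewrite RtoC_plus; ring.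
  rewrite Cmod_mult Cmod_R => Hb.
  have hb : Cmod q * Rabs h < d.
  { apply Rle_lt_trans with (K * Rabs h); first by rewrite /K; nra.
    have -> : d = K * (d / K) by field; rewrite /K; lra.
    apply Rmult_lt_compat_l => //; rewrite /K; lra. }
  have {}Hb := Hb hb.
  have -> : (Re (f (p + q * RtoC (t + h))%C) - Re (f (p + q * t)%C)) / h - Re (l * q)%C
     = Re (f (p + q * RtoC (t + h)) - f (p + q * t) - l * (q * h))%C / h.
  { rewrite /Re /Im /RtoC /=. field. done. }
  rewrite Rabs_div //.
  apply Rle_lt_trans with (eps / 2); last lra.
  apply (Rmult_le_reg_r (Rabs h)) => //.
  have -> : forall u, u / Rabs h * Rabs h = u by move=> u; field; lra.
  apply Rle_trans with (1 := re_le_Cmod _).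
  apply Rle_trans with (1 := Hb).
  have -> : eps / 2 / K * (Cmod q * Rabs h) = eps / 2 * Rabs h * (Cmod q / K) by field; rewrite /K; lra.
  have h1 : Cmod q / K <= 1.
  { apply (Rmult_le_reg_r K); first by rewrite /K; lra.
    have -> : Cmod q / K * K = Cmod q by field; rewrite /K; lra.
    rewrite /K; lra. }
  have : 0 <= eps / 2 * Rabs h by nra.
  nra.
Qed.

Lemma cder_line_im (f : C -> C) (p q l : C) (t : R) : cder f (p + q * t)%C l ->
  is_derive (fun x : R => Im (f (p + q * x)%C)) t (Im (l * q)%C).
Proof.
  move=> H.
  have := cder_line_re _ _ _ _ _ (cder_scal (- Ci)%C _ _ _ H).
  have -> : Re (- Ci * l * q)%C = Im (l * q)%C by rewrite /Re /Im /Ci /=; ring.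
  apply is_derive_ext => x. rewrite /Re /Im /Ci /=; ring.
Qed.

(** * Bisection of rectangles and line integrals *)

Lemma half_pow_small (w eps : R) : 0 < eps -> exists n, w * (/ 2) ^ n < eps.
Proof.
  move=> He. have [h|h] := Rle_lt_dec w 0.
  { exists 0%nat => /=. lra. }
  have [N HN] := pow_lt_1_zero (/2) ltac:(rewrite Rabs_pos_eq; lra) (eps / w) ltac:(by apply Rdiv_lt_0_compat).
  exists N. have := HN N (Nat.le_refl _).
  rewrite Rabs_pos_eq; last (apply pow_le; lra).
  move=> H. have -> : eps = w * (eps / w) by field; lra.
  by apply Rmult_lt_compat_l.
Qed.

Section Bisection.
Variable P : R -> R -> R -> R -> Prop.
Hypothesis Hsub : forall a b c d, a <= b -> c <= d ->
  P a ((a+b)/2) c ((c+d)/2) -> P ((a+b)/2) b c ((c+d)/2) ->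
  P a ((a+b)/2) ((c+d)/2) d -> P ((a+b)/2) b ((c+d)/2) d -> P a b c d.

Let step (q : (R * R) * (R * R)) : (R * R) * (R * R) :=
  let '((a, b), (c, d)) := q in
  let m := (a+b)/2 in let n := (c+d)/2 in
  match excluded_middle_informative (P a m c n),
        excluded_middle_informative (P m b c n),
        excluded_middle_informative (P a m n d) with
  | left _, left _, left _ => ((m, b), (n, d))
  | left _, left _, right _ => ((a, m), (n, d))
  | left _, right _, _ => ((m, b), (c, n))
  | right _, _, _ => ((a, m), (c, n))
  end.

Let bad (q : (R * R) * (R * R)) :=
  fst (fst q) <= snd (fst q) /\ fst (snd q) <= snd (snd q) /\
  ~ P (fst (fst q)) (snd (fst q)) (fst (snd q)) (snd (snd q)).

Let step_spec q : bad q -> bad (step q) /\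
  fst (fst q) <= fst (fst (step q)) /\ snd (fst (step q)) <= snd (fst q) /\
  fst (snd q) <= fst (snd (step q)) /\ snd (snd (step q)) <= snd (snd q) /\
  snd (fst (step q)) - fst (fst (step q)) = (snd (fst q) - fst (fst q)) * / 2 /\
  snd (snd (step q)) - fst (snd (step q)) = (snd (snd q) - fst (snd q)) * / 2.
Proof.
  case: q => [[a b] [c d]]; rewrite /bad /step /= => [[hab [hcd hP]]].
  do 3 (case: excluded_middle_informative => ? /=; last by repeat split => //; lra).
  repeat split; try lra. move=> h4. apply hP. exact: Hsub.
Qed.

(** Compactness in the form of bisection: if [P] failed, a quarter would fail again and again, and
    the nested rectangles would shrink to a point where the local hypothesis applies. It serves for
    Goursat's theorem and for boundedness of continuous functions; degenerate rectangles are
    allowed, so segments are covered as well. *)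
Lemma rect_induct a b c d : a <= b -> c <= d ->
  (forall x y, a <= x <= b -> c <= y <= d -> exists del, 0 < del /\
     forall a' b' c' d', a <= a' -> b' <= b -> c <= c' -> d' <= d ->
       a' <= x <= b' -> c' <= y <= d' -> b' - a' < del -> d' - c' < del -> P a' b' c' d') ->
  P a b c d.
Proof.
  move=> hab hcd Hloc. apply NNPP => hP.
  pose q n := Nat.iter n step ((a, b), (c, d)).
  have Hq n : bad (q n).
  { elim: n => [|n IH]; first by []. by apply (step_spec (q n)). }
  pose A n := fst (fst (q n)). pose B n := snd (fst (q n)).
  pose C' n := fst (snd (q n)). pose D n := snd (snd (q n)).
  have Sp n := proj2 (step_spec (q n) (Hq n)).
  have ab n : A n <= B n by apply (Hq n).
  have cd n : C' n <= D n by apply (Hq n).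
  have mA n m : (n <= m)%nat -> A n <= A m.
  { elim=> [|k hk IH]; first lra. apply Rle_trans with (1 := IH). apply (Sp k). }
  have mB n m : (n <= m)%nat -> B m <= B n.
  { elim=> [|k hk IH]; first lra. apply Rle_trans with (2 := IH). apply (Sp k). }
  have mC n m : (n <= m)%nat -> C' n <= C' m.
  { elim=> [|k hk IH]; first lra. apply Rle_trans with (1 := IH). apply (Sp k). }
  have mD n m : (n <= m)%nat -> D m <= D n.
  { elim=> [|k hk IH]; first lra. apply Rle_trans with (2 := IH). apply (Sp k). }
  have AB n m : A n <= B m.
  { case: (Nat.le_ge_cases n m) => h.
    - apply Rle_trans with (1 := mA _ _ h). exact: ab.
    - apply Rle_trans with (2 := mB _ _ h). exact: ab. }
  have CD n m : C' n <= D m.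
  { case: (Nat.le_ge_cases n m) => h.
    - apply Rle_trans with (1 := mC _ _ h). exact: cd.
    - apply Rle_trans with (2 := mD _ _ h). exact: cd. }
  have wA n : B n - A n = (b - a) * (/2)^n.
  { elim: n => [|n IH]; first by rewrite /A /B /=; ring.
    have := Sp n. rewrite -/(q (S n)) -/(A n) -/(B n). move=> [_ [_ [_ [_ [E _]]]]].
    rewrite /A /B /= E -/(A n) -/(B n) IH. simpl. ring. }
  have wC n : D n - C' n = (d - c) * (/2)^n.
  { elim: n => [|n IH]; first by rewrite /C' /D /=; ring.
    have := Sp n. move=> [_ [_ [_ [_ [_ E]]]]].
    rewrite /C' /D /= E -/(C' n) -/(D n) IH. simpl. ring. }
  have [x [Hx1 Hx2]] : exists x, is_lub (fun r => exists n, r = A n) x.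
  { have [x Hx] := completeness (fun r => exists n, r = A n)
      ltac:(by exists b => r [n ->]; apply (AB n 0%nat)) ltac:(by exists (A 0%nat), 0%nat).
    by exists x. }
  have [y [Hy1 Hy2]] : exists y, is_lub (fun r => exists n, r = C' n) y.
  { have [y Hy] := completeness (fun r => exists n, r = C' n)
      ltac:(by exists d => r [n ->]; apply (CD n 0%nat)) ltac:(by exists (C' 0%nat), 0%nat).
    by exists y. }
  have xA n : A n <= x by apply Hx1; exists n.
  have xB n : x <= B n by apply Hx2 => r [m ->].
  have yC n : C' n <= y by apply Hy1; exists n.
  have yD n : y <= D n by apply Hy2 => r [m ->].
  have [del [hdel H]] := Hloc x y (conj (xA 0%nat) (xB 0%nat)) (conj (yC 0%nat) (yD 0%nat)).
  have [n Hn] := half_pow_small (Rmax (b - a) (d - c)) del hdel.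
  have p : 0 <= (/2)^n by apply pow_le; lra.
  have h1 := Rmax_l (b - a) (d - c). have h2 := Rmax_r (b - a) (d - c).
  apply (proj2 (proj2 (Hq n))). apply H => //.
  - apply (mA 0%nat n); lia.
  - apply (mB 0%nat n); lia.
  - apply (mC 0%nat n); lia.
  - apply (mD 0%nat n); lia.
  - exact: (conj (xA n) (xB n)).
  - exact: (conj (yC n) (yD n)).
  - rewrite -/(A n) -/(B n) wA. nra.
  - rewrite -/(C' n) -/(D n) wC. nra.
Qed.
End Bisection.

(** * Integrals of complex functions of a real variable *)

Definition ccont (f : R -> C) (x : R) : Prop :=
  continuous (fun t => Re (f t)) x /\ continuous (fun t => Im (f t)) x.
Definition ccont_on (f : R -> C) (a b : R) : Prop :=
  forall x, Rmin a b <= x <= Rmax a b -> ccont f x.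
Definition cint (f : R -> C) (a b : R) : C :=
  (RInt (fun t => Re (f t)) a b, RInt (fun t => Im (f t)) a b).

Lemma ccont_on_re f a b : ccont_on f a b -> ex_RInt (fun t => Re (f t)) a b.
Proof. move=> H; apply: ex_RInt_continuous => z Hz; exact: (proj1 (H z Hz)). Qed.
Lemma ccont_on_im f a b : ccont_on f a b -> ex_RInt (fun t => Im (f t)) a b.
Proof. move=> H; apply: ex_RInt_continuous => z Hz; exact: (proj2 (H z Hz)). Qed.

Lemma ccont_on_sub f a b a' b' : a <= a' <= b -> a <= b' <= b -> ccont_on f a b -> ccont_on f a' b'.
Proof.
  move=> h1 h2 H x Hx. apply H.
  rewrite Rmin_left ?Rmax_right; try lra.
  move: Hx. rewrite /Rmin /Rmax. case: Rle_dec; lra.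
Qed.

Lemma cint_chasles f a b c : ccont_on f a b -> ccont_on f b c ->
  (cint f a b + cint f b c)%C = cint f a c.
Proof.
  move=> h1 h2. rewrite /cint /Cplus /=. f_equal.
  - apply (RInt_Chasles (fun t => Re (f t)) a b c); by apply ccont_on_re.
  - apply (RInt_Chasles (fun t => Im (f t)) a b c); by apply ccont_on_im.
Qed.

Lemma cint_swap f a b : ccont_on f a b -> cint f b a = (- cint f a b)%C.
Proof.
  move=> H. rewrite /cint /Copp /=. f_equal.
  - rewrite -(opp_RInt_swap (fun t => Re (f t)) a b) //. by apply ccont_on_re.
  - rewrite -(opp_RInt_swap (fun t => Im (f t)) a b) //. by apply ccont_on_im.
Qed.

Lemma cint_point f a : cint f a a = RtoC 0.
Proof. by rewrite /cint !RInt_point. Qed.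

Lemma cint_ext f g a b : (forall x, Rmin a b < x < Rmax a b -> f x = g x) -> cint f a b = cint g a b.
Proof. move=> H; rewrite /cint; f_equal; apply: RInt_ext => x Hx; by rewrite H. Qed.

Lemma cint_plus f g a b : ccont_on f a b -> ccont_on g a b ->
  cint (fun x => f x + g x)%C a b = (cint f a b + cint g a b)%C.
Proof.
  move=> hf hg. rewrite /cint /Cplus /=. f_equal.
  - apply (RInt_plus (fun t => Re (f t)) (fun t => Re (g t))); by apply ccont_on_re.
  - apply (RInt_plus (fun t => Im (f t)) (fun t => Im (g t))); by apply ccont_on_im.
Qed.

Lemma cint_scal (c : C) f a b : ccont_on f a b ->
  cint (fun x => c * f x)%C a b = (c * cint f a b)%C.
Proof.
  move=> hf. have h1 := ccont_on_re _ _ _ hf. have h2 := ccont_on_im _ _ _ hf.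
  rewrite /cint /Cmult /=. f_equal.
  - transitivity (RInt (fun t => minus (scal (fst c) (Re (f t))) (scal (snd c) (Im (f t)))) a b) => //.
    rewrite RInt_minus; [| by apply: ex_RInt_scal..].
    by rewrite !RInt_scal.
  - transitivity (RInt (fun t => plus (scal (fst c) (Im (f t))) (scal (snd c) (Re (f t)))) a b) => //.
    rewrite RInt_plus; [| by apply: ex_RInt_scal..].
    by rewrite !RInt_scal.
Qed.

Lemma ccont_plus f g x : ccont f x -> ccont g x -> ccont (fun t => f t + g t)%C x.
Proof.
  move=> [f1 f2] [g1 g2]; split.
  - by apply: (continuous_plus (fun t => Re (f t)) (fun t => Re (g t))).
  - by apply: (continuous_plus (fun t => Im (f t)) (fun t => Im (g t))).
Qed.

Lemma ccont_const c x : ccont (fun _ => c) x.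
Proof. split; apply continuous_const. Qed.

Lemma ccont_mult f g x : ccont f x -> ccont g x -> ccont (fun t => f t * g t)%C x.
Proof.
  move=> [f1 f2] [g1 g2]; split.
  - apply: (continuous_minus (fun t => Re (f t) * Re (g t)) (fun t => Im (f t) * Im (g t)));
    by apply: continuous_mult.
  - apply: (continuous_plus (fun t => Re (f t) * Im (g t)) (fun t => Im (f t) * Re (g t)));
    by apply: continuous_mult.
Qed.

Lemma ccont_ext f g x : (forall t, f t = g t) -> ccont f x -> ccont g x.
Proof. move=> E [h1 h2]; split; [move: h1|move: h2]; apply continuous_ext => t; by rewrite E. Qed.

(* The factor 2 pays for bounding real and imaginary parts separately. *)
Lemma cint_bound f a b M : a <= b -> ccont_on f a b ->
  (forall t, a <= t <= b -> Cmod (f t) <= M) -> Cmod (cint f a b) <= 2 * (M * (b - a)).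
Proof.
  move=> hab hf HM. apply Rle_trans with (1 := Cmod_le_re_im _).
  have h1 := abs_RInt_le_const _ a b M hab (ccont_on_re _ _ _ hf)
    (fun t Ht => Rle_trans _ _ _ (re_le_Cmod _) (HM t Ht)).
  have h2 := abs_RInt_le_const _ a b M hab (ccont_on_im _ _ _ hf)
    (fun t Ht => Rle_trans _ _ _ (im_le_Cmod _) (HM t Ht)).
  rewrite /cint /Re /Im /=. rewrite /Re /Im in h1 h2. lra.
Qed.

Lemma cder_hline (f : C -> C) (x y : R) (l : C) : cder f (x, y) l -> 
  is_derive (fun t : R => Re (f (t, y))) x (Re l) /\ is_derive (fun t : R => Im (f (t, y))) x (Im l).
Proof.
  move=> H.
  have E t : (((0, y) : C) + 1 * RtoC t)%C = (t, y).
  { rewrite /Cplus /Cmult /RtoC /=. f_equal; ring. }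
  have H' : cder f (((0, y) : C) + 1 * RtoC x)%C l by rewrite E.
  have h1 := cder_line_re _ _ _ _ _ H'. have h2 := cder_line_im _ _ _ _ _ H'.
  rewrite Cmult_1_r in h1 h2.
  split; [move: h1|move: h2]; apply is_derive_ext => t; by rewrite E.
Qed.

Lemma cder_vline (f : C -> C) (x y : R) (l : C) : cder f (x, y) l -> 
  is_derive (fun t : R => Re (f (x, t))) y (Re (Ci * l)%C) /\
  is_derive (fun t : R => Im (f (x, t))) y (Im (Ci * l)%C).
Proof.
  move=> H.
  have E t : (((x, 0) : C) + Ci * RtoC t)%C = (x, t).
  { rewrite /Cplus /Cmult /RtoC /=. f_equal; ring. }
  have H' : cder f (((x, 0) : C) + Ci * RtoC y)%C l by rewrite E.
  have h1 := cder_line_re _ _ _ _ _ H'. have h2 := cder_line_im _ _ _ _ _ H'.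
  rewrite Cmult_comm in h1 h2.
  split; [move: h1|move: h2]; apply is_derive_ext => t; by rewrite E.
Qed.

Lemma cder_hcont f x y l : cder f (x, y) l -> ccont (fun t => f (t, y)) x.
Proof. move=> /cder_hline [h1 h2]; split; apply: ex_derive_continuous; eexists; eassumption. Qed.
Lemma cder_vcont f x y l : cder f (x, y) l -> ccont (fun t => f (x, t)) y.
Proof. move=> /cder_vline [h1 h2]; split; apply: ex_derive_continuous; eexists; eassumption. Qed.

Lemma cint_derive (F f : R -> C) a b :
  (forall x, Rmin a b <= x <= Rmax a b ->
     is_derive (fun t => Re (F t)) x (Re (f x)) /\ is_derive (fun t => Im (F t)) x (Im (f x))) ->
  ccont_on f a b -> cint f a b = (F b - F a)%C.
Proof.
  move=> H hc.
  rewrite /cint /Cminus /Cplus /Copp /=. f_equal; apply is_RInt_unique.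
  - apply (is_RInt_derive (fun t => Re (F t)) (fun t => Re (f t))) => x Hx; [exact: (proj1 (H x Hx)) | exact: (proj1 (hc x Hx))].
  - apply (is_RInt_derive (fun t => Im (F t)) (fun t => Im (f t))) => x Hx; [exact: (proj2 (H x Hx)) | exact: (proj2 (hc x Hx))].
Qed.

(** * Goursat's theorem *)

Definition holo_rect (f : C -> C) (a b c d : R) : Prop :=
  forall x y, a <= x <= b -> c <= y <= d -> exists l, cder f (x, y) l.

Definition rect_int (f : C -> C) (a b c d : R) : C :=
  (cint (fun x => f (x, c)) a b + Ci * cint (fun y => f (b, y)) c d
   - cint (fun x => f (x, d)) a b - Ci * cint (fun y => f (a, y)) c d)%C.

Lemma holo_rect_hcont f a b c d y : a <= b -> c <= y <= d -> holo_rect f a b c d -> ccont_on (fun x => f (x, y)) a b.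
Proof.
  move=> hab hy H x. rewrite Rmin_left // Rmax_right // => hx.
  have [l Hl] := H x y hx hy. exact: cder_hcont Hl.
Qed.
Lemma holo_rect_vcont f a b c d x : c <= d -> a <= x <= b -> holo_rect f a b c d -> ccont_on (fun y => f (x, y)) c d.
Proof.
  move=> hab hx H y. rewrite Rmin_left // Rmax_right // => hy.
  have [l Hl] := H x y hx hy. exact: cder_vcont Hl.
Qed.

Lemma holo_rect_sub f a b c d a' b' c' d' : a <= a' -> b' <= b -> c <= c' -> d' <= d ->
  holo_rect f a b c d -> holo_rect f a' b' c' d'.
Proof. move=> h1 h2 h3 h4 H x y hx hy; apply H; lra. Qed.

Lemma rect_int_sub f a b c d m n : a <= m <= b -> c <= n <= d -> holo_rect f a b c d ->
  rect_int f a b c d = (rect_int f a m c n + rect_int f m b c n + rect_int f a m n d + rect_int f m b n d)%C.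
Proof.
  move=> hm hn H. rewrite /rect_int.
  have hh y : c <= y <= d -> cint (fun x => f (x, y)) a b = (cint (fun x => f (x, y)) a m + cint (fun x => f (x, y)) m b)%C.
  { move=> hy. have HH := holo_rect_hcont f a b c d y ltac:(lra) hy H.
    rewrite cint_chasles //; apply: (ccont_on_sub _ a b); try assumption; lra. }
  have hv x : a <= x <= b -> cint (fun y => f (x, y)) c d = (cint (fun y => f (x, y)) c n + cint (fun y => f (x, y)) n d)%C.
  { move=> hx. have HH := holo_rect_vcont f a b c d x ltac:(lra) hx H.
    rewrite cint_chasles //; apply: (ccont_on_sub _ c d); try assumption; lra. }
  rewrite (hh c ltac:(lra)) (hh d ltac:(lra)) (hv a ltac:(lra)) (hv b ltac:(lra)). ring.
Qed.

Lemma rect_int_plus f g a b c d : a <= b -> c <= d -> holo_rect f a b c d -> holo_rect g a b c d ->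
  rect_int (fun z => f z + g z)%C a b c d = (rect_int f a b c d + rect_int g a b c d)%C.
Proof.
  move=> hab hcd Hf Hg. rewrite /rect_int.
  rewrite !(cint_plus (fun x => f (x, _)) (fun x => g (x, _))) ?(cint_plus (fun y => f (_, y)) (fun y => g (_, y))); first ring;
  first [apply: (holo_rect_hcont _ a b c d) | apply: (holo_rect_vcont _ a b c d)]; try assumption; lra.
Qed.

Lemma rect_int_bound f a b c d M : a <= b -> c <= d -> holo_rect f a b c d ->
  (forall x y, a <= x <= b -> c <= y <= d -> Cmod (f (x, y)) <= M) ->
  Cmod (rect_int f a b c d) <= 4 * M * ((b - a) + (d - c)).
Proof.
  move=> hab hcd H HM. rewrite /rect_int.
  have b1 := cint_bound (fun x => f (x, c)) a b M hab ltac:(apply: (holo_rect_hcont _ a b c d); lra || assumption) (fun t Ht => HM t c Ht ltac:(lra)).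
  have b2 := cint_bound (fun x => f (x, d)) a b M hab ltac:(apply: (holo_rect_hcont _ a b c d); lra || assumption) (fun t Ht => HM t d Ht ltac:(lra)).
  have b3 := cint_bound (fun y => f (a, y)) c d M hcd ltac:(apply: (holo_rect_vcont _ a b c d); lra || assumption) (fun t Ht => HM a t ltac:(lra) Ht).
  have b4 := cint_bound (fun y => f (b, y)) c d M hcd ltac:(apply: (holo_rect_vcont _ a b c d); lra || assumption) (fun t Ht => HM b t ltac:(lra) Ht).
  apply Rle_trans with (1 := Cmod_triangle' _ _).
  apply Rle_trans with (1 := Rplus_le_compat_r _ _ _ (Cmod_triangle' _ _)).
  apply Rle_trans with (1 := Rplus_le_compat_r _ _ _ (Rplus_le_compat_r _ _ _ (Cmod_triangle _ _))).
  rewrite !Cmod_mult Cmod_Ci. lra.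
Qed.

Lemma cder_affine p q s : cder (fun z => p + q * z)%C s q.
Proof.
  have := cder_plus _ _ _ _ _ (cder_const p s) (cder_scal q _ _ _ (cder_id s)).
  by have -> : (0 + q * 1 = q)%C by ring.
Qed.

Lemma rect_int_affine p q a b c d : a <= b -> c <= d -> rect_int (fun z => p + q * z)%C a b c d = RtoC 0.
Proof.
  move=> hab hcd.
  pose F z := (p * z + (q / 2) * (z * z))%C.
  have HF z : cder F z (p + q * z)%C.
  { have := cder_plus _ _ _ _ _ (cder_scal p _ _ _ (cder_id z))
      (cder_scal (q/2)%C _ _ _ (cder_mult _ _ _ _ _ (cder_id z) (cder_id z))).
    have -> // : (p * 1 + q / 2 * (1 * z + z * 1) = p + q * z)%C.
    field. }
  have Hh : holo_rect (fun z => p + q * z)%C a b c d by move=> x y _ _; exists q; apply cder_affine.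
  have E1 y : c <= y <= d -> cint (fun x => p + q * (x, y))%C a b = (F (b, y) - F (a, y))%C.
  { move=> hy. apply (cint_derive (fun x => F (x, y))) => [x _|].
    - exact: cder_hline (HF _).
    - apply: (holo_rect_hcont (fun z => p + q * z)%C a b c d) => //. }
  have E2 x : a <= x <= b -> (Ci * cint (fun y => p + q * (x, y)) c d)%C = (F (x, d) - F (x, c))%C.
  { move=> hx.
    rewrite -cint_scal; last by apply: (holo_rect_vcont (fun z => p + q * z)%C a b c d).
    apply (cint_derive (fun y => F (x, y))) => [y _|].
    - exact: cder_vline (HF _).
    - move=> y hy. apply ccont_mult; first by apply ccont_const.
      by apply: (holo_rect_vcont (fun z => p + q * z)%C a b c d) => //. }
  rewrite /rect_int E1 ?E1 ?E2 ?E2; try lra. ring.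
Qed.

Lemma Cmod_pair_le (x y : R) : Cmod (x, y) <= Rabs x + Rabs y.
Proof. exact: (Cmod_le_re_im (x, y)). Qed.

(** The square of the half-perimeter is the right majorant for bisection: each of the four quarters
    carries a quarter of it. Near a point only the error of the affine approximation contributes,
    and the accuracy [eps / 4] cancels the factor 4 of [rect_int_bound]. *)
Lemma goursat_eps f a b c d eps : 0 < eps -> a <= b -> c <= d -> holo_rect f a b c d ->
  Cmod (rect_int f a b c d) <= eps * ((b - a) + (d - c)) ^ 2.
Proof.
  move=> He hab hcd Hf.
  pose P a' b' c' d' := a <= a' -> b' <= b -> c <= c' -> d' <= d -> a' <= b' -> c' <= d' ->
    Cmod (rect_int f a' b' c' d') <= eps * ((b' - a') + (d' - c')) ^ 2.
  suff : P a b c d by apply; lra.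
  apply (rect_induct P) => //.
  - move=> a' b' c' d' hab' hcd' P1 P2 P3 P4 h1 h2 h3 h4 h5 h6.
    set m := (a' + b') / 2 in P1 P2 P3 P4. set n := (c' + d')/2 in P1 P2 P3 P4.
    rewrite (rect_int_sub _ _ _ _ _ m n); [|rewrite /m; lra|rewrite /n; lra|apply: (holo_rect_sub _ a b c d) => //].
    apply Rle_trans with (1 := Cmod_triangle _ _).
    apply Rle_trans with (1 := Rplus_le_compat_r _ _ _ (Cmod_triangle _ _)).
    apply Rle_trans with (1 := Rplus_le_compat_r _ _ _ (Rplus_le_compat_r _ _ _ (Cmod_triangle _ _))).
    have := P1 ltac:(rewrite /m; lra) ltac:(rewrite /m; lra) ltac:(rewrite /n; lra) ltac:(rewrite /n; lra) ltac:(rewrite /m; lra) ltac:(rewrite /n; lra).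
    have := P2 ltac:(rewrite /m; lra) ltac:(rewrite /m; lra) ltac:(rewrite /n; lra) ltac:(rewrite /n; lra) ltac:(rewrite /m; lra) ltac:(rewrite /n; lra).
    have := P3 ltac:(rewrite /m; lra) ltac:(rewrite /m; lra) ltac:(rewrite /n; lra) ltac:(rewrite /n; lra) ltac:(rewrite /m; lra) ltac:(rewrite /n; lra).
    have := P4 ltac:(rewrite /m; lra) ltac:(rewrite /m; lra) ltac:(rewrite /n; lra) ltac:(rewrite /n; lra) ltac:(rewrite /m; lra) ltac:(rewrite /n; lra).
    have -> : m - a' = (b' - a') / 2 by rewrite /m; field.
    have -> : b' - m = (b' - a') / 2 by rewrite /m; field.
    have -> : n - c' = (d' - c') / 2 by rewrite /n; field.
    have -> : d' - n = (d' - c') / 2 by rewrite /n; field.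
    lra.
  - move=> x y hx hy.
    have [l Hl] := Hf x y hx hy.
    have [del [hdel Hd]] := Hl (eps / 4) ltac:(lra).
    exists (del / 2); split; first lra.
    move=> a' b' c' d' h1 h2 h3 h4 h5 h6 h7 h8 _ _ _ _ hab' hcd'.
    set z0 : C := (x, y).
    (* [g] is [f] minus its affine approximation at [z0]; the affine part has a primitive, so both
       functions have the same boundary integral. *)
    pose g z := (f z + ((- f z0 + l * z0) + (- l) * z))%C.
    have Hg : holo_rect g a' b' c' d'.
    { move=> u v hu hv. have [k Hk] := Hf u v ltac:(lra) ltac:(lra).
      eexists. apply: cder_plus; [exact: Hk | apply cder_affine]. }
    have hfs : holo_rect f a' b' c' d' by apply: (holo_rect_sub _ a b c d).
    have -> : rect_int f a' b' c' d' = rect_int g a' b' c' d'.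
    { rewrite /g (rect_int_plus f) //.
      - rewrite rect_int_affine //. ring.
      - move=> u v _ _; eexists; apply cder_affine. }
    apply Rle_trans with (4 * (eps / 4 * ((b' - a') + (d' - c'))) * ((b' - a') + (d' - c'))); last (simpl; lra).
    apply rect_int_bound => // u v hu hv.
    pose h : C := (u - x, v - y).
    have Eh : ((u, v) : C) = (z0 + h)%C by rewrite /z0 /h /Cplus /=; f_equal; ring.
    have hh : Cmod h <= (b' - a') + (d' - c').
    { apply Rle_trans with (1 := Cmod_pair_le _ _).
      apply Rplus_le_compat; apply Rabs_le; lra. }
    have := Hd h ltac:(lra).
    rewrite Eh /g.
    have -> : (f (z0 + h) + (- f z0 + l * z0 + - l * (z0 + h)) = f (z0 + h) - f z0 - l * h)%C by ring.
    move=> H. apply Rle_trans with (1 := H). apply Rmult_le_compat_l; lra.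
Qed.

Lemma goursat f a b c d : a <= b -> c <= d -> holo_rect f a b c d -> rect_int f a b c d = RtoC 0.
Proof.
  move=> hab hcd H. apply Ceq_eps => e he.
  have -> : (rect_int f a b c d - 0 = rect_int f a b c d)%C by ring.
  set w := ((b - a) + (d - c)) ^ 2.
  have hw : 0 <= w by apply pow2_ge_0.
  have h1 : 0 < e / (w + 1) by apply Rdiv_lt_0_compat; lra.
  apply Rle_trans with (1 := goursat_eps f a b c d _ h1 hab hcd H). rewrite -/w.
  apply Rle_trans with (e / (w + 1) * (w + 1)); [apply Rmult_le_compat_l; lra | apply Req_le; field; lra].
Qed.

(** * Primitives and the maximum principle *)

Lemma cint_bound_abs f a b M : ccont_on f a b ->
  (forall t, Rmin a b <= t <= Rmax a b -> Cmod (f t) <= M) -> Cmod (cint f a b) <= 2 * (M * Rabs (b - a)).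
Proof.
  move=> hf HM. case: (Rle_lt_dec a b) => hab.
  - rewrite Rabs_pos_eq; last lra. rewrite Rmin_left // Rmax_right // in HM. by apply cint_bound.
  - have hf' : ccont_on f b a by move=> x hx; apply hf; rewrite Rmin_comm Rmax_comm.
    rewrite cint_swap // Cmod_opp Rabs_minus_sym Rabs_pos_eq; last lra.
    rewrite Rmin_right ?Rmax_left in HM; try lra. apply cint_bound => //; lra.
Qed.

Lemma cint_const (c : C) (a b : R) : cint (fun _ => c) a b = (c * RtoC (b - a))%C.
Proof. rewrite /cint !RInt_const /scal /= /mult /= /Cmult /RtoC /=. f_equal; rewrite /Re /Im; ring. Qed.

Lemma interior_radius a b c d x y : a < x < b -> c < y < d ->
  exists r, 0 < r /\ r <= x - a /\ r <= b - x /\ r <= y - c /\ r <= d - y.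
Proof.
  move=> hx hy. exists (Rmin (Rmin (x - a) (b - x)) (Rmin (y - c) (d - y))).
  split; first by repeat apply Rmin_pos; lra.
  have := Rmin_l (Rmin (x - a) (b - x)) (Rmin (y - c) (d - y)).
  have := Rmin_r (Rmin (x - a) (b - x)) (Rmin (y - c) (d - y)).
  have := Rmin_l (x - a) (b - x). have := Rmin_r (x - a) (b - x).
  have := Rmin_l (y - c) (d - y). have := Rmin_r (y - c) (d - y). lra.
Qed.

Section Primitive.
Variables (f : C -> C) (a b c d : R).
Hypotheses (hab : a <= b) (hcd : c <= d) (Hf : holo_rect f a b c d).

(* The path starts at the right-hand corner [(b, c)], so that the primitive vanishes
   wherever [f] vanishes on a whole right-hand strip of the rectangle. *)
Definition primitive (z : C) : C :=
  (cint (fun t => f (t, c)) b (Re z) + Ci * cint (fun t => f (Re z, t)) c (Im z))%C.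

Let hh x x' y : a <= x <= b -> a <= x' <= b -> c <= y <= d -> ccont_on (fun t => f (t, y)) x x'.
Proof. move=> h1 h2 h3. apply: (ccont_on_sub _ a b) => //. exact: (holo_rect_hcont _ _ _ c d). Qed.
Let hv x y y' : a <= x <= b -> c <= y <= d -> c <= y' <= d -> ccont_on (fun t => f (x, t)) y y'.
Proof. move=> h1 h2 h3. apply: (ccont_on_sub _ c d) => //. exact: (holo_rect_vcont _ a b). Qed.

(** Goursat on the rectangle between x and x' and between c and y lifts the horizontal piece of the
    path from height c to height y, which leaves a short path near the point. The case distinction
    only orients that rectangle. *)
Lemma primitive_diff x y x' y' : a <= x <= b -> a <= x' <= b -> c <= y <= d -> c <= y' <= d ->
  (primitive (x', y') - primitive (x, y))%C =
  (cint (fun t => f (t, y)) x x' + Ci * cint (fun t => f (x', t)) y y')%C.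
Proof.
  move=> hx hx' hy hy'.
  have E : (cint (fun t => f (t, c)) x x' + Ci * cint (fun t => f (x', t)) c y
   = cint (fun t => f (t, y)) x x' + Ci * cint (fun t => f (x, t)) c y)%C.
  { case: (Rle_lt_dec x x') => hxx.
    - have := goursat f x x' c y hxx ltac:(lra) ltac:(apply: (holo_rect_sub _ a b c d) => //; lra).
      rewrite /rect_int => E0.
      have -> : (cint (fun t => f (t, c)) x x' + Ci * cint (fun t => f (x', t)) c y =
        (cint (fun t => f (t, c)) x x' + Ci * cint (fun t => f (x', t)) c y - cint (fun t => f (t, y)) x x' - Ci * cint (fun t => f (x, t)) c y)
        + (cint (fun t => f (t, y)) x x' + Ci * cint (fun t => f (x, t)) c y))%C by ring.
      rewrite E0; ring.
    - have := goursat f x' x c y ltac:(lra) ltac:(lra) ltac:(apply: (holo_rect_sub _ a b c d) => //; lra).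
      rewrite /rect_int => E0.
      rewrite (cint_swap (fun t => f (t, c)) x' x); last by apply hh; lra.
      rewrite (cint_swap (fun t => f (t, y)) x' x); last by apply hh; lra.
      have -> : (- cint (fun t => f (t, c)) x' x + Ci * cint (fun t => f (x', t)) c y =
       - (cint (fun t => f (t, c)) x' x + Ci * cint (fun t => f (x, t)) c y - cint (fun t => f (t, y)) x' x - Ci * cint (fun t => f (x', t)) c y)
        + (- cint (fun t => f (t, y)) x' x + Ci * cint (fun t => f (x, t)) c y))%C by ring.
      rewrite E0; ring. }
  rewrite /primitive /Re /Im /=.
  rewrite -(cint_chasles (fun t => f (t, c)) b x x'); [|apply hh; lra|apply hh; lra].
  rewrite -(cint_chasles (fun t => f (x', t)) c y y'); [|apply hv; lra|apply hv; lra].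
  transitivity ((cint (fun t => f (t, c)) x x' + Ci * cint (fun t => f (x', t)) c y)
    + Ci * cint (fun t => f (x', t)) y y' - Ci * cint (fun t => f (x, t)) c y)%C; first ring.
  rewrite E. ring.
Qed.

Lemma primitive_cder x y : a < x < b -> c < y < d -> cder primitive (x, y) (f (x, y)).
Proof.
  move=> hx hy eps he.
  have [l Hl] := Hf x y ltac:(lra) ltac:(lra).
  have [del [hdel Hd]] := cder_cont _ _ _ Hl (eps / 4) ltac:(lra).
  have [r [hr [hr1 [hr2 [hr3 hr4]]]]] := interior_radius a b c d x y hx hy.
  exists (Rmin (del / 2) r); split; first by apply Rmin_pos; lra.
  move=> [u v] hm.
  have m1 := Rlt_le_trans _ _ _ hm (Rmin_l _ _). have m2 := Rlt_le_trans _ _ _ hm (Rmin_r _ _).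
  have hu : Rabs u <= Cmod (u, v) by apply (re_le_Cmod (u, v)).
  have hv' : Rabs v <= Cmod (u, v) by apply (im_le_Cmod (u, v)).
  have hu2 : - r < u < r by have := Rabs_def2 u r ltac:(lra); lra.
  have hv2 : - r < v < r by have := Rabs_def2 v r ltac:(lra); lra.
  have -> : (((x, y) : C) + (u, v))%C = (x + u, y + v) by [].
  rewrite primitive_diff; try lra.
  set x1 := x + u. set y1 := y + v.
  have c1 : ccont_on (fun t => f (t, y)) x x1 by apply hh; rewrite /x1; lra.
  have c2 : ccont_on (fun t => f (x1, t)) y y1 by apply hv; rewrite /x1 /y1; lra.
  have -> : (cint (fun t => f (t, y)) x x1 + Ci * cint (fun t => f (x1, t)) y y1 - f (x, y) * (u, v))%C
   = (cint (fun t => f (t, y) + - f (x, y)) x x1 + Ci * cint (fun t => f (x1, t) + - f (x, y)) y y1)%C.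
  { rewrite (cint_plus (fun t => f (t, y)) (fun _ => - f (x, y))%C) //; last by move=> ? _; apply ccont_const.
    rewrite (cint_plus (fun t => f (x1, t)) (fun _ => - f (x, y))%C) //; last by move=> ? _; apply ccont_const.
    rewrite !cint_const.
    have -> : x1 - x = u by rewrite /x1; ring. have -> : y1 - y = v by rewrite /y1; ring.
    have -> : ((u, v) : C) = (RtoC u + Ci * RtoC v)%C by rewrite /Cplus /Cmult /RtoC /=; f_equal; ring.
    ring. }
  have key : forall p q, Rabs p <= Rabs u -> Rabs q <= Rabs v -> Cmod (f ((x + p)%R, (y + q)%R) + - f (x, y))%C <= eps / 4.
  { move=> p q hp hq. left.
    apply (Hd (p, q)). apply Rle_lt_trans with (1 := Cmod_pair_le _ _). lra. }
  have b1 := cint_bound_abs (fun t => f (t, y) + - f (x, y))%C x x1 (eps / 4)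
    ltac:(by move=> t ht; apply ccont_plus; [apply c1| apply ccont_const]).
  have b2 := cint_bound_abs (fun t => f (x1, t) + - f (x, y))%C y y1 (eps / 4)
    ltac:(by move=> t ht; apply ccont_plus; [apply c2| apply ccont_const]).
  have rng : forall p q t, Rmin p (p + q) <= t <= Rmax p (p + q) -> Rabs (t - p) <= Rabs q.
  { move=> p q t. rewrite /Rmin /Rmax /Rabs. case: Rle_dec => ? ; case: Rcase_abs => ?; case: Rcase_abs => ? ?; lra. }
  apply Rle_trans with (1 := Cmod_triangle _ _). rewrite Cmod_mult Cmod_Ci.
  have e1 : x1 - x = u by rewrite /x1; ring. have e2 : y1 - y = v by rewrite /y1; ring.
  rewrite e1 in b1. rewrite e2 in b2.
  have {}b1 : Cmod (cint (fun t => f (t, y) + - f (x, y))%C x x1) <= 2 * (eps / 4 * Rabs u).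
  { apply b1 => t ht. have ht' := ht. rewrite /x1 in ht'. have := key (t - x) 0 (rng _ _ _ ht') ltac:(rewrite Rabs_R0; apply Rabs_pos).
    have -> : x + (t - x) = t by ring. by rewrite Rplus_0_r. }
  have {}b2 : Cmod (cint (fun t => f (x1, t) + - f (x, y))%C y y1) <= 2 * (eps / 4 * Rabs v).
  { apply b2 => t ht. have ht' := ht. rewrite /y1 in ht'. have := key u (t - y) (Rle_refl _) (rng _ _ _ ht').
    by have -> : y + (t - y) = t by ring. }
  nra.
Qed.

Lemma primitive_zero x3 x y : a <= x3 -> x3 <= x <= b -> c <= y <= d ->
  (forall u v, x3 <= u <= b -> c <= v <= d -> f (u, v) = RtoC 0) -> primitive (x, y) = RtoC 0.
Proof.
  move=> h3 hx hy H0. rewrite /primitive /Re /Im /=.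
  rewrite (cint_ext _ (fun _ => RtoC 0)).
  - rewrite (cint_ext (fun t => f (x, t)) (fun _ => RtoC 0)).
    + rewrite !cint_const. ring.
    + move=> t. rewrite Rmin_left ?Rmax_right; try lra. move=> ht. apply H0; lra.
  - move=> t. rewrite Rmin_right ?Rmax_left; try lra. move=> ht. apply H0; lra.
Qed.
End Primitive.

(** * Maxima on rectangles and the maximum principle *)

Definition cont2 (u : C -> R) (x y : R) : Prop :=
  forall eps, 0 < eps -> exists del, 0 < del /\ forall x' y', Rabs (x' - x) < del -> Rabs (y' - y) < del ->
    Rabs (u (x', y') - u (x, y)) < eps.

Lemma rect_bounded u a b c d : a <= b -> c <= d ->
  (forall x y, a <= x <= b -> c <= y <= d -> cont2 u x y) ->
  exists M, forall x y, a <= x <= b -> c <= y <= d -> u (x, y) <= M.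
Proof.
  move=> hab hcd Hu.
  apply (rect_induct (fun a b c d => exists M, forall x y, a <= x <= b -> c <= y <= d -> u (x, y) <= M)) => //.
  - move=> a' b' c' d' h1 h2 [M1 H1] [M2 H2] [M3 H3] [M4 H4].
    exists (Rmax (Rmax M1 M2) (Rmax M3 M4)) => x y hx hy.
    have l1 := Rmax_l (Rmax M1 M2) (Rmax M3 M4). have l2 := Rmax_r (Rmax M1 M2) (Rmax M3 M4).
    have l3 := Rmax_l M1 M2. have l4 := Rmax_r M1 M2. have l5 := Rmax_l M3 M4. have l6 := Rmax_r M3 M4.
    case: (Rle_lt_dec x ((a' + b') / 2)) => ux; case: (Rle_lt_dec y ((c' + d') / 2)) => uy.
    + have := H1 x y ltac:(lra) ltac:(lra); lra.
    + have := H3 x y ltac:(lra) ltac:(lra); lra.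
    + have := H2 x y ltac:(lra) ltac:(lra); lra.
    + have := H4 x y ltac:(lra) ltac:(lra); lra.
  - move=> x y hx hy. have [del [hdel H]] := Hu x y hx hy 1 ltac:(lra).
    exists del; split => // a' b' c' d' _ _ _ _ h1 h2 h3 h4.
    exists (u (x, y) + 1) => x' y' hx' hy'.
    have := H x' y' ltac:(apply Rabs_def1; lra) ltac:(apply Rabs_def1; lra).
    move=> /Rabs_def2; lra.
Qed.

(** If the supremum S were not attained, [/ (S - u)] would be continuous, hence bounded by some K,
    and [S - / K] would be a smaller upper bound. *)
Lemma rect_max u a b c d : a <= b -> c <= d ->
  (forall x y, a <= x <= b -> c <= y <= d -> cont2 u x y) ->
  exists x0 y0, a <= x0 <= b /\ c <= y0 <= d /\ forall x y, a <= x <= b -> c <= y <= d -> u (x, y) <= u (x0, y0).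
Proof.
  move=> hab hcd Hu. apply NNPP => Hn.
  have [M HM] := rect_bounded u a b c d hab hcd Hu.
  have [S [HS1 HS2]] : exists S, is_lub (fun r => exists x y, a <= x <= b /\ c <= y <= d /\ r = u (x, y)) S.
  { have [S HS] := completeness (fun r => exists x y, a <= x <= b /\ c <= y <= d /\ r = u (x, y))
     ltac:(by exists M => r [x [y [hx [hy ->]]]]; apply HM)
     ltac:(exists (u (a, c)), a, c; repeat split; lra).
    by exists S. }
  have Hlt x y : a <= x <= b -> c <= y <= d -> u (x, y) < S.
  { move=> hx hy. apply Rnot_le_lt => hS. apply Hn. exists x, y. split => //. split => // x' y' hx' hy'.
    apply Rle_trans with (2 := hS). apply HS1. by exists x', y'. }
  have [K HK] : exists K, forall x y, a <= x <= b -> c <= y <= d -> / (S - u (x, y)) <= K.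
  { apply (rect_bounded (fun z => / (S - u z))) => // x y hx hy eps he.
    have h0 := Hlt x y hx hy. set w := S - u (x, y).
    have hw : 0 < w by rewrite /w; lra.
    have [del [hdel H]] := Hu x y hx hy (Rmin (w / 2) (eps * (w * w / 2)))
      ltac:(apply Rmin_pos; [lra | apply Rmult_lt_0_compat => //; nra]).
    exists del; split => // x' y' hx' hy'.
    have h1 := H x' y' hx' hy'.
    have m1 := Rlt_le_trans _ _ _ h1 (Rmin_l _ _). have m2 := Rlt_le_trans _ _ _ h1 (Rmin_r _ _).
    set w' := S - u (x', y').
    have ew : w - w' = u (x', y') - u (x, y) by rewrite /w /w'; ring.
    have m1' := m1. rewrite -ew in m1'. move: m1' => /Rabs_def2 m1'.
    have hw' : w / 2 < w' by lra.
    have -> : / w' - / w = (w - w') * / (w * w') by field; lra.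
    rewrite ew Rabs_mult (Rabs_pos_eq (/ _)); last by apply Rlt_le, Rinv_0_lt_compat; nra.
    apply (Rmult_lt_reg_r (w * w')); first nra.
    rewrite Rmult_assoc Rinv_l; last nra.
    rewrite Rmult_1_r.
    apply Rlt_le_trans with (1 := m2). apply Rmult_le_compat_l; first lra. nra. }
  have hK : 0 < K.
  { apply Rlt_le_trans with (2 := HK a c ltac:(lra) ltac:(lra)). apply Rinv_0_lt_compat.
    have := Hlt a c ltac:(lra) ltac:(lra). lra. }
  have : S <= S - / K.
  { apply HS2 => r [x [y [hx [hy ->]]]].
    have h1 := HK x y hx hy. have h2 := Hlt x y hx hy.
    have : / K <= S - u (x, y).
    { rewrite -(Rinv_inv (S - u (x, y))). apply Rinv_le_contravar => //. apply Rinv_0_lt_compat; lra. }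
    lra. }
  have := Rinv_0_lt_compat _ hK. lra.
Qed.

(** If U2 > 0, then U1 exceeds [U1 x] to the right of x and lies below it to the left. A step to the
    right when [U1 x >= 0], to the left otherwise, therefore increases U strictly. *)
Lemma second_derivative_test (U U1 : R -> R) (U2 x r : R) : 0 < r ->
  (forall t, Rabs (t - x) <= r -> is_derive U t (U1 t)) -> is_derive U1 x U2 ->
  (forall t, Rabs (t - x) <= r -> U t <= U x) -> U2 <= 0.
Proof.
  move=> hr HU HU1 Hmax. apply Rnot_lt_le => h2.
  have [[del hdel] Hd] := proj1 (is_derive_Reals U1 x U2) HU1 (U2 / 2) ltac:(lra).
  simpl in Hd. set s := Rmin r (del / 2).
  have hs : 0 < s by apply Rmin_pos; lra.
  have hs1 : s <= r by apply Rmin_l. have hs2 : s <= del / 2 by apply Rmin_r.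
  have Hd' h : h <> 0 -> Rabs h <= s -> (U1 (x + h) - U1 x) * h >= U2 / 2 * (h * h).
  { move=> hn hh. have := Hd h hn ltac:(lra). move=> /Rabs_def2 [_ H].
    have : (U1 (x + h) - U1 x) / h > U2 / 2 by lra.
    move=> H'. have -> : (U1 (x + h) - U1 x) * h = (U1 (x + h) - U1 x) / h * (h * h) by field.
    have : 0 < h * h by nra. nra. }
  have mvt p q : x - r <= p -> q <= x + r -> p < q -> exists z, p < z < q /\ U q - U p = U1 z * (q - p).
  { move=> hp hq hpq.
    have [z [Hz1 Hz2]] := MVT_cor2 U U1 p q hpq
      (fun t Ht => proj1 (is_derive_Reals U t (U1 t)) (HU t ltac:(apply Rabs_le; lra))).
    by exists z. }
  case: (Rle_lt_dec 0 (U1 x)) => h1.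
  - have [z [hz E]] := mvt x (x + s) ltac:(lra) ltac:(lra) ltac:(lra).
    have := Hd' (z - x) ltac:(lra) ltac:(apply Rabs_le; lra).
    have -> : x + (z - x) = z by ring. move=> Hz.
    have hw : 0 < (z - x) * (z - x) by apply Rmult_lt_0_compat; lra.
    have : 0 < U1 z.
    { apply Rnot_le_lt => h. have : (U1 z - U1 x) * (z - x) <= 0 by nra. nra. }
    have := Hmax (x + s) ltac:(apply Rabs_le; lra). nra.
  - have [z [hz E]] := mvt (x - s) x ltac:(lra) ltac:(lra) ltac:(lra).
    have := Hd' (z - x) ltac:(lra) ltac:(apply Rabs_le; lra).
    have -> : x + (z - x) = z by ring. move=> Hz.
    have hw : 0 < (z - x) * (z - x) by have : 0 < x - z; [lra | nra].
    have : U1 z < 0.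
    { apply Rnot_le_lt => h. have : (U1 z - U1 x) * (z - x) <= 0 by nra. nra. }
    have := Hmax (x - s) ltac:(apply Rabs_le; lra). nra.
Qed.

Lemma cder_cont2 (g : C -> C) (l : C) (x y : R) : cder g (x, y) l ->
  forall eps, 0 < eps -> exists del, 0 < del /\ forall x' y', Rabs (x' - x) < del -> Rabs (y' - y) < del ->
    Cmod (g (x', y') - g (x, y))%C < eps.
Proof.
  move=> H eps he. have [d [hd Hd]] := cder_cont _ _ _ H eps he.
  exists (d / 2); split; first lra. move=> x' y' hx hy.
  have := Hd ((x' - x, y' - y) : C).
  have -> : (((x, y) : C) + (x' - x, y' - y)%R)%C = (x', y') by rewrite /Cplus /=; f_equal; ring.
  apply. apply Rle_lt_trans with (1 := Cmod_pair_le _ _). lra.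
Qed.

Lemma cont2_Cmod (g : C -> C) (l : C) (x y : R) : cder g (x, y) l -> cont2 (fun z => Cmod (g z)) x y.
Proof.
  move=> H eps he. have [d [hd Hd]] := cder_cont2 _ _ _ _ H eps he.
  exists d; split => // x' y' hx hy.
  apply Rle_lt_trans with (2 := Hd x' y' hx hy).
  apply Rabs_le. have h1 := Cmod_rev_triangle (g (x', y')) (g (x, y)).
  have h2 := Cmod_rev_triangle (g (x, y)) (g (x', y')).
  have : Cmod (g (x, y) - g (x', y'))%C = Cmod (g (x', y') - g (x, y))%C.
  { rewrite -Cmod_opp. f_equal. ring. }
  lra.
Qed.

Lemma cont2_sq_plus (u : C -> R) (eps x y : R) : cont2 u x y -> cont2 (fun z => (u z)^2 + eps * (Re z)^2) x y.
Proof.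
  move=> H.
  have Hc : forall (F : R -> R) p, continuous F p -> forall e, 0 < e -> exists d, 0 < d /\ forall q, Rabs (q - p) < d -> Rabs (F q - F p) < e.
  { move=> F p /continuity_pt_filterlim hF e he. have [d [hd Hd]] := hF e he.
    exists d; split => // q hq. case: (Req_dec q p) => [->|hn].
    - by rewrite Rminus_diag Rabs_R0.
    - apply (Hd q). split => //. split => //. by apply not_eq_sym. }
  move=> e he.
  have [d1 [hd1 H1]] := Hc (fun t => t ^ 2) (u (x, y)) ltac:(apply: ex_derive_continuous; auto_derive => //) (e / 2) ltac:(lra).
  have [d2 [hd2 H2]] := Hc (fun t => eps * t ^ 2) x ltac:(apply: ex_derive_continuous; auto_derive => //) (e / 2) ltac:(lra).
  have [d3 [hd3 H3]] := H d1 hd1.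
  exists (Rmin d2 d3); split; first by apply Rmin_pos.
  move=> x' y' hx hy.
  have k1 := H2 x' (Rlt_le_trans _ _ _ hx (Rmin_l _ _)).
  have k2 := H1 _ (H3 x' y' (Rlt_le_trans _ _ _ hx (Rmin_r _ _)) (Rlt_le_trans _ _ _ hy (Rmin_r _ _))).
  rewrite /Re /=.
  have -> : u (x', y') ^ 2 + eps * x' ^ 2 - (u (x, y) ^ 2 + eps * x ^ 2) =
    (u (x', y') ^ 2 - u (x, y) ^ 2) + (eps * x' ^ 2 - eps * x ^ 2) by ring.
  apply Rle_lt_trans with (1 := Rabs_triang _ _). lra.
Qed.

(* The term [eps * x ^ 2] makes [|g|^2 + eps * x^2] strictly subharmonic: its Laplacian
   is [4 |g'|^2 + 2 eps], so an interior maximum contradicts the second derivative test. *)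
Lemma max_principle_eps (g g1 g2 : C -> C) a b c d M eps : 0 < eps -> a < b -> c < d ->
  (forall x y, a <= x <= b -> c <= y <= d -> cder g (x, y) (g1 (x, y)) /\ cder g1 (x, y) (g2 (x, y))) ->
  (forall x y, a <= x <= b -> c <= y <= d -> x = a \/ x = b \/ y = c \/ y = d -> Cmod (g (x, y)) <= M) ->
  forall x y, a <= x <= b -> c <= y <= d -> Cmod (g (x, y)) ^ 2 <= M ^ 2 + eps * (a ^ 2 + b ^ 2).
Proof.
  move=> he hab hcd Hg HM x y hx hy.
  set u := fun z : C => Cmod (g z) ^ 2 + eps * Re z ^ 2.
  have [x0 [y0 [hx0 [hy0 Hmax]]]] := rect_max u a b c d (Rlt_le _ _ hab) (Rlt_le _ _ hcd)
    (fun x y hx hy => cont2_sq_plus _ eps x y (cont2_Cmod _ _ x y (proj1 (Hg x y hx hy)))).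
  have hE z : u z = Re (g z) ^ 2 + Im (g z) ^ 2 + eps * Re z ^ 2 by rewrite /u Cmod2_alt.
  case: (classic (x0 = a \/ x0 = b \/ y0 = c \/ y0 = d)) => hbd.
  - have h1 : Cmod (g (x, y)) ^ 2 + eps * x ^ 2 <= Cmod (g (x0, y0)) ^ 2 + eps * x0 ^ 2 := Hmax x y hx hy.
    have h2 := HM x0 y0 hx0 hy0 hbd. have h3 := Cmod_ge_0 (g (x0, y0)).
    have h4 : Cmod (g (x0, y0)) ^ 2 <= M ^ 2 by apply pow_incr.
    have h5 : x0 ^ 2 <= a ^ 2 + b ^ 2.
    { have := pow2_ge_0 a. have := pow2_ge_0 b. case: (Rle_lt_dec 0 x0) => hs; nra. }
    have h6 : 0 <= x ^ 2 by apply pow2_ge_0.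
    have h7 : eps * x0 ^ 2 <= eps * (a ^ 2 + b ^ 2) by apply Rmult_le_compat_l; lra.
    have h8 : 0 <= eps * x ^ 2 by nra.
    simpl in *. lra.
  - exfalso.
    have i1 : a < x0 < b.
    { split; apply Rnot_le_lt => h; apply hbd; [left | right; left]; lra. }
    have i2 : c < y0 < d.
    { split; apply Rnot_le_lt => h; apply hbd; right; right; [left | right]; lra. }
    have [r [hr [hr1 [hr2 [hr3 hr4]]]]] := interior_radius a b c d x0 y0 i1 i2.
    have rng p t : Rabs (t - p) <= r -> p - r <= t <= p + r.
    { move=> h. have := Rle_abs (t - p). have := Rle_abs (- (t - p)). rewrite Rabs_Ropp. lra. }
    have H1 := second_derivative_test (fun t => u (t, y0))
      (fun t => 2 * (Re (g (t, y0)) * Re (g1 (t, y0)) + Im (g (t, y0)) * Im (g1 (t, y0))) + eps * (2 * t))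
      (2 * (Re (g1 (x0, y0)) ^ 2 + Im (g1 (x0, y0)) ^ 2 + Re (g (x0, y0)) * Re (g2 (x0, y0)) + Im (g (x0, y0)) * Im (g2 (x0, y0))) + 2 * eps)
      x0 r hr.
    have H2 := second_derivative_test (fun t => u (x0, t))
      (fun t => 2 * (- (Re (g (x0, t)) * Im (g1 (x0, t))) + Im (g (x0, t)) * Re (g1 (x0, t))))
      (2 * (Re (g1 (x0, y0)) ^ 2 + Im (g1 (x0, y0)) ^ 2 - Re (g (x0, y0)) * Re (g2 (x0, y0)) - Im (g (x0, y0)) * Im (g2 (x0, y0))))
      y0 r hr.
    have {}H1 := H1 _ _ (fun t ht => Hmax t y0 ltac:(have := rng _ _ ht; lra) hy0).
    have {}H2 := H2 _ _ (fun t ht => Hmax x0 t hx0 ltac:(have := rng _ _ ht; lra)).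
    have dR : forall (a b : R -> R) a' b' t, is_derive a t a' -> is_derive b t b' -> is_derive (fun t => a t * b t) t (a' * b t + a t * b').
    { move=> p q p' q' t h1 h2. apply: is_derive_mult => //. move=> ? ?; apply Rmult_comm. }
    have P1 : forall t, Rabs (t - x0) <= r ->
      is_derive (fun t => u (t, y0)) t (2 * (Re (g (t, y0)) * Re (g1 (t, y0)) + Im (g (t, y0)) * Im (g1 (t, y0))) + eps * (2 * t)).
    { move=> t ht. have [dg _] := Hg t y0 ltac:(have := rng _ _ ht; lra) hy0.
      have [d1 d2] := cder_hline _ _ _ _ dg.
      apply (is_derive_ext (fun t => (Re (g (t, y0)) * Re (g (t, y0)) + Im (g (t, y0)) * Im (g (t, y0))) + eps * (t * t))).
      { move=> s. rewrite hE /Re /Im /=. ring. }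
      evar_last.
      { apply: is_derive_plus; [apply: is_derive_plus; apply: dR; eassumption|].
        apply is_derive_scal. apply: dR; apply is_derive_id. }
      rewrite /plus /one /=. ring. }
    have P2 : is_derive (fun t => 2 * (Re (g (t, y0)) * Re (g1 (t, y0)) + Im (g (t, y0)) * Im (g1 (t, y0))) + eps * (2 * t)) x0
       (2 * (Re (g1 (x0, y0)) ^ 2 + Im (g1 (x0, y0)) ^ 2 + Re (g (x0, y0)) * Re (g2 (x0, y0)) + Im (g (x0, y0)) * Im (g2 (x0, y0))) + 2 * eps).
    { have [dg dg1] := Hg x0 y0 hx0 hy0.
      have [d1 d2] := cder_hline _ _ _ _ dg. have [d3 d4] := cder_hline _ _ _ _ dg1.
      evar_last.
      { apply: is_derive_plus; [apply is_derive_scal; apply: is_derive_plus; apply: dR; eassumption|].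
        apply is_derive_scal. apply is_derive_scal. apply is_derive_id. }
      rewrite /plus /one /=. ring. }
    have P3 : forall t, Rabs (t - y0) <= r ->
      is_derive (fun t => u (x0, t)) t (2 * (- (Re (g (x0, t)) * Im (g1 (x0, t))) + Im (g (x0, t)) * Re (g1 (x0, t)))).
    { move=> t ht. have [dg _] := Hg x0 t hx0 ltac:(have := rng _ _ ht; lra).
      have [d1 d2] := cder_vline _ _ _ _ dg.
      apply (is_derive_ext (fun t => (Re (g (x0, t)) * Re (g (x0, t)) + Im (g (x0, t)) * Im (g (x0, t))) + eps * (x0 * x0))).
      { move=> s. rewrite hE /Re /Im /=. ring. }
      evar_last.
      { apply: is_derive_plus; [apply: is_derive_plus; apply: dR; eassumption|].
        apply is_derive_const. }
      rewrite /plus /zero /= /Re /Im /=. ring. }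
    have P4 : is_derive (fun t => 2 * (- (Re (g (x0, t)) * Im (g1 (x0, t))) + Im (g (x0, t)) * Re (g1 (x0, t)))) y0
       (2 * (Re (g1 (x0, y0)) ^ 2 + Im (g1 (x0, y0)) ^ 2 - Re (g (x0, y0)) * Re (g2 (x0, y0)) - Im (g (x0, y0)) * Im (g2 (x0, y0)))).
    { have [dg dg1] := Hg x0 y0 hx0 hy0.
      have [d1 d2] := cder_vline _ _ _ _ dg. have [d3 d4] := cder_vline _ _ _ _ dg1.
      evar_last.
      { apply is_derive_scal; apply: is_derive_plus; [apply: is_derive_opp|]; apply: dR; eassumption. }
      rewrite /plus /opp /= /Re /Im /=. ring. }
    have := H1 P1 P2. have := H2 P3 P4.
    have := pow2_ge_0 (Re (g1 (x0, y0))). have := pow2_ge_0 (Im (g1 (x0, y0))). lra.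
Qed.

Lemma max_principle (g g1 g2 : C -> C) a b c d M : a < b -> c < d ->
  (forall x y, a <= x <= b -> c <= y <= d -> cder g (x, y) (g1 (x, y)) /\ cder g1 (x, y) (g2 (x, y))) ->
  (forall x y, a <= x <= b -> c <= y <= d -> x = a \/ x = b \/ y = c \/ y = d -> Cmod (g (x, y)) <= M) ->
  forall x y, a <= x <= b -> c <= y <= d -> Cmod (g (x, y)) <= M.
Proof.
  move=> hab hcd Hg HM x y hx hy.
  have hM : 0 <= M.
  { apply Rle_trans with (1 := Cmod_ge_0 (g (a, c))). apply HM; lra. }
  apply Rsqr_incr_0_var => //. rewrite !Rsqr_pow2.
  apply le_epsilon => e he.
  set K := a ^ 2 + b ^ 2.
  have hK : 0 <= K by rewrite /K; have := pow2_ge_0 a; have := pow2_ge_0 b; lra.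
  have h : 0 < e / (K + 1) by apply Rdiv_lt_0_compat; lra.
  apply Rle_trans with (1 := max_principle_eps g g1 g2 a b c d M _ h hab hcd Hg HM x y hx hy).
  rewrite -/K. apply Rplus_le_compat_l.
  have -> : e = e / (K + 1) * (K + 1) by field; lra.
  apply Rle_trans with (e / (K + 1) * (K + 1)); last by (apply Req_le; field; lra).
  have -> : e / (K + 1) * (K + 1) / (K + 1) = e / (K + 1) by field; lra.
  apply Rmult_le_compat_l; lra.
Qed.

(** * Identity theorem *)

(** The second derivative, which [max_principle] takes as a function, is chosen pointwise. *)
Lemma max_principle_ex (g g1 : C -> C) a b c d M : a < b -> c < d ->
  (forall x y, a <= x <= b -> c <= y <= d -> cder g (x, y) (g1 (x, y)) /\ exists l, cder g1 (x, y) l) ->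
  (forall x y, a <= x <= b -> c <= y <= d -> x = a \/ x = b \/ y = c \/ y = d -> Cmod (g (x, y)) <= M) ->
  forall x y, a <= x <= b -> c <= y <= d -> Cmod (g (x, y)) <= M.
Proof.
  move=> hab hcd Hg. 
  apply (max_principle g g1 (fun z => epsilon (inhabits (RtoC 0)) (fun l => cder g1 z l))) => // x y hx hy.
  have [h1 h2] := Hg x y hx hy. split => //. exact: epsilon_spec h2.
Qed.

Lemma cder_zero_near (G : C -> C) (z l : C) r : 0 < r -> cder G z l ->
  (forall h : R, Rabs h < r -> G (z + RtoC h)%C = RtoC 0) -> l = RtoC 0.
Proof.
  move=> hr HG H0. apply Ceq_eps => e he. have -> : (l - 0 = l)%C by ring.
  have [d [hd Hd]] := HG e he.
  set h := Rmin (r / 2) (d / 2).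
  have h0 : 0 < h by apply Rmin_pos; lra.
  have h1 : h <= r / 2 by apply Rmin_l. have h2 : h <= d / 2 by apply Rmin_r.
  have := Hd (RtoC h). rewrite Cmod_R Rabs_pos_eq; last lra.
  move=> /(_ ltac:(lra)).
  rewrite H0; last by rewrite Rabs_pos_eq; lra.
  have := H0 0 ltac:(rewrite Rabs_R0; lra). rewrite Cplus_0_r => ->.
  have -> : (0 - 0 - l * h = - (l * h))%C by ring.
  rewrite Cmod_opp Cmod_mult Cmod_R Rabs_pos_eq; last lra. nra.
Qed.

(* Maximum principle for [G * exp (k phi)], where [Re phi = e^{kap (x - xr)} cos (kap (y - y0))]
   vanishes on the horizontal edges and is smaller on the left edge than at the given
   point; [G] itself vanishes on the right edge. Then let [k] tend to infinity. *)
Lemma primitive_vanish D a b c d x3 : a < x3 -> x3 < b -> c < d -> holo_rect D a b c d ->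
  (forall x y, x3 <= x <= b -> c <= y <= d -> D (x, y) = RtoC 0) ->
  forall x y, a < x < b -> c < y < d -> primitive D b c (x, y) = RtoC 0.
Proof.
  move=> ha hb hcd HD HD0 x0 y0 hx0 hy0.
  case: (Rle_lt_dec x3 x0) => hx3.
  { apply: (primitive_zero D a b c d _ x3); try lra. exact: HD0. }
  set r := Rmin (y0 - c) (d - y0) / 2.
  have hr : 0 < r by rewrite /r; have : 0 < Rmin (y0 - c) (d - y0); [apply Rmin_pos|]; lra.
  have hr1 : r < y0 - c by rewrite /r; have := Rmin_l (y0 - c) (d - y0); rewrite /r in hr; lra.
  have hr2 : r < d - y0 by rewrite /r; have := Rmin_r (y0 - c) (d - y0); rewrite /r in hr; lra.
  set xl := (a + x0) / 2. set xr := (x3 + b) / 2.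
  have hxl : a < xl < x0 by rewrite /xl; lra.
  have hxr : x3 < xr < b by rewrite /xr; lra.
  set G := primitive D b c.
  have HG x y : xl <= x <= xr -> y0 - r <= y <= y0 + r -> cder G (x, y) (D (x, y)).
  { move=> hx hy. apply: (primitive_cder D a b c d); try assumption; lra. }
  have [M0 HM0] : exists M0, forall x y, xl <= x <= xr -> y0 - r <= y <= y0 + r -> Cmod (G (x, y)) <= M0.
  { apply (rect_bounded (fun z => Cmod (G z))); try lra. move=> x y hx hy.
    apply: cont2_Cmod; exact: HG. }
  have hM0 : 0 <= M0 by apply Rle_trans with (2 := HM0 x0 y0 ltac:(lra) ltac:(lra)); apply Cmod_ge_0.
  (* With this frequency [cos (kap * (y - y0))] vanishes exactly on the horizontal edges y = y0 - r
     and y = y0 + r. *)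
  pose kap := PI / (2 * r).
  have hkap : 0 < kap by apply Rdiv_lt_0_compat; [apply PI_RGT_0 | lra].
  pose phi (z : C) := Cexp (RtoC kap * z + (- RtoC kap * ((xr, y0) : C)))%C.
  have Ephi x y : phi (x, y) = (exp (kap * (x - xr)) * cos (kap * (y - y0)), exp (kap * (x - xr)) * sin (kap * (y - y0))).
  { rewrite /phi /Cexp /Re /Im /RtoC /=.
    f_equal; f_equal; f_equal; ring. }
  have Dphi z : cder phi z (phi z * RtoC kap)%C.
  { apply: (cder_comp Cexp); last exact: cder_Cexp.
    have := cder_plus _ _ _ _ _ (cder_scal (RtoC kap) _ _ _ (cder_id z)) (cder_const (- RtoC kap * ((xr, y0) : C))%C z).
    by have -> : (kap * 1 + 0 = kap)%C by ring. }
  set e1 := exp (kap * (xl - xr)). set e0 := exp (kap * (x0 - xr)).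
  have he1 : 0 < e1 by apply exp_pos.
  have he : e1 < e0 by apply exp_increasing; nra.
  have key k : 0 < k -> Cmod (G (x0, y0)) * exp (k * e0) <= M0 * exp (k * e1).
  { move=> hk.
    pose E z := Cexp (RtoC k * phi z)%C.
    have DE z : cder E z (E z * (RtoC k * (phi z * RtoC kap)))%C.
    { apply: (cder_comp Cexp); last exact: cder_Cexp. apply cder_scal. exact: Dphi. }
    have ME x y : Cmod (E (x, y)) = exp (k * (exp (kap * (x - xr)) * cos (kap * (y - y0)))).
    { rewrite /E Cmod_Cexp Ephi. f_equal. rewrite /Re /Im /=. ring. }
    have -> : Cmod (G (x0, y0)) * exp (k * e0) = Cmod (G (x0, y0) * E (x0, y0))%C.
    { rewrite Cmod_mult ME. rewrite Rminus_diag Rmult_0_r cos_0 Rmult_1_r. done. }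
    apply (max_principle_ex (fun z => G z * E z)%C
       (fun z => D z * E z + G z * (E z * (RtoC k * (phi z * RtoC kap))))%C xl xr (y0 - r) (y0 + r)); try lra.
    - move=> x y hx hy. split.
      + apply: cder_mult; [exact: HG | exact: DE].
      + have [l Hl] := HD x y ltac:(lra) ltac:(lra).
        eexists. apply: cder_plus; first by apply: cder_mult; [exact: Hl | exact: DE].
        apply: cder_mult; first exact: HG.
        apply: cder_mult; first exact: DE.
        apply: cder_scal. apply: cder_mult; [exact: Dphi | exact: cder_const].
    - move=> x y hx hy hbd. rewrite Cmod_mult ME.
      have hG := HM0 x y hx hy.
      have bnd : exp (kap * (x - xr)) * cos (kap * (y - y0)) <= e1 ->
         Cmod (G (x, y)) * exp (k * (exp (kap * (x - xr)) * cos (kap * (y - y0)))) <= M0 * exp (k * e1).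
      { move=> h. apply Rmult_le_compat => //; [apply Cmod_ge_0 | apply Rlt_le, exp_pos|].
        apply exp_le_mono. nra. }
      case: hbd => [h|[h|[h|h]]].
      + apply bnd. rewrite h. have := COS_bound (kap * (y - y0)). rewrite -/e1. nra.
      + have -> : G (x, y) = RtoC 0.
        { apply: (primitive_zero D a b c d _ x3); try lra. exact: HD0. }
        rewrite Cmod_0 Rmult_0_l. have := exp_pos (k * e1). nra.
      + apply bnd. have -> : kap * (y - y0) = - (PI / 2) by rewrite h /kap; field; lra.
        rewrite cos_neg cos_PI2. lra.
      + apply bnd. have -> : kap * (y - y0) = PI / 2 by rewrite h /kap; field; lra.
        rewrite cos_PI2. lra. }
  apply Cmod_eq_0. apply Rle_antisym; last by apply Cmod_ge_0.
  apply Rnot_lt_le => hm. set m := Cmod (G (x0, y0)) in key hm.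
  have hm' : 0 < m by [].
  (* Then [exp (k * (e0 - e1))] is at least M0 / m + 2 by [exp_ineq1_le], which [key] forbids. *)
  set k := (M0 / m + 1) / (e0 - e1).
  have hk : 0 < k.
  { apply Rdiv_lt_0_compat; last lra. have : 0 <= M0 / m; last lra.
    apply Rmult_le_pos => //. by apply Rlt_le, Rinv_0_lt_compat. }
  have := key k hk.
  have -> : k * e0 = k * e1 + (M0 / m + 1) by rewrite /k; field; lra.
  rewrite exp_plus.
  have h1 := exp_ineq1_le (M0 / m + 1).
  have h2 := exp_pos (k * e1).
  move=> h3.
  have h4 : m * (exp (k * e1) * exp (M0 / m + 1)) >= exp (k * e1) * (M0 + m).
  { have -> : M0 + m = m * (M0 / m + 1) by field; lra.
    have : 0 < m * exp (k * e1) by nra. nra. }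
  nra.
Qed.

(** The maximum principle asks for two derivatives, whereas D comes with one. It is therefore
    applied to a primitive of D, and D vanishes as the derivative of a function that is 0. *)
Theorem identity_rect D a b c d x3 : a < x3 -> x3 < b -> c < d -> holo_rect D a b c d ->
  (forall x y, x3 <= x <= b -> c <= y <= d -> D (x, y) = RtoC 0) ->
  forall x y, a < x < b -> c < y < d -> D (x, y) = RtoC 0.
Proof.
  move=> ha hb hcd HD HD0 x y hx hy.
  apply (cder_zero_near (primitive D b c) (x, y) _ (Rmin (x - a) (b - x))).
  - apply Rmin_pos; lra.
  - apply: (primitive_cder D a b c d); try assumption; lra.
  - move=> h hh. have h1 := Rlt_le_trans _ _ _ hh (Rmin_l _ _). have h2 := Rlt_le_trans _ _ _ hh (Rmin_r _ _).
    have -> : (((x, y) : C) + RtoC h)%C = ((x + h)%R, y) by rewrite /Cplus /RtoC /=; f_equal; ring.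
    apply: (primitive_vanish D a b c d x3) => //.
    have := Rabs_def2 h _ h1. have := Rabs_def2 h _ h2. lra.
Qed.

(** * Integrals over the half-line *)

(* [l] is the improper integral of [f] over the positive half-line; a two-sided integral
   is encoded as the half-line integral of [f v + f (- v)]. *)
Definition is_half_int (f : R -> C) (l : C) : Prop :=
  forall eps, 0 < eps -> exists R0, 0 <= R0 /\ forall b, R0 <= b -> Cmod (cint f 0 b - l)%C < eps.

Definition cont (f : R -> C) : Prop := forall x, ccont f x.

Lemma cont_on f a b : cont f -> ccont_on f a b.
Proof. by move=> H x _. Qed.

Lemma is_RInt_exp_neg K a b : is_RInt (fun v => K * exp (- v)) a b (K * exp (- a) - K * exp (- b)).
Proof.
  have -> : K * exp (- a) - K * exp (- b) = minus ((fun v => - K * exp (- v)) b) ((fun v => - K * exp (- v)) a).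
  { rewrite /minus /plus /opp /=. ring. }
  apply (is_RInt_derive (fun v => - K * exp (- v)) (fun v => K * exp (- v))) => x _.
  - auto_derive => //. ring.
  - apply: ex_derive_continuous. auto_derive => //.
Qed.

Lemma RInt_exp_bound (f : R -> R) K a b : 0 <= K -> a <= b -> ex_RInt f a b ->
  (forall v, a <= v <= b -> Rabs (f v) <= K * exp (- v)) -> Rabs (RInt f a b) <= K * exp (- a).
Proof.
  move=> hK hab hf H.
  have h := norm_RInt_le f (fun v => K * exp (- v)) a b _ _ hab H (RInt_correct _ _ _ hf) (is_RInt_exp_neg K a b).
  apply Rle_trans with (1 := h). have := exp_pos (- b). nra.
Qed.

Lemma cint_exp_bound f K a b : 0 <= K -> a <= b -> ccont_on f a b ->
  (forall v, a <= v <= b -> Cmod (f v) <= K * exp (- v)) -> Cmod (cint f a b) <= 2 * K * exp (- a).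
Proof.
  move=> hK hab hf H. apply Rle_trans with (1 := Cmod_le_re_im _).
  rewrite /cint {1}/Re {2}/Im /=.
  have h1 := RInt_exp_bound (fun t => Re (f t)) K a b hK hab (ccont_on_re _ _ _ hf)
    (fun v hv => Rle_trans _ _ _ (re_le_Cmod _) (H v hv)).
  have h2 := RInt_exp_bound (fun t => Im (f t)) K a b hK hab (ccont_on_im _ _ _ hf)
    (fun v hv => Rle_trans _ _ _ (im_le_Cmod _) (H v hv)).
  lra.
Qed.

Lemma exp_neg_small K eps : 0 <= K -> 0 < eps -> exists R0, 0 <= R0 /\ forall b, R0 <= b -> K * exp (- b) < eps.
Proof.
  move=> hK he. exists (K / eps). split.
  { apply Rmult_le_pos => //. by apply Rlt_le, Rinv_0_lt_compat. }
  move=> b hb.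
  have h1 := exp_ineq1_le b. have h2 := exp_pos b.
  rewrite exp_Ropp. apply (Rmult_lt_reg_r (exp b)) => //.
  rewrite Rmult_assoc Rinv_l; last lra.
  have : K <= b * eps.
  { have -> : K = K / eps * eps by field; lra. apply Rmult_le_compat_r; lra. }
  nra.
Qed.

Lemma real_tail_limit (u : R -> R) K : 0 <= K ->
  (forall a b, 0 <= a -> a <= b -> Rabs (u b - u a) <= K * exp (- a)) ->
  exists l, forall eps, 0 < eps -> exists R0, 0 <= R0 /\ forall b, R0 <= b -> Rabs (u b - l) < eps.
Proof.
  move=> hK H.
  have : exists l : R, filterlim u (Rbar_locally p_infty) (locally l).
  { apply (filterlim_locally_cauchy (U := R_CompleteSpace) (F := Rbar_locally p_infty)) => eps.
    have [R0 [h0 h1]] := exp_neg_small K (pos eps / 2) hK ltac:(have := cond_pos eps; lra).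
    exists (fun x => R0 < x). split; first by exists R0.
    move=> x y hx hy. rewrite /ball /= /AbsRing_ball /abs /minus /plus /opp /=.
    have hh a : R0 < a -> Rabs (u a - u R0) < eps / 2.
    { move=> ha. apply Rle_lt_trans with (1 := H R0 a h0 ltac:(lra)). apply h1; lra. }
    have -> : u y + - u x = (u y - u R0) - (u x - u R0) by ring.
    apply Rle_lt_trans with (1 := Rabs_triang _ _). rewrite Rabs_Ropp.
    have := hh x hx. have := hh y hy. lra. }
  move=> [l Hl]. exists l => eps he.
  have := Hl (fun y => Rabs (y - l) < eps).
  case.
  { exists (mkposreal eps he) => y hy. exact: hy. }
  move=> M HM. exists (Rmax 0 (M + 1)). split; first by apply Rmax_l.
  move=> b hb. apply HM. have := Rmax_r 0 (M + 1). lra.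
Qed.

Lemma half_int_ex f K : 0 <= K -> cont f -> (forall v, 0 <= v -> Cmod (f v) <= K * exp (- v)) -> exists l, is_half_int f l.
Proof.
  move=> hK hf H.
  have D a b : 0 <= a -> a <= b -> Cmod (cint f 0 b - cint f 0 a)%C <= 2 * K * exp (- a).
  { move=> ha hab. rewrite -(cint_chasles f 0 a b); try exact: cont_on.
    have -> : (cint f 0 a + cint f a b - cint f 0 a = cint f a b)%C by ring.
    apply: cint_exp_bound => // v hv; apply H; lra. }
  have [lr Hr] := real_tail_limit (fun b => Re (cint f 0 b)) (2 * K) ltac:(lra)
    (fun a b ha hab => Rle_trans _ _ _ (re_le_Cmod (cint f 0 b - cint f 0 a)%C) (D a b ha hab)).
  have [li Hi] := real_tail_limit (fun b => Im (cint f 0 b)) (2 * K) ltac:(lra)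
    (fun a b ha hab => Rle_trans _ _ _ (im_le_Cmod (cint f 0 b - cint f 0 a)%C) (D a b ha hab)).
  exists (lr, li) => eps he.
  have [R1 [p1 h1]] := Hr (eps / 2) ltac:(lra). have [R2 [p2 h2]] := Hi (eps / 2) ltac:(lra).
  exists (R1 + R2); split; first lra. move=> b hb.
  apply Rle_lt_trans with (1 := Cmod_le_re_im _).
  have k1 := h1 b ltac:(lra). have k2 := h2 b ltac:(lra).
  have -> : Re (cint f 0 b - (lr, li))%C = Re (cint f 0 b) - lr by [].
  have -> : Im (cint f 0 b - (lr, li))%C = Im (cint f 0 b) - li by [].
  lra.
Qed.

Lemma half_int_unique f l l' : is_half_int f l -> is_half_int f l' -> l = l'.
Proof.
  move=> H H'. apply Ceq_eps => e he.
  have [R1 [p1 h1]] := H (e / 2) ltac:(lra). have [R2 [p2 h2]] := H' (e / 2) ltac:(lra).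
  have k1 := h1 (R1 + R2) ltac:(lra). have k2 := h2 (R1 + R2) ltac:(lra).
  have -> : (l - l' = (cint f 0 (R1 + R2) - l') - (cint f 0 (R1 + R2) - l))%C by ring.
  apply Rle_trans with (1 := Cmod_triangle' _ _). lra.
Qed.

Lemma half_int_bound f l K : 0 <= K -> cont f -> (forall v, 0 <= v -> Cmod (f v) <= K * exp (- v)) ->
  is_half_int f l -> Cmod l <= 2 * K.
Proof.
  move=> hK hf H HJ. apply le_epsilon => e he.
  have [R1 [p1 h1]] := HJ e he. have k := h1 R1 (Rle_refl _).
  have k2 := cint_exp_bound f K 0 R1 hK p1 (cont_on _ _ _ hf) (fun v hv => H v (proj1 hv)).
  rewrite Ropp_0 exp_0 in k2.
  have := Cmod_triangle' (cint f 0 R1) (cint f 0 R1 - l)%C.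
  have -> : (cint f 0 R1 - (cint f 0 R1 - l) = l)%C by ring. lra.
Qed.

Lemma half_int_plus f g l m : cont f -> cont g -> is_half_int f l -> is_half_int g m -> is_half_int (fun v => f v + g v)%C (l + m)%C.
Proof.
  move=> hf hg Hf Hg e he.
  have [R1 [p1 h1]] := Hf (e / 2) ltac:(lra). have [R2 [p2 h2]] := Hg (e / 2) ltac:(lra).
  exists (R1 + R2); split; first lra. move=> b hb.
  rewrite cint_plus; try exact: cont_on.
  have -> : (cint f 0 b + cint g 0 b - (l + m) = (cint f 0 b - l) + (cint g 0 b - m))%C by ring.
  apply Rle_lt_trans with (1 := Cmod_triangle _ _).
  have := h1 b ltac:(lra). have := h2 b ltac:(lra). lra.
Qed.

Lemma half_int_scal c f l : cont f -> is_half_int f l -> is_half_int (fun v => c * f v)%C (c * l)%C.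
Proof.
  move=> hf Hf e he. have hc := Cmod_ge_0 c.
  have [R1 [p1 h1]] := Hf (e / (Cmod c + 1)) ltac:(apply Rdiv_lt_0_compat; lra).
  exists R1; split => // b hb. rewrite cint_scal; last exact: cont_on.
  have -> : (c * cint f 0 b - c * l = c * (cint f 0 b - l))%C by ring.
  rewrite Cmod_mult. have h := h1 b hb.
  have -> : e = (Cmod c + 1) * (e / (Cmod c + 1)) by field; lra.
  have := Cmod_ge_0 (cint f 0 b - l)%C. have : 0 < e / (Cmod c + 1) by apply Rdiv_lt_0_compat; lra.
  nra.
Qed.

Lemma half_int_ext f g l : (forall v, 0 <= v -> f v = g v) -> is_half_int f l -> is_half_int g l.
Proof.
  move=> E H e he. have [R1 [p1 h1]] := H e he. exists R1; split => // b hb.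
  rewrite -(cint_ext f g); first by apply h1.
  move=> x. rewrite Rmin_left ?Rmax_right; try lra. move=> hx; apply E; lra.
Qed.

Lemma cont_plus f g : cont f -> cont g -> cont (fun v => f v + g v)%C.
Proof. move=> h1 h2 x; exact: ccont_plus. Qed.
Lemma cont_mult f g : cont f -> cont g -> cont (fun v => f v * g v)%C.
Proof. move=> h1 h2 x; exact: ccont_mult. Qed.
Lemma cont_const c : cont (fun _ => c).
Proof. move=> x; exact: ccont_const. Qed.

Lemma cont_Cexp_lin (p q : C) : cont (fun v => Cexp (p + q * RtoC v)%C).
Proof.
  move=> x. 
  have h1 := cder_line_re _ p q _ x (cder_Cexp (p + q * RtoC x)%C).
  have h2 := cder_line_im _ p q _ x (cder_Cexp (p + q * RtoC x)%C).
  split; apply: ex_derive_continuous; eexists; eassumption.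
Qed.

Lemma cont_Cexp_scal (q : C) : cont (fun v => Cexp (q * RtoC v)%C).
Proof. move=> x. apply: ccont_ext (cont_Cexp_lin (RtoC 0) q x) => t. by rewrite Cplus_0_l. Qed.

Lemma cont_neg f : cont f -> cont (fun v => f (- v)).
Proof.
  move=> H x. have [h1 h2] := H (- x).
  split; [apply (continuous_comp (fun v => - v) (fun v => Re (f v)))|apply (continuous_comp (fun v => - v) (fun v => Im (f v)))] => //;
  apply: ex_derive_continuous; auto_derive => //.
Qed.

Lemma cont_RtoC (f : R -> R) : (forall x, continuous f x) -> cont (fun v => RtoC (f v)).
Proof. move=> H x; split; [exact: H | exact: continuous_const]. Qed.

(** Decay faster than every exponential: the integral of [k v * Cexp (s * v)] over the half-line
    then converges for all s and is entire in s. *)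
Definition superdecay (k : R -> C) : Prop :=
  forall M, exists K, 0 <= K /\ forall v, 0 <= v -> Cmod (k v) <= K * exp (- (M * v)).

Lemma Cmod_Cexp_scal (s : C) v : Cmod (Cexp (s * RtoC v)%C) = exp (Re s * v).
Proof. rewrite Cmod_Cexp. f_equal. rewrite /Re /Im /RtoC /=. ring. Qed.

Lemma sq_le_exp v : 0 <= v -> v * v <= 4 * exp v.
Proof.
  move=> hv. have h := exp_ineq1_le (v / 2).
  have -> : exp v = exp (v / 2) * exp (v / 2) by rewrite -exp_plus; f_equal; field.
  have : (1 + v / 2) * (1 + v / 2) <= exp (v / 2) * exp (v / 2) by nra.
  nra.
Qed.

Lemma id_le_exp v : v <= exp v.
Proof. have := exp_ineq1_le v. lra. Qed.

Lemma half_int_cder k Z : cont k -> superdecay k -> (forall s, is_half_int (fun v => k v * Cexp (s * RtoC v))%C (Z s)) ->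
  forall s, exists l, cder Z s l.
Proof.
  move=> hk hd HZ s.
  (* The surplus 3 yields three factors [exp (- v)]: one is absorbed by v^2 <= 4 exp v, one by exp
     (|h| v) with |h| < 1, and the last one keeps the integral convergent. *)
  have [K [hK HK]] := hd (Re s + 3).
  have c1 : cont (fun v => k v * Cexp (s * RtoC v))%C by apply cont_mult => //; apply cont_Cexp_scal.
  have c2 : cont (fun v => RtoC v * (k v * Cexp (s * RtoC v)))%C.
  { apply cont_mult => //. apply cont_RtoC => x; apply continuous_id. }
  have Ee v : exp (- ((Re s + 3) * v)) * exp (Re s * v) = exp (- v) * exp (- v) * exp (- v).
  { rewrite -!exp_plus. f_equal. ring. }
  have b1 v : 0 <= v -> Cmod (k v * Cexp (s * RtoC v))%C <= K * (exp (- v) * exp (- v) * exp (- v)).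
  { move=> hv. rewrite Cmod_mult Cmod_Cexp_scal -Ee -Rmult_assoc.
    apply Rmult_le_compat_r; [apply Rlt_le, exp_pos | exact: HK]. }
  have em v : 0 <= v -> exp v * exp (- v) = 1 by move=> _; rewrite -exp_plus Rplus_opp_r exp_0.
  have [l Hl] : exists l, is_half_int (fun v => RtoC v * (k v * Cexp (s * RtoC v)))%C l.
  { apply (half_int_ex _ K) => // v hv. rewrite Cmod_mult Cmod_R Rabs_pos_eq //.
    have := b1 v hv. have := em v hv. have := id_le_exp v. have := exp_pos (- v).
    have p0 := Cmod_ge_0 (k v * Cexp (s * v))%C.
    set E := exp (- v). set X := Cmod _. move=> h0 h1 h2 h3.
    have hE1 : E <= 1 by rewrite /E -exp_0; apply exp_le_mono; lra.
    apply Rle_trans with (v * (K * (E * E * E))); first by apply Rmult_le_compat_l.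
    have -> : v * (K * (E * E * E)) = K * ((v * E) * (E * E)) by ring.
    apply Rmult_le_compat_l => //. have : v * E <= 1 by rewrite -h2; apply Rmult_le_compat_r; lra.
    nra. }
  exists l => eps he.
  exists (Rmin 1 (eps / (64 * K + 1))); split.
  { apply Rmin_pos; [lra | apply Rdiv_lt_0_compat; lra]. }
  move=> h hh. have h1 := Rlt_le_trans _ _ _ hh (Rmin_l _ _). have h2 := Rlt_le_trans _ _ _ hh (Rmin_r _ _).
  have p0 := Cmod_ge_0 h.
  (* The error of the linear approximation is itself a half-line integral, so that a pointwise bound
     of order |h|^2 on the integrand finishes the proof. *)
  have HJ : is_half_int (fun v => k v * Cexp (s * RtoC v) * (Cexp (h * RtoC v) - 1 - h * RtoC v))%C (Z (s + h) - Z s - l * h)%C.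
  { have c3 : cont (fun v => k v * Cexp ((s + h) * RtoC v))%C by apply cont_mult => //; apply cont_Cexp_scal.
    have H3 := half_int_scal (- h)%C _ _ c2 Hl.
    have H2 := half_int_scal (- (1))%C _ _ c1 (HZ s).
    have c2' : cont (fun v => - h * (RtoC v * (k v * Cexp (s * RtoC v))))%C by apply cont_mult => //; apply cont_const.
    have c1' : cont (fun v => - (1) * (k v * Cexp (s * RtoC v)))%C by apply cont_mult => //; apply cont_const.
    have H4 := half_int_plus _ _ _ _ c1' c2' H2 H3.
    have H5 := half_int_plus _ _ _ _ c3 (cont_plus _ _ c1' c2') (HZ (s + h)%C) H4.
    have -> : (Z (s + h) - Z s - l * h = Z (s + h) + (- (1) * Z s + - h * l))%C by ring.
    apply: half_int_ext H5 => v hv.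
    rewrite Cmult_plus_distr_r Cexp_plus. ring. }
  have cR : cont (fun v => k v * Cexp (s * RtoC v) * (Cexp (h * RtoC v) - 1 - h * RtoC v))%C.
  { apply cont_mult => //. apply cont_plus.
    - apply cont_plus; [apply cont_Cexp_scal | apply cont_const].
    - have : cont (fun v => - h * RtoC v)%C by apply cont_mult; [apply cont_const | apply cont_RtoC => x; apply continuous_id].
      move=> H x. apply: ccont_ext (H x) => t. ring. }
  apply Rle_trans with (2 * (32 * (Cmod h * Cmod h) * K)).
  { apply: half_int_bound cR _ HJ.
    { nra. }
    move=> v hv. rewrite Cmod_mult.
    have k1 := Cexp_m1z_bound (h * RtoC v)%C. rewrite Cmod_mult Cmod_R Rabs_pos_eq // in k1.
    have k2 := b1 v hv. have k3 := em v hv. have k4 := sq_le_exp v hv.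
    have k5 : exp (Cmod h * v) <= exp v by apply exp_le_mono; nra.
    set E := exp (- v) in k2 k3 *. set X := exp v in k3 k4 k5.
    have hE : 0 < E by apply exp_pos. have hX : 0 < X by apply exp_pos.
    apply Rle_trans with ((K * (E * E * E)) * (8 * (Cmod h * Cmod h * (4 * X * X)))).
    { apply Rmult_le_compat; try apply Cmod_ge_0; first exact: k2.
      apply Rle_trans with (1 := k1). apply Rmult_le_compat_l; first lra.
      have -> : Cmod h * v * (Cmod h * v) * exp (Cmod h * v) = (Cmod h * Cmod h) * (v * v * exp (Cmod h * v)) by ring.
      apply Rmult_le_compat_l; first nra.
      have := exp_pos (Cmod h * v). have : 0 <= v * v by nra.
      move=> ? ?. apply Rmult_le_compat; lra. }
    have -> : K * (E * E * E) * (8 * (Cmod h * Cmod h * (4 * X * X))) = 32 * (Cmod h * Cmod h) * K * E * ((X * E) * (X * E)) by ring.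
    rewrite k3. lra. }
  have -> : 2 * (32 * (Cmod h * Cmod h) * K) = (64 * K * Cmod h) * Cmod h by ring.
  apply Rmult_le_compat_r => //.
  have -> : eps = (64 * K + 1) * (eps / (64 * K + 1)) by field; lra.
  apply Rmult_le_compat; lra.
Qed.

(** * The theta series *)

Fixpoint csum (a : nat -> C) (n : nat) : C :=
  match n with O => RtoC 0 | S m => (csum a m + a m)%C end.

Definition is_csum (a : nat -> C) (l : C) : Prop :=
  forall eps, 0 < eps -> exists N, forall n, (N <= n)%nat -> Cmod (csum a n - l)%C < eps.

Lemma csum_sum_n a n : sum_n (G := C_AbelianMonoid) a n = csum a (S n).
Proof.
  elim: n => [|n IH].
  - rewrite sum_O /=. by rewrite Cplus_0_l.
  - rewrite sum_Sn IH. by [].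
Qed.

Lemma is_series_csum a l : is_series (K := C_AbsRing) (V := C_NormedModule) a l -> is_csum a l.
Proof.
  move=> H eps he.
  have [N HN] := H _ (locally_Cmod l eps he). exists (S N) => n hn.
  have := HN (n - 1)%nat ltac:(lia). rewrite csum_sum_n. by have -> : S (n - 1) = n by lia.
Qed.

Lemma is_csum_unique a l l' : is_csum a l -> is_csum a l' -> l = l'.
Proof.
  move=> H H'. apply Ceq_eps => e he.
  have [N1 h1] := H (e / 2) ltac:(lra). have [N2 h2] := H' (e / 2) ltac:(lra).
  have k1 := h1 (N1 + N2)%nat ltac:(lia). have k2 := h2 (N1 + N2)%nat ltac:(lia).
  have -> : (l - l' = (csum a (N1 + N2) - l') - (csum a (N1 + N2) - l))%C by ring.
  apply Rle_trans with (1 := Cmod_triangle' _ _). lra.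
Qed.

Lemma csum_scal c a n : csum (fun k => c * a k)%C n = (c * csum a n)%C.
Proof. elim: n => [|n IH] /=; [|rewrite IH]; ring. Qed.

Lemma csum_ext a b n : (forall k, (k < n)%nat -> a k = b k) -> csum a n = csum b n.
Proof. elim: n => [|n IH] //= H. rewrite IH ?H //. move=> k hk; apply H; lia. Qed.

Lemma is_csum_scal c a l : is_csum a l -> is_csum (fun k => c * a k)%C (c * l)%C.
Proof.
  move=> H eps he. have hc := Cmod_ge_0 c.
  have [N HN] := H (eps / (Cmod c + 1)) ltac:(apply Rdiv_lt_0_compat; lra).
  exists N => n hn. rewrite csum_scal.
  have -> : (c * csum a n - c * l = c * (csum a n - l))%C by ring.
  rewrite Cmod_mult. have h := HN n hn.
  have -> : eps = (Cmod c + 1) * (eps / (Cmod c + 1)) by field; lra.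
  have := Cmod_ge_0 (csum a n - l)%C. have : 0 < eps / (Cmod c + 1) by apply Rdiv_lt_0_compat; lra.
  nra.
Qed.

Definition square_dominated (a : nat -> C) (K : R) : Prop := forall n, Cmod (a n) <= K / (INR n + 1) ^ 2.

(** K / (k + 1)^2 is at most 2 K / (k + 1) - 2 K / (k + 2), and these differences telescope. *)
Lemma csum_diff_bound a K n m : 0 <= K -> square_dominated a K -> (n <= m)%nat ->
  Cmod (csum a m - csum a n)%C <= 2 * K / (INR n + 1) - 2 * K / (INR m + 1).
Proof.
  move=> hK H. elim=> [|k hk IH] /=.
  - have -> : (csum a n - csum a n = 0)%C by ring. rewrite Cmod_0. lra.
  - have -> : (csum a k + a k - csum a n = (csum a k - csum a n) + a k)%C by ring.
    apply Rle_trans with (1 := Cmod_triangle _ _).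
    have h := H k.
    have hp := pos_INR k.
    have ES : INR (S k) = INR k + 1 by rewrite S_INR.
    rewrite -/(INR (S k)) ES.
    have : K / (INR k + 1) ^ 2 <= 2 * K / (INR k + 1) - 2 * K / (INR k + 1 + 1).
    { have -> : 2 * K / (INR k + 1) - 2 * K / (INR k + 1 + 1) = K * (2 / ((INR k + 1) * (INR k + 2))) by field; lra.
      rewrite /Rdiv. apply Rmult_le_compat_l => //.
      apply (Rmult_le_reg_r ((INR k + 1) ^ 2 * (INR k + 2))); first by apply Rmult_lt_0_compat; nra.
      have -> : / (INR k + 1) ^ 2 * ((INR k + 1) ^ 2 * (INR k + 2)) = INR k + 2 by field; lra.
      have -> : 2 * / ((INR k + 1) * (INR k + 2)) * ((INR k + 1) ^ 2 * (INR k + 2)) = 2 * (INR k + 1) by field; lra.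
      lra. }
    lra.
Qed.

Lemma inv_n_small K eps : 0 <= K -> 0 < eps -> exists N, forall n, (N <= n)%nat -> K / (INR n + 1) < eps.
Proof.
  move=> hK he. have [N HN] := INR_unbounded (K / eps).
  exists N => n hn. have h1 := le_INR _ _ hn. have h0 := pos_INR n.
  apply (Rmult_lt_reg_r (INR n + 1)); first lra.
  have -> : K / (INR n + 1) * (INR n + 1) = K by field; lra.
  have -> : K = K / eps * eps by field; lra.
  rewrite (Rmult_comm eps). apply Rmult_lt_compat_r => //. lra.
Qed.

Lemma square_dominated_csum_diff a K n m : 0 <= K -> square_dominated a K -> (n <= m)%nat ->
  Cmod (csum a m - csum a n)%C <= 2 * K / (INR n + 1).
Proof.
  move=> hK H h. have h1 := csum_diff_bound a K n m hK H h.
  have h0 := pos_INR m.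
  have : 0 <= 2 * K / (INR m + 1).
  { apply Rmult_le_pos; [lra | apply Rlt_le, Rinv_0_lt_compat; lra]. }
  lra.
Qed.

Lemma cauchy_limit (u : nat -> R) (e : nat -> R) :
  (forall eps, 0 < eps -> exists N, forall n, (N <= n)%nat -> e n < eps) ->
  (forall n m, (n <= m)%nat -> Rabs (u m - u n) <= e n) ->
  exists l, forall eps, 0 < eps -> exists N, forall n, (N <= n)%nat -> Rabs (u n - l) < eps.
Proof.
  move=> He H.
  have [l Hl] : exists l, Un_cv u l.
  { have [l hl] := Rcomplete.R_complete u ltac:(move=> eps heps; have [N HN] := He eps heps;
      exists N => n m hn hm; rewrite /Rdist;
      case: (Nat.le_ge_cases n m) => h;
       [rewrite Rabs_minus_sym; apply Rle_lt_trans with (1 := H _ _ h); by apply HN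
       |apply Rle_lt_trans with (1 := H _ _ h); by apply HN]).
    by exists l. }
  exists l => eps he. have [N HN] := Hl eps he. exists N => n hn. exact: HN.
Qed.

Lemma square_dominated_csum a K : 0 <= K -> square_dominated a K -> exists l, is_csum a l.
Proof.
  move=> hK H.
  have He : forall eps, 0 < eps -> exists N, forall n, (N <= n)%nat -> 2 * K / (INR n + 1) < eps.
  { move=> eps he; apply inv_n_small => //. lra. }
  have [lr Hr] := cauchy_limit (fun n => Re (csum a n)) _ He
    (fun n m h => Rle_trans _ _ _ (re_le_Cmod (csum a m - csum a n)%C) (square_dominated_csum_diff a K n m hK H h)).
  have [li Hi] := cauchy_limit (fun n => Im (csum a n)) _ He
    (fun n m h => Rle_trans _ _ _ (im_le_Cmod (csum a m - csum a n)%C) (square_dominated_csum_diff a K n m hK H h)).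
  exists (lr, li) => eps he.
  have [N1 h1] := Hr (eps / 2) ltac:(lra). have [N2 h2] := Hi (eps / 2) ltac:(lra).
  exists (N1 + N2)%nat => n hn.
  apply Rle_lt_trans with (1 := Cmod_le_re_im _).
  have k1 := h1 n ltac:(lia). have k2 := h2 n ltac:(lia).
  have -> : Re (csum a n - (lr, li))%C = Re (csum a n) - lr by [].
  have -> : Im (csum a n - (lr, li))%C = Im (csum a n) - li by [].
  lra.
Qed.

Lemma square_dominated_tail a K l n : 0 <= K -> square_dominated a K -> is_csum a l -> Cmod (l - csum a n)%C <= 2 * K / (INR n + 1).
Proof.
  move=> hK H Hl. apply le_epsilon => e he.
  have [N HN] := Hl e he. have h := HN (N + n)%nat ltac:(lia).
  have h2 := square_dominated_csum_diff a K n (N + n) hK H ltac:(lia).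
  have -> : (l - csum a n = (csum a (N + n) - csum a n) - (csum a (N + n) - l))%C by ring.
  apply Rle_trans with (1 := Cmod_triangle' _ _). lra.
Qed.

Definition csum_limit (a : nat -> C) : C := epsilon (inhabits (RtoC 0)) (is_csum a).

Lemma csum_limitP a K : 0 <= K -> square_dominated a K -> is_csum a (csum_limit a).
Proof. move=> hK H. apply (epsilon_spec (inhabits (RtoC 0)) (is_csum a)). exact: (square_dominated_csum _ K). Qed.

Lemma cont_csum f n : (forall k, cont (f k)) -> cont (fun v => csum (fun k => f k v) n).
Proof.
  move=> H. elim: n => [|n IH] /=; first exact: cont_const. exact: cont_plus.
Qed.

Lemma half_int_csum f L n : (forall k, cont (f k)) -> (forall k, is_half_int (f k) (L k)) ->
  is_half_int (fun v => csum (fun k => f k v) n) (csum L n).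
Proof.
  move=> Hc HJ. elim: n => [|n IH] /=.
  - move=> eps he. exists 0; split; first lra. move=> b hb.
    rewrite cint_const. have -> : (0 * (b - 0)%R - 0 = 0)%C by ring. by rewrite Cmod_0.
  - apply half_int_plus => //. exact: cont_csum.
Qed.

(** Termwise integration. The domination is a product of a decay in v and a decay in k, so the
    remainder after n terms is at most 2 K exp (- v) / (n + 1) pointwise and contributes at most 4 K
    / (n + 1) to the integral. *)
Lemma half_int_series f F K L l : 0 <= K -> (forall k, cont (f k)) -> cont F ->
  (forall k v, 0 <= v -> Cmod (f k v) <= K * exp (- v) / (INR k + 1) ^ 2) ->
  (forall v, 0 <= v -> is_csum (fun k => f k v) (F v)) ->
  (forall k, is_half_int (f k) (L k)) -> is_half_int F l -> is_csum L l.
Proof.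
  move=> hK Hc HcF Hb Hs HJ HF eps he.
  have [N HN] := inv_n_small (4 * K) eps ltac:(lra) he.
  exists N => n hn. apply Rle_lt_trans with (2 := HN n hn).
  have hn0 := pos_INR n.
  have c1 := cont_csum f n Hc.
  have c2 : cont (fun v => - (1) * F v)%C by apply cont_mult => //; apply cont_const.
  have J := half_int_plus _ _ _ _ c1 c2 (half_int_csum f L n Hc HJ) (half_int_scal (- (1))%C _ _ HcF HF).
  have -> : (csum L n - l = csum L n + - (1) * l)%C by ring.
  have hp : 0 <= 2 * K / (INR n + 1) by apply Rmult_le_pos; [lra | apply Rlt_le, Rinv_0_lt_compat; lra].
  have -> : 4 * K / (INR n + 1) = 2 * (2 * K / (INR n + 1)) by field; lra.
  apply: half_int_bound J => //; first exact: cont_plus.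
  move=> v hv.
  have he0 := exp_pos (- v).
  have := square_dominated_tail (fun k => f k v) (K * exp (- v)) (F v) n ltac:(nra) (fun k => Hb k v hv) (Hs v hv).
  rewrite -Cmod_opp.
  have -> : (- (F v - csum (fun k => f k v) n) = csum (fun k => f k v) n + - (1) * F v)%C by ring.
  move=> h. apply Rle_trans with (1 := h). apply Req_le. field. lra.
Qed.

Lemma ccont_eps f x : (forall eps, 0 < eps -> exists del, 0 < del /\ forall t, Rabs (t - x) < del -> Cmod (f t - f x)%C < eps) -> ccont f x.
Proof.
  move=> H; split; apply continuity_pt_filterlim => eps he; have [d [hd Hd]] := H eps he;
  exists d; split => // t [_ ht]; apply Rle_lt_trans with (2 := Hd t ht).
  - exact: (re_le_Cmod (f t - f x)%C).
  - exact: (im_le_Cmod (f t - f x)%C).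
Qed.

Lemma continuous_eps (F : R -> R) p : continuous F p -> forall e, 0 < e -> exists d, 0 < d /\ forall q, Rabs (q - p) < d -> Rabs (F q - F p) < e.
Proof.
  move=> /continuity_pt_filterlim hF e he. have [d [hd Hd]] := hF e he.
  exists d; split => // q hq. case: (Req_dec q p) => [->|hn].
  - by rewrite Rminus_diag Rabs_R0.
  - apply (Hd q). split => //. split => //. by apply not_eq_sym.
Qed.

Lemma eps_ccont f x : ccont f x -> forall eps, 0 < eps -> exists del, 0 < del /\ forall t, Rabs (t - x) < del -> Cmod (f t - f x)%C < eps.
Proof.
  move=> [h1 h2] eps he.
  have [d1 [p1 H1]] := continuous_eps _ _ h1 (eps / 2) ltac:(lra).
  have [d2 [p2 H2]] := continuous_eps _ _ h2 (eps / 2) ltac:(lra).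
  exists (Rmin d1 d2); split; first by apply Rmin_pos.
  move=> t ht. apply Rle_lt_trans with (1 := Cmod_le_re_im _).
  have := H1 t (Rlt_le_trans _ _ _ ht (Rmin_l _ _)). have := H2 t (Rlt_le_trans _ _ _ ht (Rmin_r _ _)).
  have -> : Re (f t - f x)%C = Re (f t) - Re (f x) by []. have -> : Im (f t - f x)%C = Im (f t) - Im (f x) by [].
  lra.
Qed.

Lemma ccont_uniform F x : (forall eps, 0 < eps -> exists g del, ccont g x /\ 0 < del /\
    forall t, Rabs (t - x) < del -> Cmod (F t - g t)%C < eps) -> ccont F x.
Proof.
  move=> H. apply ccont_eps => eps he.
  have [g [d1 [hg [hd1 H1]]]] := H (eps / 3) ltac:(lra).
  have [d2 [hd2 H2]] := eps_ccont _ _ hg (eps / 3) ltac:(lra).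
  exists (Rmin d1 d2); split; first by apply Rmin_pos.
  move=> t ht.
  have k1 := H1 t (Rlt_le_trans _ _ _ ht (Rmin_l _ _)). have k2 := H2 t (Rlt_le_trans _ _ _ ht (Rmin_r _ _)).
  have k3 := H1 x ltac:(rewrite Rminus_diag Rabs_R0; lra).
  have -> : (F t - F x = (F t - g t) + (g t - g x) - (F x - g x))%C by ring.
  apply Rle_lt_trans with (1 := Cmod_triangle' _ _).
  have := Cmod_triangle (F t - g t)%C (g t - g x)%C. lra.
Qed.

(** The p-th power of y / p <= exp (y / p). All fast decay of the theta series and of the Gaussians
    is derived from this. *)
Lemma pow_exp_bound p y : (1 <= p)%nat -> 0 <= y -> y ^ p * exp (- y) <= INR p ^ p.
Proof.
  move=> hp hy. have hp' : 1 <= INR p by apply (le_INR 1 p).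
  have h : y / INR p <= exp (y / INR p) by apply id_le_exp.
  have h0 : 0 <= y / INR p by apply Rmult_le_pos => //; apply Rlt_le, Rinv_0_lt_compat; lra.
  have h1 := pow_incr _ _ p (conj h0 h).
  have E : exp (y / INR p) ^ p = exp y.
  { have -> : exp y = exp (INR p * (y / INR p)) by f_equal; field; lra.
    move: (y / INR p) => z. clear. elim: p => [|p IH]; first by rewrite /= Rmult_0_l exp_0.
    rewrite S_INR /= IH -exp_plus. f_equal. ring. }
  rewrite E in h1.
  have -> : y ^ p = INR p ^ p * (y / INR p) ^ p.
  { rewrite -Rpow_mult_distr. f_equal. field. lra. }
  have h2 := exp_pos (- y).
  have h3 : exp y * exp (- y) = 1 by rewrite -exp_plus Rplus_opp_r exp_0.
  have h4 : 0 <= INR p ^ p by apply pow_le; lra.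
  rewrite Rmult_assoc.
  have : (y / INR p) ^ p * exp (- y) <= 1 by rewrite -h3; apply Rmult_le_compat_r; lra.
  nra.
Qed.

(* [theta_term n] has index [n + 1], so that [1 + 2 * Theta w] is the sum of
   [exp (- PI k^2 w)] over all integers [k]. *)
Definition theta_term (n : nat) (w : C) : C := Cexp (RtoC (- (PI * (INR n + 1) ^ 2)) * w)%C.
Definition Theta (w : C) : C := csum_limit (fun n => theta_term n w).
(* [ray beta v = exp (2 (v + i beta))] has argument [2 beta]; [Theta] converges on it
   for [|beta| < PI / 4]. *)
Definition ray (beta v : R) : C := Cexp (Ci * RtoC (2 * beta) + RtoC 2 * RtoC v)%C.

Lemma Cmod_theta_term n w : Cmod (theta_term n w) = exp (- (PI * (INR n + 1) ^ 2 * Re w)).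
Proof. rewrite /theta_term Cmod_Cexp. f_equal. rewrite /Re /Im /RtoC /=. ring. Qed.

Lemma PI_gt_3 : 3 < PI.
Proof. have := PI2_3_2. lra. Qed.

(** One factor (n + 1)^2 is kept for summability in n, while the free exponent p sits on x: large p
    gives decay at v = + infinity on a ray, and p = 1 a moderate bound at v = - infinity. *)
Lemma theta_term_bound p n w x : (1 <= p)%nat -> 0 < x -> x <= Re w ->
  Cmod (theta_term n w) <= (INR p ^ p / x ^ p) / (INR n + 1) ^ 2.
Proof.
  move=> hp hx hw. rewrite Cmod_theta_term.
  have hn := pos_INR n. have hpi := PI_gt_3.
  have hn2 : 1 <= (INR n + 1) ^ 2 by nra.
  have hxp : 0 < x ^ p by apply pow_lt.
  apply Rle_trans with (exp (- ((INR n + 1) ^ 2 * x))).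
  { apply exp_le_mono. apply Ropp_le_contravar.
    have : (INR n + 1) ^ 2 * x <= (INR n + 1) ^ 2 * Re w by apply Rmult_le_compat_l; lra.
    have : 0 <= (INR n + 1) ^ 2 * Re w by apply Rmult_le_pos; lra.
    nra. }
  have h := pow_exp_bound p ((INR n + 1) ^ 2 * x) hp ltac:(apply Rmult_le_pos; lra).
  rewrite Rpow_mult_distr in h.
  set E := exp _ in h *. have hE : 0 < E by apply exp_pos.
  have h2 : (INR n + 1) ^ 2 <= ((INR n + 1) ^ 2) ^ p.
  { rewrite -{1}(pow_1 ((INR n + 1) ^ 2)). by apply Rle_pow. }
  apply (Rmult_le_reg_r ((INR n + 1) ^ 2 * x ^ p)); first by apply Rmult_lt_0_compat; lra.
  have -> : INR p ^ p / x ^ p / (INR n + 1) ^ 2 * ((INR n + 1) ^ 2 * x ^ p) = INR p ^ p by field; split; lra.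
  apply Rle_trans with (2 := h).
  rewrite Rmult_comm. apply Rmult_le_compat_r; first lra. apply Rmult_le_compat_r; lra.
Qed.

Lemma theta_term_dominated p w x : (1 <= p)%nat -> 0 < x -> x <= Re w -> square_dominated (fun n => theta_term n w) (INR p ^ p / x ^ p).
Proof. move=> hp hx hw n. exact: theta_term_bound. Qed.

Lemma theta_const_pos p x : 0 < x -> 0 <= INR p ^ p / x ^ p.
Proof. move=> hx. apply Rmult_le_pos; [apply pow_le, pos_INR | by apply Rlt_le, Rinv_0_lt_compat, pow_lt]. Qed.

Lemma Theta_is_csum w : 0 < Re w -> is_csum (fun n => theta_term n w) (Theta w).
Proof. move=> hw. apply: (csum_limitP _ _ (theta_const_pos 1 _ hw)). apply theta_term_dominated => //. apply Rle_refl. Qed.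

Lemma Theta_bound p w : (1 <= p)%nat -> 0 < Re w -> Cmod (Theta w) <= 2 * (INR p ^ p / Re w ^ p).
Proof.
  move=> hp hw.
  have := square_dominated_tail _ _ _ 0 (theta_const_pos p _ hw) (theta_term_dominated p w _ hp hw (Rle_refl _)) (Theta_is_csum w hw).
  rewrite /=. have -> : (Theta w - 0 = Theta w)%C by ring.
  move=> h. apply Rle_trans with (1 := h). apply Req_le. field. apply pow_nonzero. lra.
Qed.

Lemma Re_ray beta v : Re (ray beta v) = exp (2 * v) * cos (2 * beta).
Proof. rewrite /ray /Cexp /Re /Im /RtoC /=. f_equal; f_equal; ring. Qed.

Lemma Im_ray beta v : Im (ray beta v) = exp (2 * v) * sin (2 * beta).
Proof. rewrite /ray /Cexp /Re /Im /RtoC /=. f_equal; f_equal; ring. Qed.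

Lemma cos2_pos beta : Rabs beta < PI / 4 -> 0 < cos (2 * beta).
Proof. move=> h. have := Rabs_def2 _ _ h => h2. apply cos_gt_0; lra. Qed.

Lemma cont_ray beta : cont (ray beta).
Proof. exact: (cont_Cexp_lin (Ci * RtoC (2 * beta))%C (RtoC 2)). Qed.

Lemma cont_Cexp_comp f : cont f -> cont (fun v => Cexp (f v)).
Proof.
  move=> H x. have [h1 h2] := H x. rewrite /Cexp. split; rewrite /Re /Im /=.
  - apply: continuous_mult.
    + apply (continuous_comp (fun v => Re (f v)) exp) => //. apply: ex_derive_continuous; auto_derive => //.
    + apply (continuous_comp (fun v => Im (f v)) cos) => //. apply: ex_derive_continuous; auto_derive => //.
  - apply: continuous_mult.
    + apply (continuous_comp (fun v => Re (f v)) exp) => //. apply: ex_derive_continuous; auto_derive => //.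
    + apply (continuous_comp (fun v => Im (f v)) sin) => //. apply: ex_derive_continuous; auto_derive => //.
Qed.

Lemma cont_theta_term n beta : cont (fun v => theta_term n (ray beta v)).
Proof. apply cont_Cexp_comp. apply cont_mult; [apply cont_const | apply cont_ray]. Qed.

Lemma cont_Theta beta : Rabs beta < PI / 4 -> cont (fun v => Theta (ray beta v)).
Proof.
  move=> hb x. have hc := cos2_pos _ hb.
  apply ccont_uniform => eps he.
  (* A lower bound for [Re (ray beta t)] on |t - x| < 1, where the partial sums therefore converge
     uniformly. *)
  set x0 := exp (2 * (x - 1)) * cos (2 * beta).
  have hx0 : 0 < x0 by apply Rmult_lt_0_compat => //; apply exp_pos.
  have hK := theta_const_pos 1 x0 hx0.
  have [N HN] := inv_n_small (2 * (INR 1 ^ 1 / x0 ^ 1)) eps ltac:(lra) he.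
  exists (fun v => csum (fun n => theta_term n (ray beta v)) N), 1.
  split; [|split; first lra].
  - apply (cont_csum (fun n v => theta_term n (ray beta v))) => k. exact: cont_theta_term.
  - move=> t ht. have ht2 := Rabs_def2 _ _ ht.
    have hr : x0 <= Re (ray beta t).
    { rewrite Re_ray /x0. apply Rmult_le_compat_r; first lra. apply exp_le_mono. lra. }
    apply Rle_lt_trans with (2 := HN N (Nat.le_refl _)).
    apply: square_dominated_tail => //; [apply theta_term_dominated => //|apply Theta_is_csum; lra].
Qed.

(** * Rotating the Gamma integral *)

Lemma exists_nat_ge x : exists p : nat, (1 <= p)%nat /\ x <= INR p.
Proof.
  have [N HN] := INR_unbounded x. exists (S N). split; first lia. rewrite S_INR. lra.
Qed.

(** For v <= 0 the factor [exp (kap * v)] alone suffices because kap >= 1; for v > 0 the double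
    exponential beats it, by [pow_exp_bound] with an exponent p >= kap. *)
Lemma exp_decay g kap : 0 < g -> 1 <= kap ->
  exists K, 0 <= K /\ forall v, exp (kap * v) * exp (- (g * exp (2 * v))) <= K * exp (- Rabs v).
Proof.
  move=> hg hk. have [p [hp hpk]] := exists_nat_ge kap.
  have hgp : 0 < g ^ p by apply pow_lt.
  have hpp : 0 <= INR p ^ p by apply pow_le, pos_INR.
  have h0 : 0 <= INR p ^ p / g ^ p by apply Rmult_le_pos => //; apply Rlt_le, Rinv_0_lt_compat.
  exists (1 + INR p ^ p / g ^ p). split; first lra.
  move=> v. have e1 := exp_pos (kap * v). have e2 := exp_pos (- (g * exp (2 * v))). have e3 := exp_pos (- Rabs v).
  case: (Rle_lt_dec v 0) => hv.
  - rewrite (Rabs_left1 v) // Ropp_involutive.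
    rewrite (Rabs_left1 v) // Ropp_involutive in e3.
    have : exp (- (g * exp (2 * v))) <= 1.
    { rewrite -exp_0. apply exp_le_mono. have := exp_pos (2 * v). nra. }
    have : exp (kap * v) <= exp v by apply exp_le_mono; nra.
    nra.
  - rewrite (Rabs_pos_eq v); last lra. rewrite (Rabs_pos_eq v) in e3; last lra.
    have := pow_exp_bound p (g * exp (2 * v)) hp ltac:(have := exp_pos (2 * v); nra).
    rewrite Rpow_mult_distr.
    have -> : exp (2 * v) ^ p = exp (2 * INR p * v).
    { clear. elim: p => [|p IH]; first by rewrite /= Rmult_0_r Rmult_0_l exp_0.
      rewrite S_INR /= IH -exp_plus. f_equal. ring. }
    move=> h.
    have hX := exp_pos (2 * INR p * v).
    have : exp (- (g * exp (2 * v))) <= INR p ^ p / g ^ p * exp (- (2 * INR p * v)).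
    { apply (Rmult_le_reg_r (g ^ p * exp (2 * INR p * v))); first by apply Rmult_lt_0_compat.
      have -> : INR p ^ p / g ^ p * exp (- (2 * INR p * v)) * (g ^ p * exp (2 * INR p * v))
         = INR p ^ p * (exp (2 * INR p * v) * exp (- (2 * INR p * v))) by field; lra.
      rewrite -exp_plus Rplus_opp_r exp_0 Rmult_1_r. lra. }
    move=> h2.
    apply Rle_trans with (exp (kap * v) * (INR p ^ p / g ^ p * exp (- (2 * INR p * v)))).
    { apply Rmult_le_compat_l; lra. }
    have -> : exp (kap * v) * (INR p ^ p / g ^ p * exp (- (2 * INR p * v))) =
      INR p ^ p / g ^ p * exp (kap * v + - (2 * INR p * v)) by rewrite exp_plus; ring.
    have : exp (kap * v + - (2 * INR p * v)) <= exp (- v) by apply exp_le_mono; nra.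
    nra.
Qed.

Lemma rect_int_swap f a b c d : a <= b -> c <= d -> holo_rect f a b c d -> rect_int f a b d c = (- rect_int f a b c d)%C.
Proof.
  move=> hab hcd H. rewrite /rect_int.
  rewrite (cint_swap (fun y => f (b, y)) c d); last by apply: (holo_rect_vcont _ a b) => //; lra.
  rewrite (cint_swap (fun y => f (a, y)) c d); last by apply: (holo_rect_vcont _ a b) => //; lra.
  ring.
Qed.

(** The vertical sides are left unordered because the angle of rotation may be negative. *)
Lemma goursat_any f a b c d : a <= b -> (forall z, exists l, cder f z l) -> rect_int f a b c d = RtoC 0.
Proof.
  move=> hab H. have Hh : forall a b c d, holo_rect f a b c d by move=> ? ? ? ? x y _ _; apply H.
  case: (Rle_lt_dec c d) => h; first exact: goursat.
  rewrite rect_int_swap // ?goursat //; try lra. ring.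
Qed.

Lemma cint_sym h R0 : cont h -> cint h (- R0) R0 = cint (fun v => h v + h (- v)%R)%C 0 R0.
Proof.
  move=> hc. rewrite -(cint_chasles h (- R0) 0 R0); try exact: cont_on.
  rewrite (cint_plus h (fun v => h (- v)%R)); [| exact: cont_on | exact: (cont_on _ _ _ (cont_neg _ hc))].
  rewrite Cplus_comm. f_equal.
  have E (u : R -> R) : ex_RInt u (- R0) 0 -> RInt u (- R0) 0 = RInt (fun v => u (- v)) 0 R0.
  { move=> hu. symmetry. apply is_RInt_unique.
    have H := is_RInt_comp_opp (V := R_NormedModule) u 0 R0 (RInt u 0 (- R0)).
    rewrite Ropp_0 in H.
    have {}H := H (RInt_correct _ _ _ (ex_RInt_swap _ _ _ hu)).
    have {}H := is_RInt_opp _ _ _ _ H.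
    rewrite (opp_RInt_swap u 0 (- R0)) in H; last by apply ex_RInt_swap.
    apply: is_RInt_ext H => x _. by rewrite opp_opp. }
  rewrite /cint. f_equal; apply E; [apply: ccont_on_re | apply: ccont_on_im]; exact: cont_on.
Qed.

Section GammaRot.
Variables (Gamma : C -> C) (HG : is_Gamma Gamma) (s : C) (c : R).
Hypotheses (hs : 3 <= Re s) (hc : 0 < c).

(** The integrand of Gamma (s / 2) after the substitution t = c exp (2 u), up to the factor 2
    c^(s/2). In the variable u a rotation of the ray becomes a vertical translation of the line, so
    that Goursat on rectangles applies; c will be pi (n + 1)^2. *)
Definition psi (u : C) : C := Cexp (s * u + RtoC (- c) * Cexp (RtoC 2 * u))%C.

Lemma psi_cder u : exists l, cder psi u l.
Proof.
  eexists. apply: (cder_comp Cexp); last exact: cder_Cexp.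
  apply: cder_plus.
  - apply: cder_scal. apply cder_id.
  - apply: cder_scal. apply: (cder_comp Cexp); last exact: cder_Cexp. apply: cder_scal. apply cder_id.
Qed.

Lemma Cmod_psi x y : Cmod (psi (x, y)) = exp (Re s * x - Im s * y) * exp (- (c * (exp (2 * x) * cos (2 * y)))).
Proof.
  rewrite /psi Cmod_Cexp -exp_plus. f_equal. rewrite /Cexp /Re /Im /RtoC /=.
  have -> : 2 * x - 0 * y = 2 * x by ring. have -> : 2 * y + 0 * x = 2 * y by ring. ring.
Qed.

Lemma psi_decay beta : Rabs beta < PI / 4 -> exists K, 0 <= K /\
  forall x y, Rabs y <= Rabs beta -> Cmod (psi (x, y)) <= K * exp (- Rabs x).
Proof.
  move=> hb. have hg := cos2_pos _ hb.
  have [K [hK HK]] := exp_decay (c * cos (2 * beta)) (Re s) ltac:(by apply Rmult_lt_0_compat) ltac:(lra).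
  exists (exp (Rabs (Im s)) * K). split.
  { apply Rmult_le_pos => //. apply Rlt_le, exp_pos. }
  move=> x y hy. rewrite Cmod_psi.
  have hb2 : cos (2 * beta) <= cos (2 * y).
  { have Ec z : cos (2 * z) = cos (2 * Rabs z).
    { rewrite /Rabs. case: Rcase_abs => // _. rewrite -cos_neg. f_equal. ring. }
    rewrite (Ec beta) (Ec y). have := Rabs_pos y. have := PI_RGT_0 => h1 h2.
    apply cos_decr_1; lra. }
  have h1 : exp (Re s * x - Im s * y) <= exp (Rabs (Im s)) * exp (Re s * x).
  { rewrite -exp_plus. apply exp_le_mono.
    have : - (Im s * y) <= Rabs (Im s) * 1.
    { apply Rle_trans with (1 := Rle_abs _). rewrite Rabs_Ropp Rabs_mult.
      apply Rmult_le_compat_l; first exact: Rabs_pos. have := PI_4. lra. }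
    lra. }
  have h2 : exp (- (c * (exp (2 * x) * cos (2 * y)))) <= exp (- (c * cos (2 * beta) * exp (2 * x))).
  { apply exp_le_mono. apply Ropp_le_contravar.
    have -> : c * cos (2 * beta) * exp (2 * x) = c * (exp (2 * x) * cos (2 * beta)) by ring.
    apply Rmult_le_compat_l; first lra. apply Rmult_le_compat_l => //. apply Rlt_le, exp_pos. }
  apply Rle_trans with (exp (Rabs (Im s)) * exp (Re s * x) * exp (- (c * cos (2 * beta) * exp (2 * x)))).
  { apply Rmult_le_compat => //; apply Rlt_le, exp_pos. }
  rewrite !Rmult_assoc. apply Rmult_le_compat_l; first by apply Rlt_le, exp_pos.
  have := HK x. rewrite !Rmult_assoc. done.
Qed.

Lemma cont_psi y : cont (fun v => psi (v, y)).
Proof. move=> x. have [l Hl] := psi_cder (x, y). exact: cder_hcont Hl. Qed.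

Lemma gamma_subst R0 :
  cint (fun t => Rcpow t (s / 2 - 1) * RtoC (exp (- t)))%C (c * exp (2 * - R0)) (c * exp (2 * R0)) =
  (RtoC 2 * Cexp (s / 2 * RtoC (ln c)) * cint (fun v => psi (v, 0)) (- R0) R0)%C.
Proof.
  set f := fun t => (Rcpow t (s / 2 - 1) * RtoC (exp (- t)))%C.
  rewrite -cint_scal; last exact: (cont_on _ _ _ (cont_psi 0)).
  pose g v := c * exp (2 * v). pose dg v := c * (2 * exp (2 * v)).
  have hg v : 0 < g v by apply Rmult_lt_0_compat => //; apply exp_pos.
  have Hdg v : is_derive g v (dg v) /\ continuous dg v.
  { split.
    - rewrite /g /dg. auto_derive => //. ring.
    - apply: ex_derive_continuous. rewrite /dg. auto_derive => //. }
  have hf t : 0 < t -> ccont f t.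
  { move=> ht.
    have hcln : continuous ln t by apply: ex_derive_continuous; auto_derive.
    apply ccont_mult.
    - rewrite /Rcpow.
      have H := cont_Cexp_scal (s / 2 - 1)%C (ln t).
      split; [apply (continuous_comp ln (fun x => Re (Cexp ((s / 2 - 1) * RtoC x)%C)))|
              apply (continuous_comp ln (fun x => Im (Cexp ((s / 2 - 1) * RtoC x)%C)))] => //; apply H.
    - split; last exact: continuous_const.
      apply: ex_derive_continuous. rewrite /Re /=. auto_derive => //. }
  have E v : (RtoC (dg v) * f (g v) = RtoC 2 * Cexp (s / 2 * RtoC (ln c)) * psi (v, 0))%C.
  { rewrite /f /Rcpow.
    have -> : ln (g v) = ln c + 2 * v.
    { rewrite /g ln_mult // ?ln_exp //. apply exp_pos. }
    have -> : RtoC (dg v) = (RtoC 2 * Cexp (RtoC (ln c + 2 * v)))%C.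
    { rewrite Cexp_R exp_plus exp_ln // -RtoC_mult. f_equal. rewrite /dg. ring. }
    rewrite -Cexp_R /psi.
    rewrite -!Cmult_assoc -!Cexp_plus. f_equal. f_equal.
    have -> : ((v, 0) : C) = RtoC v by [].
    rewrite -RtoC_mult Cexp_R -RtoC_mult RtoC_plus RtoC_mult.
    have -> : RtoC (- g v) = RtoC (- c * exp (2 * v)) by f_equal; rewrite /g; ring.
    field. }
  transitivity (cint (fun v => RtoC (dg v) * f (g v))%C (- R0) R0); last by apply cint_ext => v _; apply E.
  have key (u : R -> R) : (forall t, 0 < t -> continuous u t) ->
    RInt u (g (- R0)) (g R0) = RInt (fun v => dg v * u (g v)) (- R0) R0.
  { move=> hu. symmetry. apply is_RInt_unique.
    apply (@is_RInt_comp R_CompleteNormedModule u g dg (- R0) R0) => v _; [apply hu; apply hg | apply Hdg]. }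
  rewrite /cint -/(g (- R0)) -/(g R0). f_equal.
  - rewrite (key (fun t => Re (f t))); last by move=> t /hf [].
    apply RInt_ext => v _. rewrite /Re /Im /RtoC /=. ring.
  - rewrite (key (fun t => Im (f t))); last by move=> t /hf [].
    apply RInt_ext => v _. rewrite /Re /Im /RtoC /=. ring.
Qed.

(** The two ends of the Gamma integral tend to 0 and to infinity independently; here they are linked
    as c exp (- 2 R0) and c exp (2 R0), which correspond to a symmetric interval in u. *)
Lemma gamma_limit eps : 0 < eps -> exists R1, 0 <= R1 /\ forall R0, R1 <= R0 ->
  Cmod (RtoC 2 * Cexp (s / 2 * RtoC (ln c)) * cint (fun v => psi (v, 0)%R) (- R0) R0 - Gamma (s / 2))%C < eps.
Proof.
  move=> he.
  have hs2 : 0 < Re (s / 2)%C.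
  { have -> : Re (s / 2)%C = Re s / 2 by rewrite /Re /Im /RtoC /=; field. lra. }
  have H := proj2 HG (s / 2)%C hs2.
  have [Q1 Q2 [d Hd] [M HM] HQ] := H _ (locally_Cmod _ eps he).
  have [R2 [p2 h2]] := exp_neg_small c d ltac:(lra) (cond_pos d).
  exists (Rmax R2 (Rmax M 0 / c)). split; first by apply Rle_trans with (1 := p2); apply Rmax_l.
  move=> R0 hR. have hR1 : R2 <= R0 by apply Rle_trans with (2 := hR); apply Rmax_l.
  have hR2 : Rmax M 0 / c <= R0 by apply Rle_trans with (2 := hR); apply Rmax_r.
  have e1 := exp_pos (2 * - R0). have e2 := exp_pos (2 * R0).
  have q1 : Q1 (c * exp (2 * - R0)).
  { apply Hd; last nra. rewrite /ball /= /AbsRing_ball /abs /minus /plus /opp /=.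
    rewrite Ropp_0 Rplus_0_r Rabs_pos_eq; last nra.
    apply Rle_lt_trans with (2 := h2 R0 hR1). apply Rmult_le_compat_l; first lra.
    apply exp_le_mono. lra. }
  have q2 : Q2 (c * exp (2 * R0)).
  { apply HM. have h3 := exp_ineq1_le (2 * R0).
    have : Rmax M 0 <= c * R0.
    { have -> : Rmax M 0 = c * (Rmax M 0 / c) by field; lra. apply Rmult_le_compat_l; lra. }
    have := Rmax_l M 0. nra. }
  have [y [Hy1 Hy2]] := HQ _ _ q1 q2. simpl in Hy1.
  rewrite -gamma_subst.
  have -> : cint (fun t => Rcpow t (s / 2 - 1) * RtoC (exp (- t)))%C (c * exp (2 * - R0)) (c * exp (2 * R0)) = y.
  { rewrite /cint. rewrite (surjective_pairing y). f_equal; apply is_RInt_unique.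
    - exact: (is_RInt_fct_extend_fst (fun t => Rcpow t (s / 2 - 1) * RtoC (exp (- t)))%C).
    - exact: (is_RInt_fct_extend_snd (fun t => Rcpow t (s / 2 - 1) * RtoC (exp (- t)))%C). }
  exact: Hy2.
Qed.

(** Between heights 0 and beta the modulus of [psi] is at most K exp (- |x|), since cos (2 y) >= cos
    (2 beta) > 0 there. Hence the two vertical edges of the rectangle tend to 0. *)
Lemma rot_edges beta eps : Rabs beta < PI / 4 -> 0 < eps -> exists R1, 0 <= R1 /\ forall R0, R1 <= R0 ->
  Cmod (cint (fun v => psi (v, beta)) (- R0) R0 - cint (fun v => psi (v, 0)%R) (- R0) R0)%C < eps.
Proof.
  move=> hb he. have [K [hK HK]] := psi_decay beta hb.
  have [R1 [p1 h1]] := exp_neg_small (4 * K) eps ltac:(lra) he.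
  exists R1; split => // R0 hR.
  have := goursat_any psi (- R0) R0 0 beta ltac:(lra) psi_cder. rewrite /rect_int => E.
  have -> : (cint (fun v => psi (v, beta)) (- R0) R0 - cint (fun v => psi (v, 0)%R) (- R0) R0 =
    Ci * cint (fun y => psi (R0, y)) 0 beta - Ci * cint (fun y => psi (- R0, y)%R) 0 beta
     - (cint (fun x : R => psi (x, 0)%R) (- R0) R0 + Ci * cint (fun y : R => psi (R0, y)) 0 beta -
     cint (fun x : R => psi (x, beta)) (- R0) R0 - Ci * cint (fun y : R => psi (- R0, y)%R) 0 beta))%C by ring.
  rewrite E.
  have B x : Rabs x = R0 -> Cmod (cint (fun y => psi (x, y)) 0 beta) <= 2 * (K * exp (- R0) * 1).
  { move=> hx. apply Rle_trans with (2 * (K * exp (- R0) * Rabs (beta - 0))).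
    - apply cint_bound_abs.
      + move=> y _. have [l Hl] := psi_cder (x, y). exact: cder_vcont Hl.
      + move=> t ht. rewrite -hx. apply HK. move: ht. rewrite /Rmin /Rmax /Rabs.
        case: Rle_dec => ?; case: Rcase_abs => ?; case: Rcase_abs => ? ?; lra.
    - apply Rmult_le_compat_l; first lra. apply Rmult_le_compat_l.
      + apply Rmult_le_pos => //. apply Rlt_le, exp_pos.
      + rewrite Rminus_0_r. have := PI_4. lra. }
  have b1 := B R0 ltac:(apply Rabs_pos_eq; lra).
  have b2 := B (- R0) ltac:(rewrite Rabs_Ropp Rabs_pos_eq; lra).
  have -> : (Ci * cint (fun y : R => psi (R0, y)) 0 beta - Ci * cint (fun y : R => psi (- R0, y)%R) 0 beta - 0
    = Ci * cint (fun y : R => psi (R0, y)) 0 beta - Ci * cint (fun y : R => psi (- R0, y)%R) 0 beta)%C by ring.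
  apply Rle_lt_trans with (1 := Cmod_triangle' _ _). rewrite !Cmod_mult Cmod_Ci.
  have := h1 R0 hR. lra.
Qed.

(** [psi] at height beta with the constant factor exp (i beta s) removed; for c = pi (n + 1)^2 the
    second factor is [theta_term n (ray beta v)]. *)
Definition Psi (beta v : R) : C := (Cexp (s * RtoC v) * Cexp (RtoC (- c) * ray beta v))%C.

Lemma Psi_psi beta v : psi (v, beta) = (Cexp (Ci * RtoC beta * s) * Psi beta v)%C.
Proof.
  rewrite /psi /Psi /ray -!Cexp_plus. f_equal.
  have -> : ((v, beta) : C) = (RtoC v + Ci * RtoC beta)%C by rewrite /Cplus /Cmult /RtoC /=; f_equal; ring.
  have -> : (2 * (v + Ci * beta) = Ci * RtoC (2 * beta) + 2 * v)%C by rewrite RtoC_mult; ring.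
  ring.
Qed.

Lemma cont_Psi beta : cont (Psi beta).
Proof.
  apply cont_mult; first exact: cont_Cexp_scal.
  apply cont_Cexp_comp. apply cont_mult; [exact: cont_const | exact: cont_ray].
Qed.

Lemma Cexp_opp z : (Cexp (- z) * Cexp z)%C = RtoC 1.
Proof. rewrite -Cexp_plus. have -> : (- z + z = RtoC 0)%C by ring. exact: Cexp_0. Qed.

Lemma gamma_rot beta : Rabs beta < PI / 4 ->
  is_half_int (fun v => Psi beta v + Psi beta (- v)%R)%C
    (RtoC (/ 2) * Gamma (s / 2) * Cexp (- (s / 2 * RtoC (ln c))) * Cexp (- (Ci * RtoC beta * s)))%C.
Proof.
  move=> hb eps he.
  set A := Cexp (- (s / 2 * RtoC (ln c)))%C. set B := Cexp (- (Ci * RtoC beta * s))%C.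
  set P := Cmod A * Cmod B + Cmod B + 1.
  have hA := Cmod_ge_0 A. have hB := Cmod_ge_0 B.
  have hP : 0 < P by rewrite /P; nra.
  have [R1 [p1 h1]] := gamma_limit (eps / (2 * P)) ltac:(apply Rdiv_lt_0_compat; lra).
  have [R2 [p2 h2]] := rot_edges beta (eps / (2 * P)) hb ltac:(apply Rdiv_lt_0_compat; lra).
  exists (R1 + R2); split; first lra. move=> R0 hR.
  rewrite -cint_sym; last exact: cont_Psi.
  have k1 := h1 R0 ltac:(lra). have k2 := h2 R0 ltac:(lra).
  set X := cint (Psi beta) (- R0) R0. set Y := cint (fun v => psi (v, 0)%R) (- R0) R0 in k1 k2.
  have EX : cint (fun v => psi (v, beta)) (- R0) R0 = (Cexp (Ci * RtoC beta * s) * X)%C.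
  { rewrite /X -cint_scal; last exact: (cont_on _ _ _ (cont_Psi beta)).
    apply cint_ext => v _. exact: Psi_psi. }
  rewrite EX in k2.
  have EB := Cexp_opp (Ci * RtoC beta * s)%C. rewrite -/B in EB.
  have EA := Cexp_opp (s / 2 * RtoC (ln c))%C. rewrite -/A in EA.
  set Z := (RtoC 2 * Cexp (s / 2 * RtoC (ln c)) * Y - Gamma (s / 2))%C in k1.
  set V := (Cexp (Ci * RtoC beta * s) * X - Y)%C in k2.
  have -> : (X - RtoC (/ 2) * Gamma (s / 2) * A * B = B * V + RtoC (/ 2) * A * B * Z)%C.
  { have E2 : RtoC (/ 2) = (/ RtoC 2)%C by rewrite RtoC_inv.
    rewrite E2 /V /Z.
    transitivity (B * Cexp (Ci * RtoC beta * s) * X + (A * Cexp (s / 2 * RtoC (ln c)) - RtoC 1) * B * Y - / RtoC 2 * Gamma (s / 2) * A * B)%C.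
    - rewrite EB EA. ring.
    - field. }
  apply Rle_lt_trans with (1 := Cmod_triangle _ _). rewrite !Cmod_mult Cmod_R Rabs_pos_eq; last lra.
  set q := eps / (2 * P) in k1 k2.
  have hq : 0 < q by apply Rdiv_lt_0_compat; lra.
  have hE : eps = 2 * P * q by rewrite /q; field; lra.
  have a1 : Cmod B * Cmod V <= Cmod B * q by apply Rmult_le_compat_l; lra.
  have a2 : / 2 * Cmod A * Cmod B * Cmod Z <= / 2 * Cmod A * Cmod B * q.
  { apply Rmult_le_compat_l; last lra. have : 0 <= Cmod A * Cmod B by nra. nra. }
  rewrite hE /P.
  have : 0 <= Cmod A * Cmod B by nra. nra.
Qed.
End GammaRot.

(** * The Mellin representation *)

Lemma exp_pow (x : R) p : exp x ^ p = exp (INR p * x).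
Proof.
  elim: p => [|p IH]; first by rewrite /= Rmult_0_l exp_0.
  rewrite S_INR /= IH -exp_plus. f_equal. ring.
Qed.

Lemma theta_term_ray_bound beta p n v : Rabs beta < PI / 4 -> (1 <= p)%nat ->
  Cmod (theta_term n (ray beta v)) <= (INR p ^ p / cos (2 * beta) ^ p) * exp (- (2 * INR p * v)) / (INR n + 1) ^ 2.
Proof.
  move=> hb hp. have hc := cos2_pos _ hb. have hE := exp_pos (2 * v).
  have hw : 0 < Re (ray beta v) by rewrite Re_ray; apply Rmult_lt_0_compat.
  apply Rle_trans with (1 := theta_term_bound p n _ _ hp hw (Rle_refl _)). apply Req_le.
  rewrite Re_ray Rpow_mult_distr exp_pow.
  have -> : INR p * (2 * v) = 2 * INR p * v by ring.
  rewrite exp_Ropp. field.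
  have := pos_INR n. have := exp_pos (2 * INR p * v). have := pow_lt _ p hc.
  repeat split; lra.
Qed.

Lemma Theta_ray_bound beta p v : Rabs beta < PI / 4 -> (1 <= p)%nat ->
  Cmod (Theta (ray beta v)) <= 2 * (INR p ^ p / cos (2 * beta) ^ p) * exp (- (2 * INR p * v)).
Proof.
  move=> hb hp. have hc := cos2_pos _ hb. have hE := exp_pos (2 * v).
  have hw : 0 < Re (ray beta v) by rewrite Re_ray; apply Rmult_lt_0_compat.
  apply Rle_trans with (1 := Theta_bound p _ hp hw). apply Req_le.
  rewrite Re_ray Rpow_mult_distr exp_pow.
  have -> : INR p * (2 * v) = 2 * INR p * v by ring.
  rewrite exp_Ropp. field.
  have := exp_pos (2 * INR p * v). have := pow_lt _ p hc.
  repeat split; lra.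
Qed.

Lemma Theta_superdecay beta : Rabs beta < PI / 4 -> superdecay (fun v => Theta (ray beta v)).
Proof.
  move=> hb M. have [p [hp hpM]] := exists_nat_ge M. have hc := cos2_pos _ hb.
  have h0 : 0 <= INR p ^ p / cos (2 * beta) ^ p by apply theta_const_pos.
  exists (2 * (INR p ^ p / cos (2 * beta) ^ p)). split; first lra.
  move=> v hv. apply Rle_trans with (1 := Theta_ray_bound beta p v hb hp).
  apply Rmult_le_compat_l; first lra. apply exp_le_mono. have := pos_INR p. nra.
Qed.

Definition zeta_integrand (s : C) (beta v : R) : C :=
  (Theta (ray beta v) * Cexp (s * RtoC v) + Theta (ray beta (- v)) * Cexp (s * RtoC (- v)))%C.

Lemma cont_zeta_integrand s beta : Rabs beta < PI / 4 -> cont (zeta_integrand s beta).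
Proof.
  move=> hb.
  have h : cont (fun v => Theta (ray beta v) * Cexp (s * RtoC v))%C.
  { apply cont_mult; [exact: cont_Theta | exact: cont_Cexp_scal]. }
  apply cont_plus => //. exact: (cont_neg _ h).
Qed.

(** The sum over n of [gamma_rot] with c = pi (n + 1)^2. The condition 3 <= Re s comes from v = -
    infinity: the bound of [theta_term] with p = 1 costs exp (2 |v|), and exp (- Re s |v|) must
    leave exp (- |v|). At + infinity an exponent p >= Re s is used. *)
Lemma completed_zeta_mellin zeta Gamma F s beta : is_zeta zeta -> is_Gamma Gamma -> is_completed_zeta zeta Gamma F ->
  3 <= Re s -> Rabs beta < PI / 4 ->
  is_half_int (zeta_integrand s beta) (RtoC (/ 2) * F s * Cexp (- (Ci * RtoC beta * s)))%C.
Proof.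
  move=> Hz HG HF hs hb. have hc := cos2_pos _ hb.
  pose cn n := PI * (INR n + 1) ^ 2.
  have hcn n : 0 < cn n.
  { have := pos_INR n. have := PI_RGT_0 => h1 h2. apply Rmult_lt_0_compat => //. nra. }
  pose f n v := (Psi s (cn n) beta v + Psi s (cn n) beta (- v)%R)%C.
  pose L n := (RtoC (/ 2) * Gamma (s / 2) * Cexp (- (s / 2 * RtoC (ln (cn n)))) * Cexp (- (Ci * RtoC beta * s)))%C.
  have HJ n : is_half_int (f n) (L n) by apply: gamma_rot.
  have cf n : cont (f n).
  { apply cont_plus; first exact: cont_Psi. exact: (cont_neg _ (cont_Psi _ _ _)). }
  have [p [hp hpk]] := exists_nat_ge (Re s).
  set K1 := INR p ^ p / cos (2 * beta) ^ p. set K2 := INR 1 ^ 1 / cos (2 * beta) ^ 1.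
  have hK1 : 0 <= K1 by apply theta_const_pos. have hK2 : 0 <= K2 by apply theta_const_pos.
  have bf n v : 0 <= v -> Cmod (f n v) <= (K1 + K2) * exp (- v) / (INR n + 1) ^ 2.
  { move=> hv. rewrite /f. apply Rle_trans with (1 := Cmod_triangle _ _).
    rewrite /Psi !Cmod_mult !Cmod_Cexp_scal. rewrite -/(theta_term n (ray beta v)) -/(theta_term n (ray beta (- v))).
    have t1 := theta_term_ray_bound beta p n v hb hp. have t2 := theta_term_ray_bound beta 1 n (- v) hb (Nat.le_refl 1).
    rewrite -/K1 in t1. rewrite -/K2 in t2.
    have hn : 0 < / (INR n + 1) ^ 2 by apply Rinv_0_lt_compat; have := pos_INR n; nra.
    rewrite /Rdiv in t1 t2 *. set q := / (INR n + 1) ^ 2 in hn t1 t2 *.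
    have -> : (K1 + K2) * exp (- v) * q = exp (- v) * (K1 * q) + exp (- v) * (K2 * q) by ring.
    apply Rplus_le_compat.
    - apply Rle_trans with (exp (Re s * v) * (K1 * exp (- (2 * INR p * v)) * q)).
      { apply Rmult_le_compat_l => //. apply Rlt_le, exp_pos. }
      have -> : exp (Re s * v) * (K1 * exp (- (2 * INR p * v)) * q) = exp (Re s * v + - (2 * INR p * v)) * (K1 * q).
      { rewrite exp_plus. ring. }
      apply Rmult_le_compat_r; first by apply Rmult_le_pos; lra.
      apply exp_le_mono. nra.
    - apply Rle_trans with (exp (Re s * - v) * (K2 * exp (- (2 * INR 1 * - v)) * q)).
      { apply Rmult_le_compat_l => //. apply Rlt_le, exp_pos. }
      have -> : exp (Re s * - v) * (K2 * exp (- (2 * INR 1 * - v)) * q) = exp (Re s * - v + - (2 * INR 1 * - v)) * (K2 * q).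
      { rewrite exp_plus. ring. }
      apply Rmult_le_compat_r; first by apply Rmult_le_pos; lra.
      apply exp_le_mono. rewrite /=. nra. }
  have wpos v : 0 < Re (ray beta v) by rewrite Re_ray; apply Rmult_lt_0_compat => //; apply exp_pos.
  have sf v : 0 <= v -> is_csum (fun n => f n v) (zeta_integrand s beta v).
  { move=> hv eps he.
    have [N1 h1] := is_csum_scal (Cexp (s * RtoC v)) _ _ (Theta_is_csum _ (wpos v)) (eps / 2) ltac:(lra).
    have [N2 h2] := is_csum_scal (Cexp (s * RtoC (- v))) _ _ (Theta_is_csum _ (wpos (- v))) (eps / 2) ltac:(lra).
    exists (N1 + N2)%nat => n hn.
    have E m : csum (fun n => f n v) m = (csum (fun k => Cexp (s * RtoC v) * theta_term k (ray beta v)) m + csum (fun k => Cexp (s * RtoC (- v)) * theta_term k (ray beta (- v))) m)%C.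
    { elim: m => [|m IH] /=; first ring. rewrite IH /f /Psi -/(theta_term m (ray beta v)) -/(theta_term m (ray beta (- v))). ring. }
    rewrite E /zeta_integrand.
    have k1 := h1 n ltac:(lia). have k2 := h2 n ltac:(lia).
    set a1 := csum _ n in k1 *. set a2 := csum _ n in k2 *.
    set b1 := (Cexp (s * RtoC v) * Theta (ray beta v))%C in k1.
    set b2 := (Cexp (s * RtoC (- v)) * Theta (ray beta (- v)))%C in k2.
    have -> : (a1 + a2 - (Theta (ray beta v) * Cexp (s * RtoC v) + Theta (ray beta (- v)) * Cexp (s * RtoC (- v))) = (a1 - b1) + (a2 - b2))%C.
    { rewrite /b1 /b2. ring. }
    apply Rle_lt_trans with (1 := Cmod_triangle _ _). lra. }
  have bF v : 0 <= v -> Cmod (zeta_integrand s beta v) <= (2 * (K1 + K2)) * exp (- v).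
  { move=> hv.
    have := square_dominated_tail (fun n => f n v) ((K1 + K2) * exp (- v)) (zeta_integrand s beta v) 0 ltac:(have := exp_pos (- v); nra) (fun k => bf k v hv) (sf v hv).
    rewrite /=. have -> : (zeta_integrand s beta v - 0 = zeta_integrand s beta v)%C by ring. move=> h. apply Rle_trans with (1 := h).
    apply Req_le. field. }
  have [l Hl] := half_int_ex (zeta_integrand s beta) (2 * (K1 + K2)) ltac:(lra) (cont_zeta_integrand s beta hb) bF.
  have cs := half_int_series f _ (K1 + K2) L l ltac:(lra) cf (cont_zeta_integrand s beta hb) bf sf HJ Hl.
  suff <- : l = (RtoC (/ 2) * F s * Cexp (- (Ci * RtoC beta * s)))%C by [].
  apply: is_csum_unique cs _.
  have zs := is_series_csum _ _ (proj2 Hz s ltac:(lra)).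
  have zs2 := is_csum_scal (RtoC (/ 2) * Gamma (s / 2) * Rcpow PI (- s / 2) * Cexp (- (Ci * RtoC beta * s)))%C _ _ zs.
  have -> : (RtoC (/ 2) * F s * Cexp (- (Ci * RtoC beta * s)) =
    RtoC (/ 2) * Gamma (s / 2) * Rcpow PI (- s / 2) * Cexp (- (Ci * RtoC beta * s)) * zeta s)%C.
  { rewrite (proj1 HF s); first ring.
    - move=> h. rewrite h /Re /RtoC /= in hs. lra.
    - move=> n h. rewrite h /Re /RtoC /= in hs. have := pos_INR n. lra. }
  suff -> : L = (fun k => RtoC (/ 2) * Gamma (s / 2) * Rcpow PI (- s / 2) * Cexp (- (Ci * RtoC beta * s)) * Rcpow (INR (S k)) (- s))%C by [].
  apply functional_extensionality => n. rewrite /L /Rcpow.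
  (* That is, (pi (n + 1)^2)^(- s/2) = pi^(- s/2) (n + 1)^(- s), which turns the sum over n into the
     Dirichlet series. *)
  have -> : ln (cn n) = ln PI + 2 * ln (INR (S n)).
  { have hS : 0 < INR n + 1 by have := pos_INR n; lra.
    rewrite /cn ln_mult; [|exact: PI_RGT_0|by apply pow_lt].
    rewrite S_INR. f_equal.
    have -> : (INR n + 1) ^ 2 = (INR n + 1) * (INR n + 1) by ring.
    rewrite ln_mult //. ring. }
  have -> : (- (s / 2 * RtoC (ln PI + 2 * ln (INR (S n)))) = - s / 2 * RtoC (ln PI) + - s * RtoC (ln (INR (S n))))%C.
  { rewrite RtoC_plus RtoC_mult. field. }
  rewrite Cexp_plus. ring.
Qed.

(** * Euler-Maclaurin summation for Gaussians *)

Definition rder (f : R -> C) (x : R) (l : C) : Prop :=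
  is_derive (fun t => Re (f t)) x (Re l) /\ is_derive (fun t => Im (f t)) x (Im l).

Lemma csum_plus a b n : csum (fun k => a k + b k)%C n = (csum a n + csum b n)%C.
Proof. elim: n => [|n IH] /=; [|rewrite IH]; ring. Qed.

Lemma csum_Sl a n : csum a (S n) = (a 0%nat + csum (fun k => a (S k)) n)%C.
Proof. elim: n => [|n IH]; [rewrite /=; ring | rewrite [LHS]/= -/(csum a (S n)) IH /=; ring]. Qed.

Lemma csum_rev a n : csum a n = csum (fun k => a (n - 1 - k)%nat) n.
Proof.
  elim: n a => [|n IH] a //.
  rewrite csum_Sl (IH (fun k => a (S k))).
  rewrite [RHS]/=. have -> : (n - 0 - n = 0)%nat by lia. rewrite Cplus_comm. f_equal.
  apply csum_ext => k hk. f_equal. lia.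
Qed.

Lemma csum_add a n m : csum a (n + m) = (csum a n + csum (fun k => a (n + k)%nat) m)%C.
Proof.
  elim: m => [|m IH] /=; first by rewrite Nat.add_0_r; ring.
  rewrite Nat.add_succ_r /= IH. ring.
Qed.

Definition nsum (f : R -> C) (x h : R) (n : nat) : C := csum (fun k => f (x + INR k * h)) n.
Definition em_error (f : R -> C) (x h : R) (n : nat) : C := (RtoC h * nsum f x h n - cint f x (x + INR n * h))%C.

Lemma rder_plus f g x l m : rder f x l -> rder g x m -> rder (fun t => f t + g t)%C x (l + m)%C.
Proof.
  move=> [f1 f2] [g1 g2]; split.
  - exact: (is_derive_plus (fun t => Re (f t)) (fun t => Re (g t))).
  - exact: (is_derive_plus (fun t => Im (f t)) (fun t => Im (g t))).
Qed.

Lemma rder_shift f x y l : rder f (x + y) l -> rder (fun t => f (t + y)) x l.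
Proof.
  move=> [h1 h2]; split.
  - have := is_derive_comp (fun t => Re (f t)) (fun t => t + y) x (Re l) 1 h1 ltac:(auto_derive => //; ring).
    by rewrite /scal /= /mult /= Rmult_1_l.
  - have := is_derive_comp (fun t => Im (f t)) (fun t => t + y) x (Im l) 1 h2 ltac:(auto_derive => //; ring).
    by rewrite /scal /= /mult /= Rmult_1_l.
Qed.

Lemma nsum_rder f f1 h n x : (forall y, rder f y (f1 y)) -> rder (fun t => nsum f t h n) x (nsum f1 x h n).
Proof.
  move=> H. rewrite /nsum. elim: n => [|n IH].
  - rewrite /=. split; exact: is_derive_const.
  - apply: rder_plus => //. exact: (rder_shift f).
Qed.

Lemma rder_cont f f1 : (forall y, rder f y (f1 y)) -> cont f.
Proof. move=> H x. have [h1 h2] := H x. split; apply: ex_derive_continuous; eexists; eassumption. Qed.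

Lemma rder_mvt f f1 a b M : a <= b -> (forall y, rder f y (f1 y)) ->
  (forall t, a <= t <= b -> Cmod (f1 t) <= M) -> Cmod (f b - f a)%C <= 2 * (M * (b - a)).
Proof.
  move=> hab H HM. apply Rle_trans with (1 := Cmod_le_re_im _).
  have h1 := mvt_bound (fun t => Re (f t)) (fun t => Re (f1 t)) a b M hab (fun t _ => proj1 (H t))
    (fun t ht => Rle_trans _ _ _ (re_le_Cmod _) (HM t ht)).
  have h2 := mvt_bound (fun t => Im (f t)) (fun t => Im (f1 t)) a b M hab (fun t _ => proj2 (H t))
    (fun t ht => Rle_trans _ _ _ (im_le_Cmod _) (HM t ht)).
  have -> : Re (f b - f a)%C = Re (f b) - Re (f a) by []. have -> : Im (f b - f a)%C = Im (f b) - Im (f a) by [].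
  lra.
Qed.

Lemma cint_shift f a b y : cont f -> cint (fun t => f (t + y)) a b = cint f (a + y) (b + y).
Proof.
  move=> hf.
  have key (u : R -> R) : (forall x, continuous u x) -> RInt (fun t => u (t + y)) a b = RInt u (a + y) (b + y).
  { move=> hu. have := RInt_comp_lin u 1 y a b. rewrite !Rmult_1_l => <-.
    - apply RInt_ext => x _. by rewrite /scal /= /mult /= !Rmult_1_l.
    - apply: ex_RInt_continuous => z _. apply hu. }
  rewrite /cint. f_equal.
  - apply (key (fun t => Re (f t))) => x. exact: (proj1 (hf x)).
  - apply (key (fun t => Im (f t))) => x. exact: (proj2 (hf x)).
Qed.

Lemma cont_shift f y : cont f -> cont (fun t => f (t + y)).
Proof.
  move=> H x. have [h1 h2] := H (x + y).
  split; [apply (continuous_comp (fun v => v + y) (fun v => Re (f v)))|apply (continuous_comp (fun v => v + y) (fun v => Im (f v)))] => //;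
  apply: ex_derive_continuous; auto_derive => //.
Qed.

(** All n steps are translated onto the interval from 0 to h; the Riemann sum and the integral can
    then be compared under a single integral over one step. *)
Lemma cint_nsum f x h n : cont f -> cint f x (x + INR n * h) = cint (fun t => nsum f (t + x) h n) 0 h.
Proof.
  move=> hf. rewrite /nsum. elim: n => [|n IH].
  - rewrite /= Rmult_0_l Rplus_0_r cint_point cint_const. ring.
  - rewrite [in RHS]/=. 
    have c2 : cont (fun t => f (t + x + INR n * h)).
    { have := cont_shift f (x + INR n * h) hf. move=> H y. apply: ccont_ext (H y) => t. f_equal. ring. }
    rewrite (cint_plus (fun t => csum (fun k => f (t + x + INR k * h)) n)); last exact: cont_on; last first.
    { apply cont_on. apply (cont_csum (fun k t => f (t + x + INR k * h))) => k.
      have := cont_shift f (x + INR k * h) hf. move=> H y. apply: ccont_ext (H y) => t. f_equal. ring. }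
    rewrite -IH. rewrite -(cint_chasles f x (x + INR n * h)); try exact: cont_on.
    f_equal. rewrite S_INR.
    transitivity (cint (fun t => f (t + (x + INR n * h))) 0 h).
    + rewrite cint_shift //. f_equal; ring.
    + apply cint_ext => t _. f_equal. ring.
Qed.

(* [em_error f x h n] is the integral over [0 <= r <= h] of the differences [nsum f x - nsum f (x + r)],
   each of which is controlled by [nsum f1]. *)
Lemma em_error_step f f1 x h n M : 0 < h -> (forall y, rder f y (f1 y)) ->
  (forall r, 0 <= r <= h -> Cmod (RtoC h * nsum f1 (x + r) h n)%C <= M) -> Cmod (em_error f x h n) <= 4 * (h * M).
Proof.
  move=> hh H HM. have hf := rder_cont _ _ H.
  have cn : cont (fun t => nsum f (t + x) h n).
  { apply: (cont_shift (fun t => nsum f t h n)). apply (cont_csum (fun k t => f (t + INR k * h))) => k. exact: cont_shift. }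
  have -> : em_error f x h n = cint (fun t => - (1) * nsum f (t + x) h n + nsum f x h n)%C 0 h.
  { rewrite (cint_plus _ (fun _ => nsum f x h n)); last exact: cont_on (cont_const _); last first.
    { apply cont_on, cont_mult => //. exact: cont_const. }
    rewrite cint_scal; last exact: cont_on. rewrite -cint_nsum // cint_const /em_error Rminus_0_r. ring. }
  have hM : forall r, 0 <= r <= h -> Cmod (nsum f1 (x + r) h n) <= M / h.
  { move=> r hr. have := HM r hr. rewrite Cmod_mult Cmod_R Rabs_pos_eq; last lra.
    move=> h1. apply (Rmult_le_reg_l h) => //. have -> : h * (M / h) = M by field; lra. done. }
  have hM0 : 0 <= M / h by apply Rle_trans with (2 := hM 0 ltac:(lra)); apply Cmod_ge_0.
  apply Rle_trans with (2 * (2 * (M / h * h) * (h - 0))).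
  - apply cint_bound; first lra.
    + apply cont_on, cont_plus; last exact: cont_const. apply cont_mult => //. exact: cont_const.
    + move=> t ht.
      have -> : (- (1) * nsum f (t + x) h n + nsum f x h n = - (nsum f (x + t)%R h n - nsum f x h n))%C.
      { rewrite (Rplus_comm x t). ring. }
      rewrite Cmod_opp.
      apply Rle_trans with (2 * (M / h * (x + t - x))).
      * apply (rder_mvt (fun y => nsum f y h n) (fun y => nsum f1 y h n)); first lra.
        -- move=> y. exact: nsum_rder.
        -- move=> u hu. have := hM (u - x) ltac:(lra). by have -> : x + (u - x) = u by ring.
      * have -> : x + t - x = t by ring. nra.
  - apply Req_le. field. lra.
Qed.

Section Gauss.
Variable tau : R.
(** The powers y^j make the family stable under differentiation up to linear combinations, as an
    induction on the order of Euler-Maclaurin summation requires. *)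
Definition gauss (j : nat) (y : R) : C := (RtoC (y ^ j) * Cexp (RtoC (- (PI * y ^ 2)) * ((1, tau) : C)))%C.
(** For j = 0 the index [pred j] is 0 again, which is harmless because its coefficient [INR j]
    vanishes. *)
Definition gauss_deriv (j : nat) (y : R) : C :=
  (RtoC (INR j) * gauss (pred j) y + RtoC (- (2 * PI)) * ((1, tau) : C) * gauss (S j) y)%C.

Lemma gauss_rder j y : rder (gauss j) y (gauss_deriv j y).
Proof.
  have E : forall t, gauss j t = (t ^ j * (exp (- (PI * t ^ 2)) * cos (- (PI * t ^ 2) * tau)), t ^ j * (exp (- (PI * t ^ 2)) * sin (- (PI * t ^ 2) * tau))).
  { move=> t. rewrite /gauss /Cexp /Cmult /RtoC /Re /Im /=.
    have -> : - (PI * (t * (t * 1))) * 1 - 0 * tau = - (PI * (t * (t * 1))) by ring.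
    have -> : - (PI * (t * (t * 1))) * tau + 0 * 1 = - (PI * (t * (t * 1))) * tau by ring.
    f_equal; ring. }
  have EE k : gauss k y = (RtoC (y ^ k) * gauss 0 y)%C by rewrite /gauss /= ; ring.
  split.
  - apply (is_derive_ext (fun t => t ^ j * (exp (- (PI * t ^ 2)) * cos (- (PI * t ^ 2) * tau)))).
    { move=> t. by rewrite E. }
    auto_derive => //. rewrite /gauss_deriv (EE (pred j)) (EE (S j)) /gauss /Cexp /Re /Im /RtoC /=. 
    have -> : - (PI * (y * (y * 1))) * 1 - 0 * tau = - (PI * (y * (y * 1))) by ring.
    have -> : - (PI * (y * (y * 1))) * tau + 0 * 1 = - (PI * (y * (y * 1))) * tau by ring.
    ring.
  - apply (is_derive_ext (fun t => t ^ j * (exp (- (PI * t ^ 2)) * sin (- (PI * t ^ 2) * tau)))).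
    { move=> t. by rewrite E. }
    auto_derive => //. rewrite /gauss_deriv (EE (pred j)) (EE (S j)) /gauss /Cexp /Re /Im /RtoC /=. 
    have -> : - (PI * (y * (y * 1))) * 1 - 0 * tau = - (PI * (y * (y * 1))) by ring.
    have -> : - (PI * (y * (y * 1))) * tau + 0 * 1 = - (PI * (y * (y * 1))) * tau by ring.
    ring.
Qed.

Lemma cont_gauss j : cont (gauss j).
Proof. exact: rder_cont (gauss_rder j). Qed.

(** From [pow_exp_bound] with exponent j + 1 at z = 1 + y^2; the factor [exp 1] pays for replacing
    exp (- y^2) by exp (- z). *)
Definition gauss_const (j : nat) : R := exp 1 * INR (S j) ^ (S j).

Lemma Cmod_gauss j y : Cmod (gauss j y) = Rabs y ^ j * exp (- (PI * y ^ 2)).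
Proof.
  rewrite /gauss Cmod_mult Cmod_R Cmod_Cexp RPow_abs. f_equal. f_equal. rewrite /Re /Im /RtoC /=. ring.
Qed.

Lemma gauss_bound j y : Cmod (gauss j y) <= gauss_const j / (1 + y ^ 2).
Proof.
  rewrite Cmod_gauss. have h2 : 0 <= y ^ 2 by apply pow2_ge_0. have hpi := PI_gt_3.
  set z := 1 + y ^ 2. have hz : 1 <= z by rewrite /z; lra.
  have hy : Rabs y <= z.
  { rewrite /z -(pow2_abs y). have := Rabs_pos y. nra. }
  have h1 : Rabs y ^ j <= z ^ j by apply pow_incr; split; [apply Rabs_pos | done].
  have h3 : exp (- (PI * y ^ 2)) <= exp 1 * exp (- z) by rewrite -exp_plus; apply exp_le_mono; rewrite /z; nra.
  have h4 := pow_exp_bound (S j) z ltac:(lia) ltac:(lra).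
  have e1 := exp_pos 1. have e2 := exp_pos (- z). have e3 := exp_pos (- (PI * y ^ 2)).
  have hzj : 0 <= z ^ j by apply pow_le; lra.
  apply (Rmult_le_reg_r z); first lra.
  have -> : gauss_const j / z * z = exp 1 * INR (S j) ^ S j by rewrite /gauss_const; field; lra.
  apply Rle_trans with (exp 1 * (z ^ S j * exp (- z))); last by apply Rmult_le_compat_l; lra.
  have -> : exp 1 * (z ^ S j * exp (- z)) = z ^ j * (exp 1 * exp (- z)) * z by rewrite /=; ring.
  apply Rmult_le_compat_r; first lra.
  apply Rmult_le_compat; try lra. apply pow_le, Rabs_pos.
Qed.

Lemma gauss_const_pos j : 0 <= gauss_const j.
Proof. apply Rmult_le_pos; [apply Rlt_le, exp_pos | apply pow_le, pos_INR]. Qed.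

Lemma is_derive_atan x : is_derive atan x (/ (1 + x ^ 2)).
Proof. apply is_derive_Reals. have := derivable_pt_lim_atan x. rewrite /Rsqr. by have -> : x ^ 2 = x * x by ring. Qed.

(** The right-hand sides telescope, which bounds Riemann sums of 1 / (1 + y^2) by 3 pi uniformly in
    the step and in the number of terms. The constant 3 holds because 1 + z^2 <= 3 (1 + y^2) for z
    between y and y + 1. *)
Lemma atan_step y h : 0 < h <= 1 -> h / (1 + y ^ 2) <= 3 * (atan (y + h) - atan y).
Proof.
  move=> hh.
  have [z [hz1 hz2]] := MVT_cor2 atan (fun x => / (1 + x ^ 2)) y (y + h) ltac:(lra)
    (fun t _ => proj1 (is_derive_Reals atan t _) (is_derive_atan t)).
  rewrite hz1. have -> : y + h - y = h by ring.
  have hy2 : 0 <= y ^ 2 by apply pow2_ge_0. have hz3 : 0 <= z ^ 2 by apply pow2_ge_0.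
  have hzz : z ^ 2 <= 2 * y ^ 2 + 2.
  { have : 0 <= (z - y) <= 1 by lra. move=> hd. have : z ^ 2 <= 2 * y ^ 2 + 2 * (z - y) ^ 2.
    { have := pow2_ge_0 (2 * y - z). nra. }
    nra. }
  have h3 : / (1 + y ^ 2) <= 3 * / (1 + z ^ 2).
  { apply (Rmult_le_reg_r ((1 + y ^ 2) * (1 + z ^ 2))); first nra.
    have -> : / (1 + y ^ 2) * ((1 + y ^ 2) * (1 + z ^ 2)) = 1 + z ^ 2 by field; lra.
    have -> : 3 * / (1 + z ^ 2) * ((1 + y ^ 2) * (1 + z ^ 2)) = 3 * (1 + y ^ 2) by field; lra.
    nra. }
  rewrite /Rdiv. nra.
Qed.

Lemma nsum_gauss_bound j x h n : 0 < h <= 1 -> Cmod (RtoC h * nsum (gauss j) x h n)%C <= 3 * PI * gauss_const j.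
Proof.
  move=> hh. have hC := gauss_const_pos j.
  have key : Cmod (RtoC h * nsum (gauss j) x h n)%C <= gauss_const j * (3 * (atan (x + INR n * h) - atan x)).
  { rewrite Cmod_mult Cmod_R Rabs_pos_eq; last lra.
    rewrite /nsum. elim: n => [|n IH].
    - rewrite /= Cmod_0 Rmult_0_l Rplus_0_r. lra.
    - rewrite [csum _ _]/=.
      have t := Cmod_triangle (csum (fun k => gauss j (x + INR k * h)) n) (gauss j (x + INR n * h)).
      have b := gauss_bound j (x + INR n * h). have a := atan_step (x + INR n * h) h hh.
      have -> : x + INR (S n) * h = x + INR n * h + h by rewrite S_INR; ring.
      have : h * Cmod (gauss j (x + INR n * h)) <= gauss_const j * (3 * (atan (x + INR n * h + h) - atan (x + INR n * h))).
      { apply Rle_trans with (gauss_const j * (h / (1 + (x + INR n * h) ^ 2))); last by apply Rmult_le_compat_l.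
        have -> : gauss_const j * (h / (1 + (x + INR n * h) ^ 2)) = h * (gauss_const j / (1 + (x + INR n * h) ^ 2)) by rewrite /Rdiv; ring.
        apply Rmult_le_compat_l => //; lra. }
      nra. }
  have b1 := atan_bound (x + INR n * h). have b2 := atan_bound x.
  nra.
Qed.

Lemma cint_gauss_bound j a b : a <= b -> Cmod (cint (gauss j) a b) <= 2 * PI * gauss_const j.
Proof.
  move=> hab. have hC := gauss_const_pos j.
  have H : is_RInt (fun y => gauss_const j * / (1 + y ^ 2)) a b (gauss_const j * atan b - gauss_const j * atan a).
  { apply (is_RInt_derive (fun y => gauss_const j * atan y) (fun y => gauss_const j * / (1 + y ^ 2))) => y _.
    - apply is_derive_scal, is_derive_atan.
    - apply: ex_derive_continuous. auto_derive. have := pow2_ge_0 y. simpl. lra. }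
  have key (u : R -> R) : (forall x, continuous u x) -> (forall t, Rabs (u t) <= Cmod (gauss j t)) -> Rabs (RInt u a b) <= PI * gauss_const j.
  { move=> hu hb.
    have eu : ex_RInt u a b by apply: ex_RInt_continuous => z _; apply hu.
    have := norm_RInt_le u (fun y => gauss_const j * / (1 + y ^ 2)) a b _ _ hab
      (fun x _ => Rle_trans _ _ _ (hb x) (gauss_bound j x)) (RInt_correct _ _ _ eu) H.
    move=> h. apply Rle_trans with (1 := h).
    have b1 := atan_bound a. have b2 := atan_bound b. nra. }
  apply Rle_trans with (1 := Cmod_le_re_im _).
  have -> : Re (cint (gauss j) a b) = RInt (fun t => Re (gauss j t)) a b by [].
  have -> : Im (cint (gauss j) a b) = RInt (fun t => Im (gauss j t)) a b by [].
  have k1 := key (fun t => Re (gauss j t)) (fun x => proj1 (cont_gauss j x)) (fun t => re_le_Cmod _).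
  have k2 := key (fun t => Im (gauss j t)) (fun x => proj2 (cont_gauss j x)) (fun t => im_le_Cmod _).
  lra.
Qed.

Lemma em_error_gauss_bound j x h n : 0 < h <= 1 -> Cmod (em_error (gauss j) x h n) <= 5 * PI * gauss_const j.
Proof.
  move=> hh. apply Rle_trans with (1 := Cmod_triangle' _ _).
  have := nsum_gauss_bound j x h n hh.
  have := cint_gauss_bound j x (x + INR n * h) ltac:(have := pos_INR n; nra). lra.
Qed.

Lemma nsum_gauss_deriv j x h n : nsum (gauss_deriv j) x h n =
  (RtoC (INR j) * nsum (gauss (pred j)) x h n + RtoC (- (2 * PI)) * ((1, tau) : C) * nsum (gauss (S j)) x h n)%C.
Proof. by rewrite /nsum -!csum_scal -csum_plus. Qed.

Lemma cont_gauss_deriv j : cont (gauss_deriv j).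
Proof. apply cont_plus; (apply cont_mult; [exact: cont_const | exact: cont_gauss]). Qed.

Lemma em_error_gauss_deriv j x h n : em_error (gauss_deriv j) x h n =
  (RtoC (INR j) * em_error (gauss (pred j)) x h n + RtoC (- (2 * PI)) * ((1, tau) : C) * em_error (gauss (S j)) x h n)%C.
Proof.
  rewrite /em_error nsum_gauss_deriv /gauss_deriv.
  rewrite (cint_plus (fun y => RtoC (INR j) * gauss (pred j) y)%C (fun y => RtoC (- (2 * PI)) * ((1, tau) : C) * gauss (S j) y)%C).
  - rewrite !cint_scal; try (apply cont_on, cont_gauss). ring.
  - apply cont_on, cont_mult; [exact: cont_const | exact: cont_gauss].
  - apply cont_on, cont_mult; [exact: cont_const | exact: cont_gauss].
Qed.
End Gauss.

(* The half-width [X] controls the boundary terms; each step moves the left end by at most [h <= 1]. *)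
Lemma em_error_gauss_order B M j : exists K, 0 <= K /\ forall tau h X x n, Rabs tau <= B -> 0 < h <= 1 -> 1 <= X ->
  x <= - X - INR M -> X <= x + INR n * h -> Cmod (em_error (gauss tau j) x h n) <= K * (h ^ M + / X).
Proof.
  case: (Rle_lt_dec 0 B) => hB; last first.
  { exists 0; split; first lra. move=> tau h X x n ht. have := Rabs_pos tau. lra. }
  have hpi := PI_gt_3.
  elim: M j => [|M IH] j.
  - have hC := gauss_const_pos j. exists (5 * PI * gauss_const j); split; first nra.
    move=> tau h X x n _ hh hX _ _. apply Rle_trans with (1 := em_error_gauss_bound tau j x h n hh).
    have : 0 < / X by apply Rinv_0_lt_compat; lra. rewrite pow_O. have : 0 <= 5 * PI * gauss_const j by nra. nra.
  - have [K1 [hK1 H1]] := IH (pred j). have [K2 [hK2 H2]] := IH (S j).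
    have hC := gauss_const_pos j. have hj := pos_INR j.
    set Kd := INR j * K1 + 2 * PI * (1 + B) * K2.
    have hKd : 0 <= Kd.
    { rewrite /Kd. have : 0 <= INR j * K1 by apply Rmult_le_pos.
      have : 0 <= 2 * PI * (1 + B) * K2 by apply Rmult_le_pos => //; nra. lra. }
    exists (4 * (Kd + 2 * gauss_const j)); split; first lra.
    move=> tau h X x n ht hh hX hx hn.
    have iX : 0 < / X by apply Rinv_0_lt_compat; lra.
    have hhM : 0 < h ^ M by apply pow_lt; lra.
    have hbd y : X <= Rabs y -> Cmod (gauss tau j y) <= gauss_const j * / X.
    { move=> hy. apply Rle_trans with (1 := gauss_bound tau j y). apply Rmult_le_compat_l => //.
      apply Rinv_le_contravar; first lra. rewrite -(pow2_abs y). nra. }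
    have om : Cmod (RtoC (- (2 * PI)) * ((1, tau) : C))%C <= 2 * PI * (1 + B).
    { rewrite Cmod_mult Cmod_R Rabs_Ropp Rabs_pos_eq; last lra.
      apply Rmult_le_compat_l; first lra. apply Rle_trans with (1 := Cmod_pair_le _ _). rewrite Rabs_R1. lra. }
    have S1 : Cmod (em_error (gauss tau j) x h n) <= 4 * (h * (Kd * (h ^ M + / X) + 2 * (gauss_const j * / X))).
    { apply: (em_error_step _ (gauss_deriv tau j)); first lra.
      - exact: gauss_rder.
      - move=> r hr. rewrite S_INR in hx.
        have e1 := H1 tau h X (x + r) n ht hh hX ltac:(lra) ltac:(lra).
        have e2 := H2 tau h X (x + r) n ht hh hX ltac:(lra) ltac:(lra).
        (* The integral of the derivative reduces to boundary values beyond X, of size 1 / X; the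
           error term obeys the induction hypothesis for [pred j] and [S j]. The factor h of
           [em_error_step] then raises the order by one. *)
        have -> : (RtoC h * nsum (gauss_deriv tau j) (x + r) h n = em_error (gauss_deriv tau j) (x + r) h n + cint (gauss_deriv tau j) (x + r) (x + r + INR n * h))%C.
        { rewrite /em_error. ring. }
        rewrite em_error_gauss_deriv (cint_derive (gauss tau j)); last exact: cont_on (cont_gauss_deriv tau j); last by move=> y _; apply gauss_rder.
        apply Rle_trans with (1 := Cmod_triangle _ _). apply Rplus_le_compat.
        + apply Rle_trans with (1 := Cmod_triangle _ _). rewrite (Cmod_mult (RtoC (INR j))) (Cmod_mult (_ * _)%C) Cmod_R Rabs_pos_eq //.
          rewrite /Kd Rmult_plus_distr_r. apply Rplus_le_compat.
          * rewrite Rmult_assoc. apply Rmult_le_compat_l => //.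
          * rewrite Rmult_assoc. apply Rmult_le_compat; try apply Cmod_ge_0; done.
        + apply Rle_trans with (1 := Cmod_triangle' _ _).
          have c1 := hbd (x + r) ltac:(rewrite Rabs_left1; have := pos_INR M; lra).
          have c2 := hbd (x + r + INR n * h) ltac:(rewrite Rabs_pos_eq; lra).
          lra. }
    apply Rle_trans with (1 := S1).
    have -> : h ^ S M = h * h ^ M by [].
    have q1 : h * / X <= / X by nra.
    have q2 : h * (Kd * (h ^ M + / X)) <= Kd * (h * h ^ M + / X).
    { have -> : h * (Kd * (h ^ M + / X)) = Kd * (h * h ^ M + h * / X) by ring.
      apply Rmult_le_compat_l => //. lra. }
    have q3 : h * (2 * (gauss_const j * / X)) <= 2 * gauss_const j * (h * h ^ M + / X).
    { have -> : h * (2 * (gauss_const j * / X)) = 2 * gauss_const j * (h * / X) by ring.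
      apply Rmult_le_compat_l; first lra. nra. }
    nra.
Qed.

(** * Theta at the cusps *)

(** The Gaussian integral over the half-line. It enters as a constant depending on tau only, the
    same for all steps h, which is what allows it to cancel at the cusps. *)
Definition gauss_half_int (tau : R) : C := epsilon (inhabits (RtoC 0)) (is_half_int (gauss tau 0)).

Lemma gauss0_exp_bound tau y : Cmod (gauss tau 0 y) <= exp 1 * exp (- Rabs y).
Proof.
  rewrite Cmod_gauss pow_O Rmult_1_l -exp_plus. apply exp_le_mono. have := PI_gt_3.
  move=> hpi. rewrite -(pow2_abs y). set a := Rabs y.
  have : 3 * a ^ 2 <= PI * a ^ 2 by apply Rmult_le_compat_r; [apply pow2_ge_0 | lra].
  nra.
Qed.

Lemma gauss_half_intP tau : is_half_int (gauss tau 0) (gauss_half_int tau).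
Proof.
  apply (epsilon_spec (inhabits (RtoC 0)) (is_half_int (gauss tau 0))).
  apply (half_int_ex _ (exp 1)); [by apply Rlt_le, exp_pos | exact: cont_gauss |].
  move=> v hv. have := gauss0_exp_bound tau v. by rewrite (Rabs_pos_eq v).
Qed.

Lemma gauss0_even tau y : gauss tau 0 (- y) = gauss tau 0 y.
Proof. rewrite /gauss. by have -> : (- y) ^ 2 = y ^ 2 by ring. Qed.

(** The 2 N + 1 sample points are the multiples k h with |k| <= N: the middle one contributes 1, and
    by evenness the two halves are equal partial sums of theta at w = h^2 (1 + i tau). *)
Lemma nsum_theta tau h N :
  nsum (gauss tau 0) (- (INR N * h)) h (N + S N) = (RtoC 1 + RtoC 2 * csum (fun n => theta_term n ((h ^ 2, h ^ 2 * tau)%R : C)) N)%C.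
Proof.
  have E y k : y = (INR k + 1) * h -> gauss tau 0 y = theta_term k ((h ^ 2, h ^ 2 * tau)%R : C).
  { move=> ->. rewrite /gauss /theta_term pow_O Cmult_1_l. f_equal. rewrite /Cmult /RtoC /=. f_equal; ring. }
  rewrite /nsum csum_add csum_rev csum_Sl.
  rewrite (csum_ext _ (fun n => theta_term n ((h ^ 2, h ^ 2 * tau)%R : C))); last first.
  { move=> k hk. rewrite -gauss0_even. apply E.
    rewrite -Nat.sub_add_distr minus_INR; last lia. rewrite plus_INR /=. ring. }
  rewrite (csum_ext (fun k => gauss tau 0 (- (INR N * h) + INR (N + S k) * h)) (fun n => theta_term n ((h ^ 2, h ^ 2 * tau)%R : C))); last first.
  { move=> k hk. apply E. rewrite plus_INR S_INR. ring. }
  have -> : gauss tau 0 (- (INR N * h) + INR (N + 0) * h) = RtoC 1.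
  { have -> : - (INR N * h) + INR (N + 0) * h = 0 by rewrite Nat.add_0_r; ring.
    rewrite /gauss pow_O Cmult_1_l -Cexp_0. f_equal. rewrite /Cmult /RtoC /=. f_equal; ring. }
  ring.
Qed.

(** For w = h^2 (1 + i tau), h (1 + 2 Theta w) is a Riemann sum of a Gaussian over the whole real
    line, without boundary terms in the limit; Euler-Maclaurin summation thus gives the integral up
    to every power of h. Uniformity in tau lets the cusps be approached along arcs. *)
Lemma Theta_small_argument B M : exists K, 0 <= K /\ forall tau h, Rabs tau <= B -> 0 < h <= 1 ->
  Cmod (RtoC h * (RtoC 1 + RtoC 2 * Theta ((h ^ 2, h ^ 2 * tau)%R : C)) - RtoC 2 * gauss_half_int tau)%C <= K * h ^ M.
Proof.
  have [K [hK HK]] := em_error_gauss_order B M 0.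
  exists K; split => // tau h ht hh. apply le_epsilon => e he.
  set w : C := (h ^ 2, h ^ 2 * tau)%R.
  have hw : 0 < Re w by rewrite /w /Re /=; nra.
  have [N1 h1] := Theta_is_csum w hw (e / 8) ltac:(lra).
  have [R1 [p1 h2]] := gauss_half_intP tau (e / 8) ltac:(lra).
  (* R1 brings the truncated integrals close to their limits, M is the room for the displaced left
     ends in [em_error_gauss_order], and 4 K / e makes K / X at most e / 4. *)
  have [N2 [_ hN2]] := exists_nat_ge ((R1 + INR M + 1 + 4 * K / e) / h).
  set N := (N1 + N2)%nat. have hN : INR N2 <= INR N by apply le_INR; lia.
  set X := INR N * h - INR M.
  have hke : 0 <= 4 * K / e by apply Rmult_le_pos; [lra | apply Rlt_le, Rinv_0_lt_compat; lra].
  have hNh : R1 + INR M + 1 + 4 * K / e <= INR N * h.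
  { have -> : R1 + INR M + 1 + 4 * K / e = (R1 + INR M + 1 + 4 * K / e) / h * h by field; lra.
    apply Rmult_le_compat_r; lra. }
  have hM := pos_INR M.
  have hX : 1 + 4 * K / e <= X by rewrite /X; lra.
  have hEnd : - (INR N * h) + INR (N + S N) * h = INR N * h + h by rewrite plus_INR S_INR; ring.
  have HE := HK tau h X (- (INR N * h)) (N + S N)%nat ht hh ltac:(lra) ltac:(rewrite /X; lra)
    ltac:(rewrite hEnd /X; lra).
  rewrite /em_error nsum_theta hEnd -/w in HE.
  have cg := cont_gauss tau 0.
  rewrite -(cint_chasles _ (- (INR N * h)) 0 (INR N * h + h)) in HE; try exact: cont_on.
  have Eneg : cint (gauss tau 0) (- (INR N * h)) 0 = cint (gauss tau 0) 0 (INR N * h).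
  { have := cint_sym (gauss tau 0) (INR N * h) cg.
    rewrite -(cint_chasles _ (- (INR N * h)) 0 (INR N * h)); try exact: cont_on.
    rewrite (cint_plus (gauss tau 0) (fun v => gauss tau 0 (- v))); [|exact: cont_on | exact: (cont_on _ _ _ (cont_neg _ cg))].
    rewrite (cint_ext (fun v => gauss tau 0 (- v)) (gauss tau 0)); last by move=> x _; apply gauss0_even.
    move=> H. 
    have -> : (cint (gauss tau 0) (- (INR N * h)) 0 = cint (gauss tau 0) (- (INR N * h)) 0 + cint (gauss tau 0) 0 (INR N * h) - cint (gauss tau 0) 0 (INR N * h))%C by ring.
    rewrite H. ring. }
  rewrite Eneg in HE.
  have k1 := h1 N ltac:(lia).
  have k2 := h2 (INR N * h) ltac:(lra). have k3 := h2 (INR N * h + h) ltac:(lra).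
  set S0 := csum _ N in HE k1. set I1 := cint _ 0 (INR N * h) in HE k2. set I2 := cint _ 0 (INR N * h + h) in HE k3.
  have -> : (h * (1 + 2 * Theta w) - 2 * gauss_half_int tau = (h * (1 + 2 * S0) - (I1 + I2)) - 2 * h * (S0 - Theta w) + ((I1 - gauss_half_int tau) + (I2 - gauss_half_int tau)))%C by ring.
  apply Rle_trans with (1 := Cmod_triangle _ _).
  apply Rle_trans with (1 := Rplus_le_compat_r _ _ _ (Cmod_triangle' _ _)).
  have t1 := Cmod_triangle (I1 - gauss_half_int tau)%C (I2 - gauss_half_int tau)%C.
  have t2 : Cmod (2 * h * (S0 - Theta w))%C <= 2 * (e / 8).
  { rewrite !Cmod_mult !Cmod_R !Rabs_pos_eq; try lra. have := Cmod_ge_0 (S0 - Theta w)%C. nra. }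
  have t3 : K * / X <= e / 4.
  { apply (Rmult_le_reg_r X); first lra. rewrite Rmult_assoc Rinv_l; last lra. rewrite Rmult_1_r.
    apply Rle_trans with (e / 4 * (4 * K / e)); last by apply Rmult_le_compat_l; lra.
    apply Req_le. field. lra. }
  lra.
Qed.

(** [ray beta (- v)] equals h^2 (1 + i tau) with h = exp (- v) sqrt (cos (2 beta)) and tau = tan (2
    beta). The two terms that fail to decay, of order exp v and 1, are those behind the poles of the
    Mellin transform at 1 and 0. *)
Lemma Theta_at_minus_infinity beta : Rabs beta < PI / 4 -> exists I : C, forall M, exists K, 0 <= K /\ forall v, 0 <= v ->
  Cmod (Theta (ray beta (- v)) - (I * RtoC (exp v) - RtoC (/ 2)))%C <= K * exp (- (M * v)).
Proof.
  move=> hb. have hc := cos2_pos _ hb.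
  set q := sqrt (cos (2 * beta)). have hq : 0 < q by apply sqrt_lt_R0.
  have hq2 : q ^ 2 = cos (2 * beta) by rewrite /q pow2_sqrt; lra.
  have hq1 : q <= 1 by have := COS_bound (2 * beta); nra.
  set tau := sin (2 * beta) / cos (2 * beta).
  exists (gauss_half_int tau * RtoC (/ q))%C => M.
  have [p [hp hpM]] := exists_nat_ge M.
  (* One power more than p, because solving for Theta divides by 2 h. *)
  have [K [hK HK]] := Theta_small_argument (Rabs tau) (S p).
  exists (K / 2); split; first lra. move=> v hv.
  set h := exp (- v) * q.
  have he := exp_pos (- v). have he1 : exp (- v) <= 1 by rewrite -exp_0; apply exp_le_mono; lra.
  have hh : 0 < h <= 1 by rewrite /h; split; nra.
  have := HK tau h (Rle_refl _) hh.
  have -> : (((h ^ 2)%R, (h ^ 2 * tau)%R) : C) = ray beta (- v).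
  { rewrite (surjective_pairing (ray beta (- v))). rewrite -/(Re (ray beta (- v))) -/(Im (ray beta (- v))) Re_ray Im_ray.
    have -> : h ^ 2 = exp (2 * - v) * cos (2 * beta).
    { by rewrite /h Rpow_mult_distr hq2 exp_pow. }
    f_equal. rewrite /tau. field. lra. }
  set T := Theta _. move=> H.
  have Eh : (T - (gauss_half_int tau * RtoC (/ q) * RtoC (exp v) - RtoC (/ 2)) = RtoC (/ (2 * h)) * (RtoC h * (RtoC 1 + RtoC 2 * T) - RtoC 2 * gauss_half_int tau))%C.
  { have Ev : exp v = / exp (- v) by rewrite exp_Ropp Rinv_inv.
    have nz1 : exp (- v) <> 0 by lra. have nz2 : q <> 0 by lra. have nz3 : 2 * (exp (- v) * q) <> 0 by nra.
    have nz4 : 2 <> 0 by lra.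
    rewrite Ev /h (RtoC_inv q) // (RtoC_inv (exp _)) // (RtoC_inv 2) // (RtoC_inv (2 * _)) // !RtoC_mult. field.
    split; move=> /RtoC_inj; lra. }
  rewrite Eh Cmod_mult Cmod_R Rabs_pos_eq; last by apply Rlt_le, Rinv_0_lt_compat; lra.
  apply Rle_trans with (/ (2 * h) * (K * h ^ S p)).
  { apply Rmult_le_compat_l => //. apply Rlt_le, Rinv_0_lt_compat; lra. }
  have -> : / (2 * h) * (K * h ^ S p) = K / 2 * h ^ p by rewrite /=; field; lra.
  apply Rmult_le_compat_l; first lra.
  apply Rle_trans with (exp (- v) ^ p).
  { apply pow_incr. rewrite /h; split; nra. }
  rewrite exp_pow. apply exp_le_mono. nra.
Qed.

Lemma cos_sin_PI_sq n : cos (PI * (INR n + 1) ^ 2) = (-1) ^ (S n) /\ sin (PI * (INR n + 1) ^ 2) = 0.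
Proof.
  have P m : cos (PI * INR m) = (-1) ^ m /\ sin (PI * INR m) = 0.
  { elim: m => [|m [IH1 IH2]]; first by rewrite /= Rmult_0_r cos_0 sin_0.
    rewrite S_INR. have -> : PI * (INR m + 1) = PI * INR m + PI by ring.
    rewrite neg_cos neg_sin IH1 IH2 /=. split; ring. }
  have -> : (INR n + 1) ^ 2 = INR (S n * S n) by rewrite mult_INR S_INR /=; ring.
  have [h1 h2] := P (S n * S n)%nat. rewrite h1 h2. split => //.
  rewrite pow_mult. clear. elim: (S n) => [|m IH]; first by rewrite pow1.
  have -> : (-1) ^ S m = - ((-1) ^ m) by rewrite /=; ring.
  case: (Nat.Even_or_Odd m) => [[k ->]|[k ->]].
  - rewrite pow_1_even. have -> : (- (1)) ^ S (2 * k) = -1. { by rewrite -(pow_1_odd k). } done.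
  - rewrite Nat.add_1_r pow_1_odd. have -> : - -1 = 1 by ring. by rewrite pow1.
Qed.

(* [exp (- i PI k^2) = (-1)^k]: near the cusps [w = i] and [w = - i] theta is an alternating
   theta series at [0]. *)
Lemma theta_term_shift n d sg : sg = 1 \/ sg = -1 ->
  theta_term n (d + Ci * RtoC sg)%C = (RtoC ((-1) ^ (S n)) * theta_term n d)%C.
Proof.
  move=> hsg. rewrite /theta_term Cmult_plus_distr_l Cexp_plus Cmult_comm. f_equal.
  have [h1 h2] := cos_sin_PI_sq n.
  rewrite /Cexp /Re /Im /RtoC /Ci /=. 
  set a := INR n + 1.
  have -> : - (PI * (a * (a * 1))) * (0 * sg - 1 * 0) - 0 * (0 * 0 + 1 * sg) = 0 by ring.
  have -> : - (PI * (a * (a * 1))) * (0 * 0 + 1 * sg) + 0 * (0 * sg - 1 * 0) = - (PI * a ^ 2 * sg) by ring.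
  rewrite exp_0 cos_neg sin_neg.
  case: hsg => ->.
  - rewrite Rmult_1_r h1 h2. rewrite /=. f_equal; ring.
  - have -> : PI * a ^ 2 * -1 = - (PI * a ^ 2) by ring. rewrite cos_neg sin_neg h1 h2 /=. f_equal; ring.
Qed.

(** Twice the even part minus the whole. Index n stands for the integer n + 1, so the even integer 2
    (n + 1) sits at index 2 n + 1. *)
Lemma csum_alt a b N : (forall n, b n = a (2 * n + 1)%nat) ->
  csum (fun n => RtoC ((-1) ^ (S n)) * a n)%C (2 * N) = (RtoC 2 * csum b N - csum a (2 * N))%C.
Proof.
  move=> H. elim: N => [|N IH]; first by rewrite /=; ring.
  have -> : (2 * S N = S (S (2 * N)))%nat by lia.
  rewrite ![csum _ (S _)]/= -!/(csum _ (2 * N)).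
  rewrite -!/(2 * N)%nat. 
  have E1 : (-1) ^ S (2 * N) = -1 by apply pow_1_odd.
  have E2 : (-1) ^ S (S (2 * N)) = 1.
  { have -> : (S (S (2 * N)) = 2 * S N)%nat by lia. apply pow_1_even. }
  have H' := H N. have e3 : (2 * N + 1 = S (2 * N))%nat by lia. rewrite e3 in H'.
  change (csum (fun n => RtoC ((-1) ^ S n) * a n)%C (2 * N) + RtoC ((-1) ^ S (2 * N)) * a (2 * N)%nat + RtoC ((-1) ^ S (S (2 * N))) * a (S (2 * N)) =
    RtoC 2 * (csum b N + b N) - (csum a (2 * N) + a (2 * N)%nat + a (S (2 * N))))%C.
  rewrite IH E1 E2 H'. have -> : RtoC (-1) = (- RtoC 1)%C by rewrite -RtoC_opp. ring.
Qed.

(** The even integers k = 2 m contribute exp (- pi m^2 (4 d)), whence the argument 4 d. *)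
Lemma Theta_alt d sg : sg = 1 \/ sg = -1 -> 0 < Re d ->
  Theta (d + Ci * RtoC sg)%C = (RtoC 2 * Theta (RtoC 4 * d) - Theta d)%C.
Proof.
  move=> hsg hd.
  have h4 : 0 < Re (RtoC 4 * d)%C by rewrite /Re /RtoC /= in hd *; lra.
  have hs : 0 < Re (d + Ci * RtoC sg)%C by rewrite /Re /RtoC /= in hd *; lra.
  have c1 := Theta_is_csum _ hs. have c2 := Theta_is_csum _ h4. have c3 := Theta_is_csum _ hd.
  apply Ceq_eps => e he.
  have [N1 h1] := c1 (e / 4) ltac:(lra). have [N2 h2] := c2 (e / 4) ltac:(lra). have [N3 h3] := c3 (e / 4) ltac:(lra).
  set N := (N1 + N2 + N3)%nat.
  have k1 := h1 (2 * N)%nat ltac:(lia). have k2 := h2 N ltac:(lia). have k3 := h3 (2 * N)%nat ltac:(lia).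
  rewrite (csum_ext _ (fun n => RtoC ((-1) ^ (S n)) * theta_term n d)%C) in k1; last by move=> k _; apply theta_term_shift.
  rewrite (csum_alt (fun n => theta_term n d) (fun n => theta_term n (RtoC 4 * d)%C)) in k1; last first.
  { move=> n. rewrite /theta_term. f_equal. rewrite Cmult_assoc -RtoC_mult. f_equal. f_equal.
    rewrite plus_INR mult_INR /=. ring. }
  set a := csum _ N in k1 k2. set b := csum _ (2 * N) in k1 k3.
  set T1 := Theta _ in k1 *. set T2 := Theta (RtoC 4 * d)%C in k2 *. set T3 := Theta d in k3 *.
  have -> : (T1 - (2 * T2 - T3) = 2 * (a - T2) - (b - T3) - (2 * a - b - T1))%C by ring.
  apply Rle_trans with (1 := Cmod_triangle' _ _).
  apply Rle_trans with (1 := Rplus_le_compat_r _ _ _ (Cmod_triangle' _ _)).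
  rewrite Cmod_mult Cmod_R Rabs_pos_eq; lra.
Qed.

(* Euler-Maclaurin at the steps [h] and [2 h] has the same main term, which therefore
   cancels in the alternating series. *)
Lemma Theta_near_cusp p : exists K, 0 <= K /\ forall beta, Rabs beta < PI / 4 ->
  Cmod (Theta (ray beta 0) + RtoC (/ 2))%C <= K * (PI / 4 - Rabs beta) ^ p.
Proof.
  (* One power of h is lost in the division by 2 h; the other 2 p give the p-th power of h^2 = sin
     (2 ep) <= 2 ep. *)
  have [K [hK HK]] := Theta_small_argument 1 (S (2 * p)).
  have h2p : 0 < 2 ^ S (2 * p) by apply pow_lt; lra.
  exists (K * (1 + 2 ^ S (2 * p)) * 2 ^ p + 9 * 8 ^ p). 
  have k0 : 0 <= K * (1 + 2 ^ S (2 * p)) * 2 ^ p.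
  { apply Rmult_le_pos; [apply Rmult_le_pos; lra | apply pow_le; lra]. }
  have k1 : 0 <= 9 * 8 ^ p by have := pow_le 8 p; lra.
  split; first lra.
  move=> beta hb. set ep := PI / 4 - Rabs beta.
  have hpi := PI_RGT_0.
  have hep : 0 < ep <= PI / 4 by rewrite /ep; have := Rabs_pos beta; lra.
  have hepp : 0 < ep ^ p by apply pow_lt; lra.
  have [sg [hsg hbs]] : exists sg, (sg = 1 \/ sg = -1) /\ beta = sg * (PI / 4 - ep).
  { rewrite /ep. case: (Rle_lt_dec 0 beta) => h.
    - exists 1. split; first by left. rewrite Rabs_pos_eq //; ring.
    - exists (-1). split; first by right. rewrite Rabs_left //; ring. }
  have hcos : cos (2 * beta) = sin (2 * ep).
  { have -> : sin (2 * ep) = cos (PI / 2 - 2 * ep) by rewrite cos_shift.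
    case: hsg hbs => -> ->; first by f_equal; field.
    rewrite -cos_neg. f_equal. field. }
  have hsin : sin (2 * beta) = sg * cos (2 * ep).
  { have -> : cos (2 * ep) = sin (PI / 2 - 2 * ep) by rewrite sin_shift.
    case: hsg hbs => -> ->; first by rewrite !Rmult_1_l; f_equal; field.
    have -> : 2 * (-1 * (PI / 4 - ep)) = - (PI / 2 - 2 * ep) by field. rewrite sin_neg. ring. }
  have hs2 : 0 < sin (2 * ep) by apply sin_gt_0; lra.
  have hsle : sin (2 * ep) <= 2 * ep by left; apply sin_lt_x; lra.
  set h := sqrt (sin (2 * ep)). have hh0 : 0 < h by apply sqrt_lt_R0.
  have hh2 : h ^ 2 = sin (2 * ep) by rewrite /h pow2_sqrt; lra.
  have hwb : Re (ray beta 0) = sin (2 * ep) by rewrite Re_ray Rmult_0_r exp_0 hcos; ring.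
  (* The step 2 h must not exceed 1. If h > 1/2, then ep > 1/8 and |Theta| <= 8, so the summand 9 *
     8^p of the constant is enough. *)
  case: (Rle_lt_dec h (/ 2)) => hh; last first.
  { have hs4 : / 4 < sin (2 * ep) by rewrite -hh2; nra.
    have tb := Theta_bound 1 (ray beta 0) (Nat.le_refl 1) ltac:(rewrite hwb; lra).
    rewrite hwb /= !Rmult_1_r in tb.
    have : / sin (2 * ep) <= 4 by rewrite -(Rinv_inv 4); apply Rinv_le_contravar; lra.
    move=> hi.
    apply Rle_trans with 9.
    { apply Rle_trans with (1 := Cmod_triangle _ _). rewrite Cmod_R Rabs_pos_eq; last lra.
      rewrite /Rdiv in tb. lra. }
    have h8 : 1 <= 8 ^ p * ep ^ p.
    { rewrite -Rpow_mult_distr. apply pow_R1_Rle. lra. }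
    nra. }
  (* Relative to the cusp i sg the point is sin (2 ep) + i sg (cos (2 ep) - 1) = h^2 (1 + i tau),
     and |tau| = tan ep <= 1. *)
  set tau := sg * ((cos (2 * ep) - 1) / sin (2 * ep)).
  have htau : Rabs tau <= 1.
  { have hx : Rabs ((cos (2 * ep) - 1) / sin (2 * ep)) <= 1.
    { have s1 : 0 <= sin ep by apply sin_ge_0; lra.
      have s2 : sin ep <= cos ep.
      { rewrite -(cos_shift ep). apply cos_decr_1; lra. }
      have e1 : cos (2 * ep) - 1 = - (2 * (sin ep * sin ep)) by rewrite cos_2a_sin; ring.
      have e2 : sin (2 * ep) = 2 * sin ep * cos ep by apply sin_2a.
      apply Rabs_le. 
      have e3 : (cos (2 * ep) - 1) / sin (2 * ep) * sin (2 * ep) = - (2 * (sin ep * sin ep)) by rewrite -e1; field; lra.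
      split; apply (Rmult_le_reg_r (sin (2 * ep))) => //; rewrite e3; nra. }
    have hsa : Rabs sg = 1 by case: hsg => ->; [exact: Rabs_R1 | rewrite Rabs_left; lra].
    rewrite /tau Rabs_mult hsa. lra. }
  set d : C := (h ^ 2, h ^ 2 * tau)%R.
  have Ew : ray beta 0 = (d + Ci * RtoC sg)%C.
  { rewrite (surjective_pairing (ray beta 0)) -/(Re (ray beta 0)) -/(Im (ray beta 0)) hwb Im_ray Rmult_0_r exp_0 hsin.
    rewrite /d hh2 /Cplus /Cmult /RtoC /=. f_equal; first ring. rewrite /tau. field. lra. }
  have hd : 0 < Re d by rewrite /d /Re /= ; nra.
  have H1 := HK tau h htau ltac:(lra).
  have H2 := HK tau (2 * h) htau ltac:(lra).
  have E4 : (((2 * h) ^ 2)%R, ((2 * h) ^ 2 * tau)%R) = (RtoC 4 * d)%C.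
  { rewrite /d /Cmult /RtoC /=. f_equal; ring. }
  rewrite E4 in H2. rewrite -/d in H1.
  rewrite Ew Theta_alt //.
  set T4 := Theta _ in H2 *. set T1 := Theta d in H1 *.
  have -> : (2 * T4 - T1 + RtoC (/ 2) = RtoC (/ (2 * h)) * ((RtoC (2 * h) * (1 + 2 * T4) - 2 * gauss_half_int tau) - (RtoC h * (1 + 2 * T1) - 2 * gauss_half_int tau)))%C.
  { have nz3 : 2 * h <> 0 by lra. have nz4 : 2 <> 0 by lra.
    rewrite (RtoC_inv 2) // (RtoC_inv (2 * _)) // !RtoC_mult. field. move=> /RtoC_inj; lra. }
  rewrite Cmod_mult Cmod_R Rabs_pos_eq; last by apply Rlt_le, Rinv_0_lt_compat; lra.
  have tri := Cmod_triangle' (RtoC (2 * h) * (1 + 2 * T4) - 2 * gauss_half_int tau)%C (RtoC h * (1 + 2 * T1) - 2 * gauss_half_int tau)%C.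
  apply Rle_trans with (/ (2 * h) * (K * (2 * h) ^ S (2 * p) + K * h ^ S (2 * p))).
  { apply Rmult_le_compat_l; first by apply Rlt_le, Rinv_0_lt_compat; lra. lra. }
  have -> : / (2 * h) * (K * (2 * h) ^ S (2 * p) + K * h ^ S (2 * p)) = K * (1 + 2 ^ S (2 * p)) / 2 * (h ^ 2) ^ p.
  { rewrite Rpow_mult_distr -pow_mult. have -> : h ^ S (2 * p) = h * h ^ (2 * p) by []. field. lra. }
  rewrite hh2.
  have : sin (2 * ep) ^ p <= 2 ^ p * ep ^ p by rewrite -Rpow_mult_distr; apply pow_incr; lra.
  move=> hs. have hsp : 0 < sin (2 * ep) ^ p by apply pow_lt.
  have : 0 <= K * (1 + 2 ^ S (2 * p)) by apply Rmult_le_pos; lra.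
  move=> hKK.
  apply Rle_trans with (K * (1 + 2 ^ S (2 * p)) * (2 ^ p * ep ^ p)); last nra.
  apply Rle_trans with (K * (1 + 2 ^ S (2 * p)) * sin (2 * ep) ^ p); first nra.
  apply Rmult_le_compat_l => //.
Qed.

(** * Analytic continuation by exponential multipliers *)

Section Lists.
Variable sg : R.

(* A list of pairs (c, beta) encodes a sum of [c exp (- i beta (s - sg))]. On the line
   [Re s = sg] it is the real function [t |-> sum of c exp (beta t)]; multiplying [F] by it
   amounts to rotating the theta kernel by the angles beta. *)
Fixpoint multiplier (l : list (R * R)) (s : C) : C :=
  match l with
  | nil => RtoC 0
  | p :: l' => (RtoC (fst p) * Cexp (- (Ci * RtoC (snd p) * (s - RtoC sg))) + multiplier l' s)%C
  end.

Fixpoint mkernel (l : list (R * R)) (v : R) : C :=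
  match l with
  | nil => RtoC 0
  | p :: l' => (RtoC (fst p) * Cexp (Ci * RtoC (snd p) * RtoC sg) * Theta (ray (snd p) v) + mkernel l' v)%C
  end.

Definition small_angles (l : list (R * R)) : Prop := forall p, In p l -> Rabs (snd p) < PI / 4.

Lemma small_angles_cons p l : small_angles (p :: l) -> Rabs (snd p) < PI / 4 /\ small_angles l.
Proof. move=> H; split; [by apply H; left | move=> q hq; apply H; by right]. Qed.

Lemma cont_mkernel l : small_angles l -> cont (mkernel l).
Proof.
  elim: l => [|p l IH] /=; first by move=> _; exact: cont_const.
  move=> /small_angles_cons [h1 h2]. apply cont_plus; last exact: IH.
  apply cont_mult; [exact: cont_const | exact: cont_Theta].
Qed.

Lemma superdecay_0 : superdecay (fun _ => RtoC 0).
Proof. move=> M. exists 0; split; first lra. move=> v _. rewrite Cmod_0. lra. Qed.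

Lemma superdecay_plus f g : superdecay f -> superdecay g -> superdecay (fun v => f v + g v)%C.
Proof.
  move=> Hf Hg M. have [K1 [p1 h1]] := Hf M. have [K2 [p2 h2]] := Hg M.
  exists (K1 + K2); split; first lra. move=> v hv. apply Rle_trans with (1 := Cmod_triangle _ _).
  have := h1 v hv. have := h2 v hv. lra.
Qed.

Lemma superdecay_scal c f : superdecay f -> superdecay (fun v => c * f v)%C.
Proof.
  move=> Hf M. have [K1 [p1 h1]] := Hf M. have hc := Cmod_ge_0 c.
  exists (Cmod c * K1); split; first by apply Rmult_le_pos. move=> v hv. rewrite Cmod_mult Rmult_assoc.
  apply Rmult_le_compat_l => //. exact: h1.
Qed.

Lemma superdecay_ext f g : (forall v, f v = g v) -> superdecay f -> superdecay g.
Proof. move=> E Hf M. have [K [p h]] := Hf M. exists K; split => // v hv. rewrite -E. exact: h. Qed.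

Lemma superdecay_mkernel l : small_angles l -> superdecay (mkernel l).
Proof.
  elim: l => [|p l IH] /=; first by move=> _; exact: superdecay_0.
  move=> /small_angles_cons [h1 h2]. apply superdecay_plus; last exact: IH.
  apply superdecay_scal. exact: Theta_superdecay.
Qed.

(** The terms - 1/2 of the single thetas are weighted by c exp (i beta sg), which are exactly the
    summands of the multiplier at s = 0. *)
Lemma mkernel_at_minus_infinity l : small_angles l -> exists I : C,
  superdecay (fun v => mkernel l (- v) - (I * RtoC (exp v) - RtoC (/ 2) * multiplier l 0))%C.
Proof.
  elim: l => [|p l IH] /=.
  - move=> _. exists (RtoC 0). apply: superdecay_ext superdecay_0 => v. ring.
  - move=> /small_angles_cons [h1 h2]. have [I HI] := IH h2. have [I' HI'] := Theta_at_minus_infinity _ h1.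
    set c := (RtoC (fst p) * Cexp (Ci * RtoC (snd p) * RtoC sg))%C.
    exists (c * I' + I)%C.
    have := superdecay_plus _ _ (superdecay_scal c _ HI') HI. apply superdecay_ext => v.
    have -> : (- (Ci * RtoC (snd p) * (0 - RtoC sg)) = Ci * RtoC (snd p) * RtoC sg)%C by ring.
    rewrite -/c. ring.
Qed.

Lemma cder_multiplier l s : exists d, cder (multiplier l) s d.
Proof.
  elim: l => [|p l [d IH]] /=; first by eexists; apply cder_const.
  eexists. apply: cder_plus; last exact: IH. apply: cder_scal.
  apply: (cder_comp Cexp); last exact: cder_Cexp.
  apply: (cder_ext (fun z => - (Ci * RtoC (snd p)) * z + (Ci * RtoC (snd p) * RtoC sg))%C); first by move=> z; ring.
  apply: cder_plus; [apply: cder_scal; apply cder_id | apply cder_const].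
Qed.

(** A two-sided Mellin integral folded at v = 0. The part [k2] for negative v is independent of
    [k1], so that its term of order exp v can be subtracted separately. *)
Definition mellin_integrand (k1 k2 : R -> C) (s : C) (v : R) : C := (k1 v * Cexp (s * RtoC v) + k2 v * Cexp (- s * RtoC v))%C.

Lemma mkernel_mellin zeta Gamma F s l : is_zeta zeta -> is_Gamma Gamma -> is_completed_zeta zeta Gamma F ->
  3 <= Re s -> small_angles l ->
  is_half_int (mellin_integrand (mkernel l) (fun v => mkernel l (- v)) s) (RtoC (/ 2) * F s * multiplier l s)%C.
Proof.
  move=> Hz HG HF hs. elim: l => [|p l IH] /=.
  - move=> _. rewrite /mellin_integrand /=. apply: (half_int_ext (fun _ => RtoC 0)); first by move=> v _; ring.
    move=> eps he. exists 0; split; first lra. move=> b _. rewrite cint_const.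
    have -> : (0 * (b - 0)%R - RtoC (/ 2) * F s * 0 = 0)%C by ring. by rewrite Cmod_0.
  - move=> /small_angles_cons [h1 h2]. have H := IH h2. have H1 := completed_zeta_mellin zeta Gamma F s _ Hz HG HF hs h1.
    set c := (RtoC (fst p) * Cexp (Ci * RtoC (snd p) * RtoC sg))%C.
    have H2 := half_int_scal c _ _ (cont_zeta_integrand s _ h1) H1.
    have c1 : cont (fun v => c * zeta_integrand s (snd p) v)%C by apply cont_mult; [exact: cont_const | exact: cont_zeta_integrand].
    have c2 : cont (mellin_integrand (mkernel l) (fun v => mkernel l (- v)) s).
    { have hk := cont_mkernel l h2. apply cont_plus; (apply cont_mult; [|exact: cont_Cexp_scal]) => //. exact: (cont_neg _ hk). }
    have H3 := half_int_plus _ _ _ _ c1 c2 H2 H.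
    have -> : (RtoC (/ 2) * F s * (RtoC (fst p) * Cexp (- (Ci * RtoC (snd p) * (s - RtoC sg))) + multiplier l s) =
       c * (RtoC (/ 2) * F s * Cexp (- (Ci * RtoC (snd p) * s))) + RtoC (/ 2) * F s * multiplier l s)%C.
    { have -> : (- (Ci * RtoC (snd p) * (s - RtoC sg)) = Ci * RtoC (snd p) * RtoC sg + - (Ci * RtoC (snd p) * s))%C by ring.
      rewrite Cexp_plus /c. ring. }
    apply: half_int_ext H3 => v _. rewrite /mellin_integrand /zeta_integrand /c.
    have -> : (s * RtoC (- v) = - s * RtoC v)%C by rewrite RtoC_opp; ring.
    ring.
Qed.

(** Used with z = s - 1 for the transform of the term of order exp v at minus infinity; the
    prefactor z avoids a quotient. *)
Lemma half_int_exp z : 1 <= Re z -> is_half_int (fun v => z * Cexp (- z * RtoC v))%C (RtoC 1).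
Proof.
  move=> hz eps he. have [R0 [p0 h0]] := exp_neg_small 1 eps ltac:(lra) he.
  exists R0; split => // b hb.
  have -> : cint (fun v => z * Cexp (- z * RtoC v))%C 0 b = (- Cexp (- z * RtoC b) - - Cexp (- z * RtoC 0))%C.
  { apply (cint_derive (fun v => - Cexp (- z * RtoC v))%C).
    - move=> x _.
      have hd : cder (fun u => - (1) * Cexp u)%C (RtoC 0 + - z * RtoC x)%C (- (1) * Cexp (RtoC 0 + - z * RtoC x))%C by apply cder_scal, cder_Cexp.
      have d1 := cder_line_re _ _ _ _ _ hd. have d2 := cder_line_im _ _ _ _ _ hd.
      have e : (- (1) * Cexp (RtoC 0 + - z * RtoC x) * - z = z * Cexp (- z * RtoC x))%C by rewrite Cplus_0_l; ring.
      rewrite e in d1, d2.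
      have e2 t : (- (1) * Cexp (RtoC 0 + - z * RtoC t) = - Cexp (- z * RtoC t))%C by rewrite Cplus_0_l; ring.
      split; [move: d1|move: d2]; apply is_derive_ext => t; by rewrite e2.
    - apply cont_on, cont_mult; [exact: cont_const | exact: cont_Cexp_scal]. }
  rewrite Cmult_0_r Cexp_0.
  have -> : (- Cexp (- z * RtoC b) - - (1) - 1 = - Cexp (- z * RtoC b))%C by ring.
  rewrite Cmod_opp Cmod_Cexp_scal.
  have := h0 b hb. rewrite Rmult_1_l. apply Rle_lt_trans. apply exp_le_mono.
  have -> : Re (- z)%C = - Re z by []. nra.
Qed.

Definition half_int (f : R -> C) : C := epsilon (inhabits (RtoC 0)) (is_half_int f).

Lemma superdecay_half_int k s : cont k -> superdecay k -> is_half_int (fun v => k v * Cexp (s * RtoC v))%C (half_int (fun v => k v * Cexp (s * RtoC v))%C).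
Proof.
  move=> hc hd. apply (epsilon_spec (inhabits (RtoC 0)) (is_half_int (fun v => k v * Cexp (s * RtoC v))%C)).
  have [K [hK HK]] := hd (Re s + 1). apply (half_int_ex _ K) => //.
  - apply cont_mult => //. exact: cont_Cexp_scal.
  - move=> v hv. rewrite Cmod_mult Cmod_Cexp_scal.
    have -> : exp (- v) = exp (- ((Re s + 1) * v)) * exp (Re s * v) by rewrite -exp_plus; f_equal; ring.
    rewrite -Rmult_assoc. apply Rmult_le_compat_r; [by apply Rlt_le, exp_pos | exact: HK].
Qed.

Lemma residue_eps (F : C -> C) p r : simple_pole_with_residue F p r -> forall eps, 0 < eps -> exists del, 0 < del /\
  forall s, s <> p -> Cmod (s - p)%C < del -> Cmod ((s - p) * F s - r)%C < eps.
Proof.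
  move=> H eps he.
  have [d Hd] := H _ (locally_Cmod r eps he). exists d; split; first exact: cond_pos.
  move=> s hs hsd. apply Hd => //. apply C_NormedModule_mixin_compat1. exact: hsd.
Qed.

Lemma cder_opp_arg Z s d : cder Z (- s)%C d -> cder (fun z => Z (- z)%C) s (d * - (1))%C.
Proof.
  move=> H. apply: (cder_comp Z (fun z => - z)%C); last exact: H.
  apply: (cder_ext (fun z => - (1) * z)%C); first by move=> z; ring.
  have := cder_scal (- (1))%C _ _ _ (cder_id s). by rewrite Cmult_1_r.
Qed.

(* The zero of the multiplier at 0 removes the constant term of the kernel at minus infinity.
   The coefficient [I] of the other term is the residue at 1 of [F] times the multiplier,
   hence 0; its value is never computed. *)
Theorem multiplier_continuation zeta Gamma F l : is_zeta zeta -> is_Gamma Gamma -> is_completed_zeta zeta Gamma F ->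
  small_angles l -> multiplier l 0 = RtoC 0 -> multiplier l 1 = RtoC 0 ->
  superdecay (fun v => mkernel l (- v)) /\ exists X : C -> C,
    (forall s, exists d, cder X s d) /\
    (forall s, is_half_int (mellin_integrand (mkernel l) (fun v => mkernel l (- v)) s) (X s)) /\
    (forall s, Im s <> 0 -> (F s * multiplier l s = RtoC 2 * X s)%C).
Proof.
  move=> Hz HG HF Hl W0 W1.
  have ck := cont_mkernel l Hl. have ck' : cont (fun v => mkernel l (- v)) by exact: (cont_neg _ ck).
  have dk := superdecay_mkernel l Hl.
  have [I HI] := mkernel_at_minus_infinity l Hl.
  (* The zero of the multiplier at 0 has removed the constant term, so [ka] decays faster than every
     exponential and its transform is entire. *)
  pose ka v := (mkernel l (- v)%R - I * RtoC (exp v))%C.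
  have dka : superdecay ka by apply: superdecay_ext HI => v; rewrite W0 /ka; ring.
  have cexp : cont (fun v => RtoC (exp v)).
  { apply cont_RtoC => x. apply: ex_derive_continuous. auto_derive => //. }
  have cka : cont ka.
  { move=> x. have : cont (fun v => mkernel l (- v)%R + - I * RtoC (exp v))%C by apply cont_plus => //; apply cont_mult => //; exact: cont_const.
    move=> H. apply: ccont_ext (H x) => t. rewrite /ka. ring. }
  pose Z1 s := half_int (fun v => mkernel l v * Cexp (s * RtoC v))%C.
  pose Z2 s := half_int (fun v => ka v * Cexp (s * RtoC v))%C.
  have HZ1 s : is_half_int (fun v => mkernel l v * Cexp (s * RtoC v))%C (Z1 s) by exact: superdecay_half_int.
  have HZ2 s : is_half_int (fun v => ka v * Cexp (s * RtoC v))%C (Z2 s) by exact: superdecay_half_int.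
  have D1 := half_int_cder _ _ ck dk HZ1. have D2 := half_int_cder _ _ cka dka HZ2.
  pose X s := (Z1 s + Z2 (- s))%C.
  have DX s : exists d, cder X s d.
  { have [d1 h1] := D1 s. have [d2 h2] := D2 (- s)%C. eexists. apply: cder_plus; [exact: h1 | exact: (cder_opp_arg _ _ _ h2)]. }
  have HX s : is_half_int (mellin_integrand (mkernel l) ka s) (X s).
  { apply: half_int_plus; [| | exact: HZ1 | exact: HZ2]; apply cont_mult => //; exact: cont_Cexp_scal. }
  have cJ k1 k2 s : cont k1 -> cont k2 -> cont (mellin_integrand k1 k2 s).
  { move=> h1 h2. apply cont_plus; apply cont_mult => //; exact: cont_Cexp_scal. }
  (* The subtracted term I exp v has the transform I / (s - 1); cleared of its denominator, the
     identity to be continued reads D = 0. *)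
  pose D s := ((s - 1) * (RtoC (/ 2) * F s * multiplier l s - X s) - I)%C.
  have D3 s : 3 <= Re s -> D s = RtoC 0.
  { move=> hs. have H := mkernel_mellin zeta Gamma F s l Hz HG HF hs Hl.
    have h1 : 1 <= Re (s - 1)%C. { have -> : Re (s - 1)%C = Re s - 1 by []. lra. }
    have H2 := half_int_exp (s - 1)%C h1.
    have cE : cont (fun v => (s - 1) * Cexp (- (s - 1) * RtoC v))%C by apply cont_mult; [exact: cont_const | exact: cont_Cexp_scal].
    have cA : cont (fun v => (s - 1) * mellin_integrand (mkernel l) ka s v)%C by apply cont_mult; [exact: cont_const | exact: cJ].
    have cB : cont (fun v => I * ((s - 1) * Cexp (- (s - 1) * RtoC v)))%C by apply cont_mult; [exact: cont_const | exact: cE].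
    have H3 := half_int_plus _ _ _ _ cA cB (half_int_scal (s - 1)%C _ _ (cJ _ _ s ck cka) (HX s)) (half_int_scal I _ _ cE H2).
    have H4 := half_int_scal (s - 1)%C _ _ (cJ _ _ s ck ck') H.
    suff E : ((s - 1) * (RtoC (/ 2) * F s * multiplier l s) = (s - 1) * X s + I * 1)%C by rewrite /D; transitivity ((s - 1) * (RtoC (/ 2) * F s * multiplier l s) - ((s - 1) * X s + I * 1))%C; [ring | rewrite E; ring].
    apply: half_int_unique H4 _. apply: half_int_ext H3 => v _. rewrite /mellin_integrand /ka.
    have -> : Cexp (- (s - 1) * RtoC v)%C = (RtoC (exp v) * Cexp (- s * RtoC v))%C.
    { rewrite -Cexp_R -Cexp_plus. f_equal. ring. }
    ring. }
  have DD s : s <> RtoC 0 -> s <> RtoC 1 -> exists d, cder D s d.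
  { move=> h0 h1. have [d1 e1] := ex_derive_cder F s (proj1 (proj2 HF) s ltac:(by case)).
    have [d2 e2] := cder_multiplier l s. have [d3 e3] := DX s.
    eexists.
    apply: (cder_ext (fun s => (s + - (1)) * ((RtoC (/ 2) * F s) * multiplier l s + (- (1)) * X s) + - I)%C); first by move=> z; rewrite /D; ring.
    apply: cder_plus; last by apply cder_const.
    apply: cder_mult; first by apply: cder_plus; [apply cder_id | apply cder_const].
    apply: cder_plus; last by apply: cder_scal; exact: e3.
    apply: cder_mult; last exact: e2. apply: cder_scal. exact: e1. }
  (* The rectangle has height |y| around s, hence misses the real axis with the two poles, and it
     reaches beyond Re s = 3, where D vanishes. *)
  have D0 s : Im s <> 0 -> D s = RtoC 0.
  { case: s => x y hy. rewrite /Im /= in hy.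
    have hay : 0 < Rabs y by apply Rabs_pos_lt.
    apply: (identity_rect D (Rmin x 3 - 1) (Rmax x 3 + 1) (y - Rabs y / 2) (y + Rabs y / 2) 3).
    - have := Rmin_r x 3. lra.
    - have := Rmax_r x 3. lra.
    - lra.
    - move=> u v _ hv.
      have hv0 : v <> 0 by move: hv; rewrite /Rabs; case: Rcase_abs => ? ? ?; lra.
      apply DD => h; apply hv0; have : Im ((u, v) : C) = 0 by rewrite h.
      + done.
      + done.
    - move=> u v hu _. apply D3. rewrite /Re /=. lra.
    - have := Rmin_l x 3. have := Rmax_l x 3. lra.
    - lra. }
  (* Let s = 1 + i t with t tending to 0 in D s = 0: (s - 1) F s stays bounded by 2, the multiplier
     tends to 0, and (s - 1) X s tends to 0. *)
  have I0 : I = RtoC 0.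
  { apply Ceq_eps => e he. have -> : (I - 0 = I)%C by ring.
    have [d1 e1] := cder_multiplier l 1. have [d3 e3] := DX 1.
    set e' := Rmin 1 (e / 4).
    have he' : 0 < e' by apply Rmin_pos; lra.
    have he1 : e' <= 1 by apply Rmin_l. have he2 : e' <= e / 4 by apply Rmin_r.
    have [r1 [p1 h1]] := residue_eps F 1 1 (proj2 (proj2 (proj2 HF))) 1 ltac:(lra).
    have [r2 [p2 h2]] := cder_cont _ _ _ e1 e' he'.
    have [r3 [p3 h3]] := cder_cont _ _ _ e3 1 ltac:(lra).
    have hX1 := Cmod_ge_0 (X 1).
    have q4 : 0 < e / 4 / (Cmod (X 1) + 1) by apply Rdiv_lt_0_compat; lra.
    set t := Rmin (Rmin r1 r2) (Rmin r3 (e / 4 / (Cmod (X 1) + 1))) / 2.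
    have ht : 0 < t by rewrite /t; have : 0 < Rmin (Rmin r1 r2) (Rmin r3 (e / 4 / (Cmod (X 1) + 1))); [repeat apply Rmin_pos => // | lra].
    have tt : t < Rmin (Rmin r1 r2) (Rmin r3 (e / 4 / (Cmod (X 1) + 1))) by rewrite /t in ht *; lra.
    have t12 := Rlt_le_trans _ _ _ tt (Rmin_l _ _). have t34 := Rlt_le_trans _ _ _ tt (Rmin_r _ _).
    have t1 := Rlt_le_trans _ _ _ t12 (Rmin_l _ _). have t2 := Rlt_le_trans _ _ _ t12 (Rmin_r _ _).
    have t3 := Rlt_le_trans _ _ _ t34 (Rmin_l _ _). have t4 := Rlt_le_trans _ _ _ t34 (Rmin_r _ _).
    pose h : C := (Ci * RtoC t)%C.
    have mh : Cmod h = t by rewrite /h Cmod_mult Cmod_Ci Cmod_R Rabs_pos_eq; lra.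
    have hs : Im (1 + h)%C <> 0. { rewrite /h /Im /= . lra. }
    have := D0 _ hs. rewrite /D.
    have -> : (1 + h - 1 = h)%C by ring.
    move=> E.
    have EI : I = (h * F (1 + h)%C * multiplier l (1 + h)%C * RtoC (/ 2) - h * X (1 + h)%C)%C.
    { have -> : I = ((h * (RtoC (/ 2) * F (1 + h)%C * multiplier l (1 + h)%C - X (1 + h)%C)) - (h * (RtoC (/ 2) * F (1 + h)%C * multiplier l (1 + h)%C - X (1 + h)%C) - I))%C by ring.
      rewrite E. ring. }
    rewrite EI.
    have k1 := h1 (1 + h)%C ltac:(move=> hh; apply hs; by rewrite hh) ltac:(by have -> : (1 + h - 1 = h)%C; [ring | rewrite mh]).
    have e0 : (1 + h - 1 = h)%C by ring. rewrite e0 in k1.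
    have k2 := h2 h ltac:(by rewrite mh). rewrite W1 in k2. have e9 : (multiplier l (1 + h) - 0 = multiplier l (1 + h))%C by ring. rewrite e9 in k2.
    have k3 := h3 h ltac:(by rewrite mh).
    have m1 : Cmod (h * F (1 + h)%C)%C <= 2.
    { have -> : (h * F (1 + h) = (h * F (1 + h) - 1) + 1)%C by ring.
      apply Rle_trans with (1 := Cmod_triangle _ _). rewrite Cmod_1. lra. }
    have m3 : Cmod (X (1 + h)%C) <= Cmod (X 1) + 1.
    { have -> : (X (1 + h) = (X (1 + h) - X 1) + X 1)%C by ring.
      apply Rle_trans with (1 := Cmod_triangle _ _). lra. }
    apply Rle_trans with (1 := Cmod_triangle' _ _).
    rewrite (Cmod_mult h (X _)) mh Cmod_mult (Cmod_mult (h * F _)%C) Cmod_R Rabs_pos_eq; last lra.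
    have z1 : t * Cmod (X (1 + h)%C) <= e / 4.
    { apply Rle_trans with (e / 4 / (Cmod (X 1) + 1) * (Cmod (X 1) + 1)); last by apply Req_le; field; lra.
      apply Rmult_le_compat; try lra. apply Cmod_ge_0. }
    have z2 : Cmod (h * F (1 + h)%C)%C * Cmod (multiplier l (1 + h)%C) <= 2 * e'.
    { apply Rmult_le_compat; try apply Cmod_ge_0; lra. }
    lra. }
  have Eka v : ka v = mkernel l (- v) by rewrite /ka I0; ring.
  have Fka : ka = (fun v => mkernel l (- v)) by apply functional_extensionality.
  split; first by apply: superdecay_ext dka.
  exists X. split => //. split; first by move=> s; rewrite -Fka.
  move=> s hs. have := D0 s hs. rewrite /D I0 => E.
  have hs1 : (s - 1 <> 0)%C.
  { move=> h. apply hs. have -> : s = (s - 1 + 1)%C by ring. rewrite h /Im /=. ring. }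
  have E2 : ((s - 1) * (RtoC (/ 2) * F s * multiplier l s - X s) = 0)%C by rewrite -E; ring.
  have E3 : (RtoC (/ 2) * F s * multiplier l s - X s = 0)%C.
  { have -> : (RtoC (/ 2) * F s * multiplier l s - X s = / (s - 1) * ((s - 1) * (RtoC (/ 2) * F s * multiplier l s - X s)))%C by field.
    rewrite E2. ring. }
  have -> : X s = (RtoC (/ 2) * F s * multiplier l s)%C by apply Ceq_of_minus; transitivity (- (RtoC (/ 2) * F s * multiplier l s - X s))%C; [ring | rewrite E3; ring].
  rewrite RtoC_inv; last lra. field.
Qed.
End Lists.

(** * Fejer's kernel *)

Lemma cos_lipschitz a b : Rabs (cos a - cos b) <= Rabs (a - b).
Proof.
  case: (Rle_lt_dec b a) => h.
  - have := mvt_bound cos (fun t => - sin t) b a 1 h ltac:(move=> t _; auto_derive => //; ring)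
      ltac:(move=> t _; rewrite Rabs_Ropp; exact: Rabs_sin_le).
    rewrite (Rabs_pos_eq (a - b)); lra.
  - have := mvt_bound cos (fun t => - sin t) a b 1 ltac:(lra) ltac:(move=> t _; auto_derive => //; ring)
      ltac:(move=> t _; rewrite Rabs_Ropp; exact: Rabs_sin_le).
    rewrite Rabs_minus_sym (Rabs_minus_sym a b) (Rabs_pos_eq (b - a)); lra.
Qed.

Lemma eps_continuous (F : R -> R) x : (forall eps, 0 < eps -> exists del, 0 < del /\ forall t, Rabs (t - x) < del -> Rabs (F t - F x) < eps) -> continuous F x.
Proof.
  move=> H. apply continuity_pt_filterlim => eps he. have [d [hd Hd]] := H eps he.
  exists d; split => // t [_ ht]. exact: Hd.
Qed.

Lemma lipschitz_continuous (F : R -> R) L x : 0 <= L -> (forall t, Rabs (F t - F x) <= L * Rabs (t - x)) -> continuous F x.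
Proof.
  move=> hL H. apply eps_continuous => eps he. exists (eps / (L + 1)); split; first by apply Rdiv_lt_0_compat; lra.
  move=> t ht. apply Rle_lt_trans with (1 := H t).
  have -> : eps = (L + 1) * (eps / (L + 1)) by field; lra.
  have := Rabs_pos (t - x). have : 0 < eps / (L + 1) by apply Rdiv_lt_0_compat; lra. nra.
Qed.

Lemma cos_transform_continuous (w : R -> R) B b u : (forall x, continuous w x) -> (forall x, Rabs (w x) <= B) ->
  continuous (fun u => RInt (fun x => w x * cos (x * u)) 0 b) u.
Proof.
  move=> hw hB.
  have hB0 : 0 <= B by apply Rle_trans with (2 := hB 0); apply Rabs_pos.
  have ci r x : continuous (fun x => w x * cos (x * r)) x.
  { apply: continuous_mult; first exact: hw. apply: ex_derive_continuous. auto_derive => //. }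
  have ei r p q : ex_RInt (fun x => w x * cos (x * r)) p q by apply: ex_RInt_continuous => z _; apply ci.
  apply (lipschitz_continuous _ (B * Rabs b * Rabs b)).
  { apply Rmult_le_pos; last exact: Rabs_pos. apply Rmult_le_pos => //. exact: Rabs_pos. }
  move=> t.
  have -> : RInt (fun x => w x * cos (x * t)) 0 b - RInt (fun x => w x * cos (x * u)) 0 b =
    RInt (fun x => w x * cos (x * t) - w x * cos (x * u)) 0 b.
  { by rewrite (RInt_minus (fun x => w x * cos (x * t)) (fun x => w x * cos (x * u))). }
  have H p q : p <= q -> Rabs p <= Rabs b -> Rabs q <= Rabs b ->
    Rabs (RInt (fun x => w x * cos (x * t) - w x * cos (x * u)) p q) <= (q - p) * (B * (Rabs b * Rabs (t - u))).
  { move=> hpq hp hq. apply: abs_RInt_le_const => //.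
    - apply: ex_RInt_minus; exact: ei.
    - move=> x hx. have -> : w x * cos (x * t) - w x * cos (x * u) = w x * (cos (x * t) - cos (x * u)) by ring.
      rewrite Rabs_mult. apply Rmult_le_compat; try apply Rabs_pos; first exact: hB.
      apply Rle_trans with (1 := cos_lipschitz _ _). have -> : x * t - x * u = x * (t - u) by ring.
      rewrite Rabs_mult. apply Rmult_le_compat_r; first exact: Rabs_pos.
      apply Rabs_le. have := Rle_abs q. have := Rle_abs (- p). rewrite Rabs_Ropp. lra. }
  case: (Rle_lt_dec 0 b) => hb.
  - apply Rle_trans with (1 := H 0 b hb ltac:(rewrite Rabs_R0; apply Rabs_pos) (Rle_refl _)).
    rewrite (Rabs_pos_eq b) //. apply Req_le. ring.
  - rewrite -(opp_RInt_swap _ b 0); last by apply: ex_RInt_minus; exact: ei.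
    rewrite /opp /= Rabs_Ropp.
    apply Rle_trans with (1 := H b 0 ltac:(lra) (Rle_refl _) ltac:(rewrite Rabs_R0; apply Rabs_pos)).
    rewrite (Rabs_left b) //. apply Req_le. ring.
Qed.

Lemma fejer_weight_range T t : 0 < T -> 0 <= t <= T -> 0 <= 1 - t / T <= 1.
Proof.
  move=> hT ht. have : 0 <= t / T <= 1; last lra.
  split; first by apply Rmult_le_pos; [lra | apply Rlt_le, Rinv_0_lt_compat].
  apply (Rmult_le_reg_r T) => //. have -> : t / T * T = t by field; lra. lra.
Qed.

Definition fejer_kernel (T v : R) : R := RInt (fun t => (1 - t / T) * cos (t * v)) 0 T.

Lemma fejer_integrable T v a b : ex_RInt (fun t => (1 - t / T) * cos (t * v)) a b.
Proof. apply: ex_RInt_continuous => z _. apply: ex_derive_continuous. auto_derive => //. Qed.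

(** The kernel is (1 - cos (T v)) / (T v^2) for v <> 0 and at most T everywhere. The single majorant
    for both regimes has the primitive 4 atan (T v), hence total mass 2 pi on the half-line. *)
Lemma fejer_kernel_bound T v : 0 < T -> Rabs (fejer_kernel T v) <= 4 * T / (1 + T ^ 2 * v ^ 2).
Proof.
  move=> hT. have hv2 : 0 <= v ^ 2 by apply pow2_ge_0. have hT2 : 0 < T ^ 2 by apply pow_lt.
  set z := T ^ 2 * v ^ 2. have hz : 0 <= z by apply Rmult_le_pos; lra.
  have chi t := fejer_weight_range T t hT.
  case: (Rle_lt_dec z 1) => h.
  - apply Rle_trans with ((T - 0) * 1).
    + apply: abs_RInt_le_const; [lra | exact: fejer_integrable |].
      move=> t ht. rewrite Rabs_mult. have c := chi t ht. rewrite (Rabs_pos_eq (1 - t / T)); last lra.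
      have := Rabs_cos_le (t * v). have := Rabs_pos (cos (t * v)). nra.
    + apply (Rmult_le_reg_r (1 + z)); first lra.
      have -> : 4 * T / (1 + z) * (1 + z) = 4 * T by field; lra. nra.
  - have hv : v <> 0. { move=> hv. rewrite /z hv in h. simpl in h. lra. }
    have -> : fejer_kernel T v = (1 - cos (T * v)) / (T * v ^ 2).
    { apply is_RInt_unique.
      have -> : (1 - cos (T * v)) / (T * v ^ 2) =
         minus ((fun t => (1 - t / T) * sin (t * v) / v - cos (t * v) / (T * v ^ 2)) T)
               ((fun t => (1 - t / T) * sin (t * v) / v - cos (t * v) / (T * v ^ 2)) 0).
      { rewrite /minus /plus /opp /= !Rmult_0_l sin_0 cos_0. field. split; lra. }
      apply (is_RInt_derive (fun t => (1 - t / T) * sin (t * v) / v - cos (t * v) / (T * v ^ 2)) (fun t => (1 - t / T) * cos (t * v))) => t _.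
      - auto_derive; first done. field. split; lra.
      - apply: ex_derive_continuous. auto_derive => //. }
    have hTv : 0 < T * v ^ 2 by have : 0 < v ^ 2; [apply pow2_gt_0 | nra].
    have hc := COS_bound (T * v).
    rewrite Rabs_pos_eq; last by apply Rmult_le_pos; [lra | apply Rlt_le, Rinv_0_lt_compat].
    apply (Rmult_le_reg_r (T * v ^ 2)) => //.
    have -> : (1 - cos (T * v)) / (T * v ^ 2) * (T * v ^ 2) = 1 - cos (T * v) by field; split; lra.
    have -> : 4 * T / (1 + z) * (T * v ^ 2) = 4 * (z / (1 + z)) by rewrite {2}/z; field; lra.
    have : / 2 <= z / (1 + z).
    { apply (Rmult_le_reg_r (1 + z)); first lra. have -> : z / (1 + z) * (1 + z) = z by field; lra. lra. }
    lra.
Qed.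

Lemma fejer_kernel_continuous T v : 0 < T -> continuous (fejer_kernel T) v.
Proof.
  move=> hT. rewrite /fejer_kernel.
  (* The weight truncated outside the interval from 0 to T, because [cos_transform_continuous] asks
     for a globally bounded one. *)
  pose w t := Rmax (-1) (Rmin 1 (1 - t / T)).
  have E u : RInt (fun t => (1 - t / T) * cos (t * u)) 0 T = RInt (fun t => w t * cos (t * u)) 0 T.
  { apply RInt_ext => t. rewrite Rmin_left ?Rmax_right; try lra. move=> ht. f_equal.
    have : 0 < t / T < 1.
    { split; first by apply Rdiv_lt_0_compat; lra.
      apply (Rmult_lt_reg_r T) => //. have -> : t / T * T = t by field; lra. lra. }
    move=> h. rewrite /w Rmin_right ?Rmax_right; lra. }
  apply (continuous_ext (fun u => RInt (fun t => w t * cos (t * u)) 0 T)); first by move=> u; rewrite E.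
  apply (cos_transform_continuous w 1) => t.
  - apply (lipschitz_continuous w (/ T)); first by apply Rlt_le, Rinv_0_lt_compat.
    move=> s. apply Rle_trans with (Rabs ((1 - s / T) - (1 - t / T))).
    + rewrite /w. move: (1 - s / T) (1 - t / T) => p q. rewrite /Rmax /Rmin.
      destruct (Rle_dec 1 p); destruct (Rle_dec 1 q); repeat destruct (Rle_dec _ _);
      rewrite /Rabs; repeat destruct (Rcase_abs _); lra.
    + have -> : 1 - s / T - (1 - t / T) = / T * (- (s - t)) by field; lra.
      rewrite Rabs_mult Rabs_Ropp (Rabs_pos_eq (/ T)); first lra. by apply Rlt_le, Rinv_0_lt_compat.
  - rewrite /w. apply Rabs_le. split; first exact: Rmax_l. apply Rmax_lub; [lra | exact: Rmin_l].
Qed.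

Lemma continuity_2d_pt_prod (f g : R -> R) (x y : R) (h : R -> R -> R) : continuous f x -> continuous g y ->
  (forall u v, h u v = f u * g v * cos (v * u)) -> continuity_2d_pt h x y.
Proof.
  move=> hf hg E.
  apply (continuity_2d_pt_ext (fun u v => f u * g v * cos (v * u))); first by move=> u v; rewrite E.
  apply continuity_2d_pt_mult.
  - apply continuity_2d_pt_mult.
    + apply (continuity_1d_2d_pt_comp f (fun u v => u)); [by apply continuity_pt_filterlim | exact: continuity_2d_pt_id1].
    + apply (continuity_1d_2d_pt_comp g (fun u v => v)); [by apply continuity_pt_filterlim | exact: continuity_2d_pt_id2].
  - apply (continuity_1d_2d_pt_comp cos (fun u v => v * u)); first exact: continuity_cos.
    apply continuity_2d_pt_mult; [exact: continuity_2d_pt_id2 | exact: continuity_2d_pt_id1].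
Qed.

(** Exchange of integrals by differentiation in the upper limit b: both sides vanish at b = 0 and
    have the derivative [P b * fejer_kernel T b]. *)
Lemma fubini_fejer (P : R -> R) B T b : 0 < T -> 0 < b -> (forall x, continuous P x) -> (forall x, Rabs (P x) <= B) ->
  RInt (fun t => (1 - t / T) * RInt (fun v => P v * cos (v * t)) 0 b) 0 T = RInt (fun v => P v * fejer_kernel T v) 0 b.
Proof.
  move=> hT hb hP hB.
  pose G r t := (1 - t / T) * RInt (fun v => P v * cos (v * t)) 0 r.
  have ci u x : continuous (fun x => P x * cos (x * u)) x.
  { apply: continuous_mult; first exact: hP. apply: ex_derive_continuous. auto_derive => //. }
  have ei u p q : ex_RInt (fun x => P x * cos (x * u)) p q by apply: ex_RInt_continuous => z _; apply ci.
  have dG r t : is_derive (fun r => G r t) r (P r * (1 - t / T) * cos (t * r)).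
  { rewrite /G. have h : is_derive (fun r => RInt (fun v => P v * cos (v * t)) 0 r) r (P r * cos (r * t)).
    { apply: (is_derive_RInt (fun v => P v * cos (v * t)) (fun r => RInt (fun v => P v * cos (v * t)) 0 r) 0 r); last exact: ci.
      exact: (filter_forall _ (fun z => RInt_correct _ _ _ (ei t 0 z))). }
    have := is_derive_scal _ r (1 - t / T) _ h.
    by have -> : (1 - t / T) * (P r * cos (r * t)) = P r * (1 - t / T) * cos (t * r) by rewrite (Rmult_comm r t); ring. }
  have DG r t : Derive (fun r => G r t) r = P r * (1 - t / T) * cos (t * r) by apply is_derive_unique.
  have exG r : ex_RInt (fun t => G r t) 0 T.
  { apply: ex_RInt_continuous => z _. apply: continuous_mult.
    - apply: ex_derive_continuous. auto_derive => //.
    - exact: (cos_transform_continuous P B). }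
  have d1 r : is_derive (fun r => RInt (fun t => G r t) 0 T) r (P r * fejer_kernel T r).
  { have := is_derive_RInt_param G 0 T r.
    have -> : RInt (fun t => Derive (fun u => G u t) r) 0 T = P r * fejer_kernel T r.
    { transitivity (RInt (fun t => scal (P r) ((1 - t / T) * cos (t * r))) 0 T).
      - apply RInt_ext => t _. rewrite DG /scal /= /mult /=. ring.
      - rewrite RInt_scal //. exact: fejer_integrable. }
    apply.
    - apply filter_forall => x t _. eexists. exact: dG.
    - move=> t _. apply (continuity_2d_pt_prod P (fun t => 1 - t / T)) => //.
      + apply: ex_derive_continuous. auto_derive => //.
    - apply filter_forall => x. exact: exG. }
  have d2 r : is_derive (fun r => RInt (fun v => P v * fejer_kernel T v) 0 r) r (P r * fejer_kernel T r).
  { have c2 x : continuous (fun v => P v * fejer_kernel T v) x by apply: continuous_mult; [exact: hP | exact: fejer_kernel_continuous].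
    have e2 z : ex_RInt (fun v => P v * fejer_kernel T v) 0 z by apply: ex_RInt_continuous => u _; exact: c2.
    apply: (is_derive_RInt (fun v => P v * fejer_kernel T v) (fun r => RInt (fun v => P v * fejer_kernel T v) 0 r) 0 r); last exact: c2.
    exact: (filter_forall _ (fun z => RInt_correct _ _ _ (e2 z))). }
  have := eq_is_derive (fun r => minus (RInt (fun t => G r t) 0 T) (RInt (fun v => P v * fejer_kernel T v) 0 r)) 0 b.
  move=> H.
  have {}H := H ltac:(move=> r _; have := is_derive_minus _ _ r _ _ (d1 r) (d2 r); by rewrite minus_eq_zero) hb.
  rewrite RInt_point in H.
  have G0 : RInt (fun t => G 0 t) 0 T = 0.
  { transitivity (RInt (fun _ : R => 0) 0 T).
    - apply RInt_ext => t _. rewrite /G RInt_point /zero /=. ring.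
    - rewrite RInt_const /scal /= /mult /=. ring. }
  rewrite G0 /minus /plus /opp /zero /= in H. rewrite -/(G b). 
  change (RInt (fun t => G b t) 0 T = RInt (fun v => P v * fejer_kernel T v) 0 b). lra.
Qed.

Lemma is_RInt_fejer_majorant T A b : is_RInt (fun v => A * (4 * T / (1 + T ^ 2 * v ^ 2))) 0 b (A * (4 * atan (T * b))).
Proof.
  have -> : A * (4 * atan (T * b)) = minus ((fun v => A * (4 * atan (T * v))) b) ((fun v => A * (4 * atan (T * v))) 0).
  { rewrite /minus /plus /opp /= Rmult_0_r atan_0. ring. }
  have hp v : 1 + T ^ 2 * v ^ 2 <> 0.
  { have : 0 <= T ^ 2 * v ^ 2 by apply Rmult_le_pos; apply pow2_ge_0. lra. }
  apply (is_RInt_derive (fun v => A * (4 * atan (T * v))) (fun v => A * (4 * T / (1 + T ^ 2 * v ^ 2)))) => v _.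
  - auto_derive => //. field. have h := hp v. move=> hz; apply h; move: hz; simpl; lra.
  - apply: ex_derive_continuous. auto_derive. have h := hp v. move=> hz; apply h; move: hz; simpl; lra.
Qed.

(** The mean of the transform y is the integral of P against Fejer's kernel. For large T the kernel
    concentrates at 0, where P is nearly [P 0], with mass at most 2 pi; elsewhere it is O(1 / T). *)
Theorem fejer_bound (P y : R -> R) K : 0 <= K -> (forall x, continuous P x) -> (forall x, continuous y x) ->
  (forall v, Rabs (P v) <= K * exp (- Rabs v)) ->
  (forall t eps, 0 < eps -> exists R0, 0 <= R0 /\ forall b, R0 <= b -> Rabs (RInt (fun v => P v * cos (v * t)) 0 b - y t) < eps) ->
  forall eps, 0 < eps -> exists T0, 0 < T0 /\ forall T, T0 <= T ->
    Rabs (RInt (fun t => (1 - t / T) * y t) 0 T) <= 2 * PI * Rabs (P 0) + eps.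
Proof.
  move=> hK hP hy hb hlim eps he.
  have hpi := PI_RGT_0.
  have hB x : Rabs (P x) <= K.
  { apply Rle_trans with (1 := hb x). have : exp (- Rabs x) <= 1.
    { rewrite -exp_0. apply exp_le_mono. have := Rabs_pos x. lra. }
    nra. }
  have ci u x : continuous (fun x => P x * cos (x * u)) x.
  { apply: continuous_mult; first exact: hP. apply: ex_derive_continuous. auto_derive => //. }
  have ei u p q : ex_RInt (fun x => P x * cos (x * u)) p q by apply: ex_RInt_continuous => z _; apply ci.
  have tail t b : 0 <= b -> Rabs (RInt (fun v => P v * cos (v * t)) 0 b - y t) <= K * exp (- b).
  { move=> hb0. apply le_epsilon => e he'. have [R0 [p0 h0]] := hlim t e he'.
    have h1 := h0 (R0 + b) ltac:(lra).
    have h2 := RInt_exp_bound (fun v => P v * cos (v * t)) K b (R0 + b) hK ltac:(lra) (ei _ _ _).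
    have {}h2 : Rabs (RInt (fun v => P v * cos (v * t)) b (R0 + b)) <= K * exp (- b).
    { apply h2 => v hv. rewrite Rabs_mult. have := hb v. rewrite (Rabs_pos_eq v); last lra.
      have := Rabs_cos_le (v * t). have := Rabs_pos (P v). have := Rabs_pos (cos (v * t)). nra. }
    have ch := RInt_Chasles (fun v => P v * cos (v * t)) 0 b (R0 + b) (ei _ _ _) (ei _ _ _).
    rewrite /plus /= in ch.
    have -> : RInt (fun v => P v * cos (v * t)) 0 b - y t = (RInt (fun v => P v * cos (v * t)) 0 (R0 + b) - y t) - RInt (fun v => P v * cos (v * t)) b (R0 + b) by rewrite -ch; ring.
    apply Rle_trans with (1 := Rabs_triang _ _). rewrite Rabs_Ropp. lra. }
  (* Multiplied by the mass 2 pi of the majorant, this variation of P near 0 costs eps / 4. *)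
  set e1 := eps / (8 * PI). have he1 : 0 < e1 by apply Rdiv_lt_0_compat; lra.
  have [eta [heta Heta]] := continuous_eps P 0 (hP 0) e1 he1.
  have heta2 : 0 < eta ^ 2 by apply pow_lt.
  (* Beyond eta the kernel is at most 4 / (T eta^2), and this T makes the contribution 4 K / (T
     eta^2) at most eps / 4. *)
  exists (16 * K / (eta ^ 2 * eps) + 1). 
  have q0 : 0 <= 16 * K / (eta ^ 2 * eps).
  { apply Rmult_le_pos; first lra. apply Rlt_le, Rinv_0_lt_compat. nra. }
  split; first lra.
  move=> T hT. have hT0 : 0 < T by lra.
  (* The truncation point b is chosen after T, since the truncation error of y is integrated over a
     length T. *)
  have [b [hb0 Hb]] := exp_neg_small (T * K) (eps / 4) ltac:(nra) ltac:(lra).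
  set b' := b + 1. have {}Hb : T * K * exp (- b') < eps / 4 by apply Hb; rewrite /b'; lra.
  have hb' : 0 < b' by rewrite /b'; lra.
  pose yb t := RInt (fun v => P v * cos (v * t)) 0 b'.
  have cyb t : continuous yb t by exact: (cos_transform_continuous P K).
  have cchi t : continuous (fun t => 1 - t / T) t by apply: ex_derive_continuous; auto_derive.
  have e_y a c : ex_RInt (fun t => (1 - t / T) * y t) a c by apply: ex_RInt_continuous => z _; apply: continuous_mult.
  have e_yb a c : ex_RInt (fun t => (1 - t / T) * yb t) a c by apply: ex_RInt_continuous => z _; apply: continuous_mult.
  have F := fubini_fejer P K T b' hT0 hb' hP hB. rewrite -/(yb _) in F.
  have d1 : Rabs (RInt (fun t => (1 - t / T) * y t) 0 T - RInt (fun t => (1 - t / T) * yb t) 0 T) <= T * (K * exp (- b')).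
  { have -> : RInt (fun t => (1 - t / T) * y t) 0 T - RInt (fun t => (1 - t / T) * yb t) 0 T =
      RInt (fun t => minus ((1 - t / T) * y t) ((1 - t / T) * yb t)) 0 T by rewrite RInt_minus.
    have -> : T * (K * exp (- b')) = (T - 0) * (K * exp (- b')) by ring.
    apply: abs_RInt_le_const; [lra | exact: ex_RInt_minus |].
    move=> t ht.
    have -> : minus ((1 - t / T) * y t) ((1 - t / T) * yb t) = - ((1 - t / T) * (yb t - y t)) by rewrite /minus /plus /opp /=; ring.
    rewrite Rabs_Ropp Rabs_mult.
    have := fejer_weight_range T t hT0 ltac:(lra).
    move=> hc. rewrite (Rabs_pos_eq (1 - t / T)); last lra.
    have := tail t b' ltac:(lra). have := Rabs_pos (yb t - y t). rewrite -/(yb t). nra. }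
  have d2 : Rabs (RInt (fun v => P v * fejer_kernel T v) 0 b') <= (Rabs (P 0) + e1) * (2 * PI) + eps / 4.
  { set A := Rabs (P 0) + e1. have hA : 0 <= A by rewrite /A; have := Rabs_pos (P 0); lra.
    set K2 := 4 * K / (T * eta ^ 2).
    have hTe : 0 < T * eta ^ 2 by nra.
    have hK2 : 0 <= K2 by apply Rmult_le_pos; [lra | apply Rlt_le, Rinv_0_lt_compat].
    have e_k : ex_RInt (fun v => P v * fejer_kernel T v) 0 b'.
    { apply: ex_RInt_continuous => z _. apply: continuous_mult; [exact: hP | exact: fejer_kernel_continuous]. }
    have M := is_RInt_plus _ _ 0 b' _ _ (is_RInt_fejer_majorant T A b') (is_RInt_exp_neg K2 0 b').
    have := norm_RInt_le (fun v => P v * fejer_kernel T v) _ 0 b' _ _ (Rlt_le _ _ hb') _ (RInt_correct _ _ _ e_k) M.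
    rewrite /norm /= /abs /= /plus /= Ropp_0 exp_0.
    move=> h. apply Rle_trans with (A * (4 * atan (T * b')) + (K2 * 1 - K2 * exp (- b'))).
    - apply h => v hv.
      have kb := fejer_kernel_bound T v hT0.
      have hv2 : 0 <= v ^ 2 by apply pow2_ge_0. have hT2 : 0 < T ^ 2 by apply pow_lt.
      have hz : 0 <= T ^ 2 * v ^ 2 by apply Rmult_le_pos; lra.
      have hq : 0 <= 4 * T / (1 + T ^ 2 * v ^ 2) by apply Rmult_le_pos; [lra | apply Rlt_le, Rinv_0_lt_compat; lra].
      rewrite Rabs_mult. have ev := exp_pos (- v).
      change (Rabs (P v) * Rabs (fejer_kernel T v) <= A * (4 * T / (1 + T ^ 2 * v ^ 2)) + K2 * exp (- v)).
      case: (Rlt_le_dec v eta) => hve.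
      + have := Heta v ltac:(rewrite Rminus_0_r Rabs_pos_eq; lra).
        move=> hp. have hPA : Rabs (P v) <= A.
        { rewrite /A. have := Rabs_triang (P v - P 0) (P 0). have -> : P v - P 0 + P 0 = P v by ring. lra. }
        have : Rabs (P v) * Rabs (fejer_kernel T v) <= A * (4 * T / (1 + T ^ 2 * v ^ 2)) by apply Rmult_le_compat; try apply Rabs_pos.
        have : 0 <= K2 * exp (- v) by apply Rmult_le_pos; lra.
        lra.
      + have hpv := hb v. rewrite (Rabs_pos_eq v) in hpv; last lra.
        have kb2 : 4 * T / (1 + T ^ 2 * v ^ 2) <= 4 / (T * eta ^ 2).
        { have hev : eta ^ 2 <= v ^ 2 by apply pow_incr; lra.
          apply (Rmult_le_reg_r ((1 + T ^ 2 * v ^ 2) * (T * eta ^ 2))); first by apply Rmult_lt_0_compat; lra.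
          have -> : 4 * T / (1 + T ^ 2 * v ^ 2) * ((1 + T ^ 2 * v ^ 2) * (T * eta ^ 2)) = 4 * (T ^ 2 * eta ^ 2) by field; lra.
          have -> : 4 / (T * eta ^ 2) * ((1 + T ^ 2 * v ^ 2) * (T * eta ^ 2)) = 4 * (1 + T ^ 2 * v ^ 2) by field; split; lra.
          nra. }
        have : Rabs (P v) * Rabs (fejer_kernel T v) <= (K * exp (- v)) * (4 / (T * eta ^ 2)).
        { apply Rmult_le_compat; [exact: Rabs_pos | exact: Rabs_pos | exact: hpv | lra]. }
        have -> : K * exp (- v) * (4 / (T * eta ^ 2)) = K2 * exp (- v) by rewrite /K2; field; split; lra.
        have : 0 <= A * (4 * T / (1 + T ^ 2 * v ^ 2)) by apply Rmult_le_pos.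
        lra.
    - have := atan_bound (T * b'). have := exp_pos (- b'). move=> x1 x2.
      have : K2 <= eps / 4.
      { rewrite /K2. apply (Rmult_le_reg_r (T * eta ^ 2)) => //.
        have -> : 4 * K / (T * eta ^ 2) * (T * eta ^ 2) = 4 * K by field; split; lra.
        have : 16 * K / (eta ^ 2 * eps) * (eta ^ 2 * eps) <= T * (eta ^ 2 * eps) by apply Rmult_le_compat_r; [nra | lra].
        have -> : 16 * K / (eta ^ 2 * eps) * (eta ^ 2 * eps) = 16 * K by field; split; lra.
        lra. }
      nra. }
  have F' : RInt (fun t => (1 - t / T) * yb t) 0 T = RInt (fun v => P v * fejer_kernel T v) 0 b' by exact: F.
  rewrite F' in d1.
  have ee : e1 * (2 * PI) = eps / 4 by rewrite /e1; field; lra.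
  have := Rabs_triang (RInt (fun t => (1 - t / T) * y t) 0 T - RInt (fun v => P v * fejer_kernel T v) 0 b') (RInt (fun v => P v * fejer_kernel T v) 0 b').
  have -> : forall u w, u - w + w = u by move=> u w; ring.
  have : T * (K * exp (- b')) = T * K * exp (- b') by ring.
  lra.
Qed.

(** * Positive weights on a vertical line *)

Fixpoint line_weight (l : list (R * R)) (t : R) : R :=
  match l with nil => 0 | p :: l' => fst p * exp (snd p * t) + line_weight l' t end.

Fixpoint abs_sum (l : list (R * R)) : R :=
  match l with nil => 0 | p :: l' => Rabs (fst p) + abs_sum l' end.

Definition on_line (sg t : R) : C := (RtoC sg + Ci * RtoC t)%C.

Lemma multiplier_line sg l t : multiplier sg l (on_line sg t) = RtoC (line_weight l t).
Proof.
  elim: l => [|p l IH] //=. rewrite IH RtoC_plus RtoC_mult. f_equal. f_equal.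
  rewrite -Cexp_R. f_equal. rewrite /on_line RtoC_mult.
  transitivity (- (Ci * Ci) * (RtoC (snd p) * RtoC t))%C; first ring.
  have -> : (Ci * Ci = - RtoC 1)%C by rewrite /Ci /Cmult /RtoC /Copp /=; f_equal; ring.
  ring.
Qed.

(** * Operations on angle lists and the lists of the weights *)

Definition shift_angles (d : R) (l : list (R * R)) := map (fun p => (fst p, snd p + d)) l.
Definition scale_coefs (c : R) (l : list (R * R)) := map (fun p => (c * fst p, snd p)) l.
(** Multiplies the multiplier by 2 cos (d (s - sg)) - 2 cos (g d), which vanishes at s = sg + g and
    s = sg - g and is 2 cosh (d t) - 2 cos (g d) on the line. With g = sg there is a zero at 0, with
    g = 1 - sg one at 1. *)
Definition cosh_step (g d : R) (l : list (R * R)) := shift_angles d l ++ shift_angles (- d) l ++ scale_coefs (- (2 * cos (g * d))) l.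

Lemma multiplier_app sg l l' s : multiplier sg (l ++ l') s = (multiplier sg l s + multiplier sg l' s)%C.
Proof. elim: l => [|p l IH] /=; [ring | rewrite IH; ring]. Qed.

Lemma multiplier_shift sg d l s : multiplier sg (shift_angles d l) s = (Cexp (- (Ci * RtoC d * (s - RtoC sg))) * multiplier sg l s)%C.
Proof.
  elim: l => [|p l IH] /=; first ring. rewrite IH.
  have -> : (- (Ci * RtoC (snd p + d) * (s - RtoC sg)) = - (Ci * RtoC d * (s - RtoC sg)) + - (Ci * RtoC (snd p) * (s - RtoC sg)))%C.
  { rewrite RtoC_plus. ring. }
  rewrite Cexp_plus. ring.
Qed.

Lemma multiplier_scale sg c l s : multiplier sg (scale_coefs c l) s = (RtoC c * multiplier sg l s)%C.
Proof. elim: l => [|p l IH] /=; [ring | rewrite IH RtoC_mult; ring]. Qed.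

Lemma multiplier_step sg g d l s : multiplier sg (cosh_step g d l) s =
  ((Cexp (- (Ci * RtoC d * (s - RtoC sg))) + Cexp (Ci * RtoC d * (s - RtoC sg)) - RtoC (2 * cos (g * d))) * multiplier sg l s)%C.
Proof.
  rewrite /cosh_step !multiplier_app !multiplier_shift multiplier_scale !RtoC_opp.
  have -> : (- (Ci * - RtoC d * (s - RtoC sg)) = Ci * RtoC d * (s - RtoC sg))%C by ring.
  ring.
Qed.

Lemma multiplier_step_zero sg g d l (x : R) : x - sg = g \/ x - sg = - g -> multiplier sg (cosh_step g d l) (RtoC x) = RtoC 0.
Proof.
  move=> h. rewrite multiplier_step.
  have -> : (Cexp (- (Ci * RtoC d * (RtoC x - RtoC sg))) + Cexp (Ci * RtoC d * (RtoC x - RtoC sg)) - RtoC (2 * cos (g * d)) = 0)%C; last ring.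
  rewrite -RtoC_minus.
  have ex : cos (d * (x - sg)) = cos (g * d).
  { case: h => ->; first by f_equal; ring. rewrite -cos_neg. f_equal. ring. }
  rewrite -ex /Cexp /Re /Im /Ci /RtoC /=. set z := x - sg.
  have e1 : - ((0 * d - 1 * 0) * z - (0 * 0 + 1 * d) * 0) = 0 by ring.
  have e2 : - ((0 * d - 1 * 0) * 0 + (0 * 0 + 1 * d) * z) = - (d * z) by ring.
  have e3 : (0 * d - 1 * 0) * z - (0 * 0 + 1 * d) * 0 = 0 by ring.
  have e4 : (0 * d - 1 * 0) * 0 + (0 * 0 + 1 * d) * z = d * z by ring.
  rewrite e1 e2 e3 e4 exp_0 cos_neg sin_neg /Cminus /Cplus /Copp /=. f_equal; ring.
Qed.

Lemma line_weight_app l l' t : line_weight (l ++ l') t = line_weight l t + line_weight l' t.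
Proof. elim: l => [|p l IH] /=; [ring | rewrite IH; ring]. Qed.
Lemma line_weight_shift d l t : line_weight (shift_angles d l) t = exp (d * t) * line_weight l t.
Proof. elim: l => [|p l IH] /=; [ring | rewrite IH Rmult_plus_distr_r exp_plus; ring]. Qed.
Lemma line_weight_scale c l t : line_weight (scale_coefs c l) t = c * line_weight l t.
Proof. elim: l => [|p l IH] /=; [ring | rewrite IH; ring]. Qed.

Definition cosh_factor (g d t : R) : R := exp (d * t) + exp (- (d * t)) - 2 * cos (g * d).

Lemma line_weight_step g d l t : line_weight (cosh_step g d l) t = cosh_factor g d t * line_weight l t.
Proof.
  rewrite /cosh_step !line_weight_app !line_weight_shift line_weight_scale /cosh_factor. have -> : - d * t = - (d * t) by ring. ring.
Qed.

Lemma abs_sum_app l l' : abs_sum (l ++ l') = abs_sum l + abs_sum l'.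
Proof. elim: l => [|p l IH] /=; [ring | rewrite IH; ring]. Qed.
Lemma abs_sum_shift d l : abs_sum (shift_angles d l) = abs_sum l.
Proof. elim: l => [|p l IH] //=. by rewrite IH. Qed.
Lemma abs_sum_scale c l : abs_sum (scale_coefs c l) = Rabs c * abs_sum l.
Proof. elim: l => [|p l IH] /=; [ring | rewrite IH Rabs_mult; ring]. Qed.
Lemma abs_sum_pos l : 0 <= abs_sum l.
Proof. elim: l => [|p l IH] /=; first lra. have := Rabs_pos (fst p). lra. Qed.

Lemma abs_sum_step g d l : abs_sum (cosh_step g d l) <= 4 * abs_sum l.
Proof.
  rewrite /cosh_step !abs_sum_app !abs_sum_shift abs_sum_scale Rabs_Ropp Rabs_mult.
  have := abs_sum_pos l. have := Rabs_cos_le (g * d). have := Rabs_pos (cos (g * d)). rewrite (Rabs_pos_eq 2); last lra. nra.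
Qed.

(** The angles cluster at al and at - al; the absolute value treats both clusters at once, as only
    the distance of |beta| from pi/4 matters. *)
Definition angles_near (al r : R) (l : list (R * R)) : Prop := forall p, In p l -> Rabs (Rabs (snd p) - al) <= r.

Lemma angles_near_step al r g d l : 0 <= d -> angles_near al r l -> angles_near al (r + d) (cosh_step g d l).
Proof.
  move=> hd H p. rewrite /cosh_step !in_app_iff /shift_angles /scale_coefs !in_map_iff.
  have key b q : In q l -> Rabs (b - snd q) <= d -> Rabs (Rabs b - al) <= r + d.
  { move=> hq hb. have h1 := H q hq. have h2 := Rabs_triang_inv2 b (snd q).
    have -> : Rabs b - al = (Rabs b - Rabs (snd q)) + (Rabs (snd q) - al) by ring.
    apply Rle_trans with (1 := Rabs_triang _ _). lra. }
  move=> [[q [<- hq]]|[[q [<- hq]]|[q [<- hq]]]] /=; apply: (key _ q) => //.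
  - have -> : snd q + d - snd q = d by ring. rewrite Rabs_pos_eq; lra.
  - have -> : snd q + - d - snd q = - d by ring. rewrite Rabs_Ropp Rabs_pos_eq; lra.
  - rewrite Rminus_diag Rabs_R0. lra.
Qed.

Definition base_list (e al : R) : list (R * R) := (/ 2, al) :: (e / 2, - al) :: nil.
Definition weight_list (sg e al d : R) (N : nat) : list (R * R) :=
  Nat.iter N (fun l => cosh_step sg d (cosh_step (1 - sg) d l)) (base_list e al).

(** cosh for e = 1 and sinh for e = -1. *)
Definition exp_half (e x : R) : R := (exp x + e * exp (- x)) / 2.

Lemma line_weight_weight_list sg e al d N t : line_weight (weight_list sg e al d N) t = (cosh_factor sg d t * cosh_factor (1 - sg) d t) ^ N * exp_half e (al * t).
Proof.
  elim: N => [|N IH].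
  - rewrite /= /exp_half. have -> : - al * t = - (al * t) by ring. field.
  - rewrite /weight_list /= -/(weight_list sg e al d N) !line_weight_step IH. ring.
Qed.

Lemma abs_sum_weight_list sg e al d N : Rabs e <= 1 -> abs_sum (weight_list sg e al d N) <= 16 ^ N.
Proof.
  move=> he. elim: N => [|N IH].
  - rewrite /= /Rdiv Rabs_mult (Rabs_pos_eq (/ 2)); lra.
  - rewrite /weight_list /= -/(weight_list sg e al d N).
    have h1 := abs_sum_step sg d (cosh_step (1 - sg) d (weight_list sg e al d N)).
    have h2 := abs_sum_step (1 - sg) d (weight_list sg e al d N). lra.
Qed.

Lemma angles_near_weight_list sg e al d N : 0 <= d -> 0 <= al -> angles_near al (2 * INR N * d) (weight_list sg e al d N).
Proof.
  move=> hd ha. elim: N => [|N IH].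
  - rewrite /= Rmult_0_r Rmult_0_l. move=> p [<-|[<-|[]]] /=.
    + rewrite (Rabs_pos_eq al) // Rminus_diag Rabs_R0. lra.
    + rewrite Rabs_Ropp (Rabs_pos_eq al) // Rminus_diag Rabs_R0. lra.
  - rewrite /weight_list [Nat.iter _ _ _]/= -/(weight_list sg e al d N).
    have -> : 2 * INR (S N) * d = 2 * INR N * d + d + d by rewrite S_INR; ring.
    by apply angles_near_step => //; apply angles_near_step.
Qed.

Lemma multiplier_weight_list_zero sg e al d N : (1 <= N)%nat ->
  multiplier sg (weight_list sg e al d N) (RtoC 0) = RtoC 0 /\ multiplier sg (weight_list sg e al d N) (RtoC 1) = RtoC 0.
Proof.
  case: N => [|N] hN; first lia. rewrite /weight_list /= -/(weight_list sg e al d N). split.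
  - apply multiplier_step_zero. right. ring.
  - rewrite multiplier_step multiplier_step_zero; first ring. by left.
Qed.

(** At v = 0 every theta is within E of - 1/2, and these halves add up to - 1/2 times the multiplier
    at 0, which is 0 for the weight lists. The phases exp (i beta sg) have modulus 1. *)
Lemma mkernel_0_bound sg l E : (forall p, In p l -> Cmod (Theta (ray (snd p) 0) + RtoC (/ 2))%C <= E) ->
  Cmod (mkernel sg l 0 + RtoC (/ 2) * multiplier sg l 0)%C <= abs_sum l * E.
Proof.
  elim: l => [|p l IH] H /=.
  - have -> : (0 + RtoC (/ 2) * 0 = 0)%C by ring. rewrite Cmod_0. lra.
  - have h1 := IH (fun q hq => H q (or_intror hq)). have h2 := H p (or_introl eq_refl).
    have -> : (- (Ci * RtoC (snd p) * (0 - RtoC sg)) = Ci * RtoC (snd p) * RtoC sg)%C by ring.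
    set c := (RtoC (fst p) * Cexp (Ci * RtoC (snd p) * RtoC sg))%C.
    have hc : Cmod c = Rabs (fst p).
    { rewrite /c Cmod_mult Cmod_R Cmod_Cexp.
      have -> : Re (Ci * RtoC (snd p) * RtoC sg)%C = 0 by rewrite /Re /Im /Ci /RtoC /=; ring.
      rewrite exp_0. ring. }
    have -> : (c * Theta (ray (snd p) 0) + mkernel sg l 0 + RtoC (/ 2) * (c + multiplier sg l 0)
       = c * (Theta (ray (snd p) 0) + RtoC (/ 2)) + (mkernel sg l 0 + RtoC (/ 2) * multiplier sg l 0))%C by ring.
    apply Rle_trans with (1 := Cmod_triangle _ _). rewrite Cmod_mult hc Rmult_plus_distr_r.
    apply Rplus_le_compat => //. apply Rmult_le_compat_l => //. exact: Rabs_pos.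
Qed.

Lemma half_int_re f l : is_half_int f l -> forall eps, 0 < eps -> exists R0, 0 <= R0 /\ forall b, R0 <= b ->
  Rabs (RInt (fun v => Re (f v)) 0 b - Re l) < eps.
Proof.
  move=> H eps he. have [R0 [p0 h0]] := H eps he. exists R0; split => // b hb.
  apply Rle_lt_trans with (2 := h0 b hb). exact: (re_le_Cmod (cint f 0 b - l)%C).
Qed.

Lemma cont_line X sg : (forall s, exists d, cder X s d) -> cont (fun t => X (on_line sg t)).
Proof.
  move=> H t. have [d Hd] := H (on_line sg t).
  split; apply: ex_derive_continuous; eexists; [exact: cder_line_re Hd | exact: cder_line_im Hd].
Qed.

(* Evenness of the Fejer weight lets [t] and [-t] be paired, which leaves a cosine transform. *)
Theorem fejer_line sg l lam X : small_angles l -> Cmod lam <= 1 -> superdecay (fun v => mkernel sg l (- v)) ->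
  (forall s, exists d, cder X s d) ->
  (forall s, is_half_int (mellin_integrand (mkernel sg l) (fun v => mkernel sg l (- v)) s) (X s)) ->
  forall eps, 0 < eps -> exists T0, 0 < T0 /\ forall T, T0 <= T ->
    Rabs (RInt (fun t => (1 - t / T) * (Re (lam * X (on_line sg t))%C + Re (lam * X (on_line sg (- t)))%C)) 0 T)
      <= 2 * PI * (4 * Cmod (mkernel sg l 0)) + eps.
Proof.
  move=> hl hlam dk' DX HX eps he.
  have ck := cont_mkernel sg l hl. have dk := superdecay_mkernel sg l hl.
  pose p v := (mkernel sg l v * Cexp (RtoC sg * RtoC v))%C.
  have cp : cont p by apply cont_mult; [exact: ck | exact: cont_Cexp_scal].
  (* The exponentials for t and - t combine to 2 cos (v t), and the negative half of the integral is
     folded onto the positive one. Hence P is even and |P 0| <= 4 |mkernel 0|. *)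
  pose P v := Re (RtoC 2 * lam * (p v + p (- v)%R))%C.
  have cP x : continuous P x.
  { have h : cont (fun v => RtoC 2 * lam * (p v + p (- v)%R))%C.
    { apply cont_mult; first exact: cont_const. apply cont_plus => //. exact: (cont_neg _ cp). }
    exact: (proj1 (h x)). }
  have [K1 [hK1 H1]] := dk (sg + 1). have [K2 [hK2 H2]] := dk' (- sg + 1).
  have bp v : 0 <= v -> Cmod (p v) <= K1 * exp (- v).
  { move=> hv. rewrite /p Cmod_mult Cmod_Cexp_scal.
    have -> : exp (- v) = exp (- ((sg + 1) * v)) * exp (Re (RtoC sg) * v) by rewrite -exp_plus; f_equal; rewrite /Re /=; ring.
    rewrite -Rmult_assoc. apply Rmult_le_compat_r; [by apply Rlt_le, exp_pos | exact: H1]. }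
  have bp' v : 0 <= v -> Cmod (p (- v)) <= K2 * exp (- v).
  { move=> hv. rewrite /p Cmod_mult Cmod_Cexp_scal.
    have -> : exp (- v) = exp (- ((- sg + 1) * v)) * exp (Re (RtoC sg) * - v) by rewrite -exp_plus; f_equal; rewrite /Re /=; ring.
    rewrite -Rmult_assoc. apply Rmult_le_compat_r; [by apply Rlt_le, exp_pos | exact: H2]. }
  have hl0 := Cmod_ge_0 lam.
  have bP0 v : 0 <= v -> Rabs (P v) <= 2 * (K1 + K2) * exp (- v).
  { move=> hv. apply Rle_trans with (1 := re_le_Cmod _). rewrite !Cmod_mult Cmod_R Rabs_pos_eq; last lra.
    have t := Cmod_triangle (p v) (p (- v)). have := bp v hv. have := bp' v hv.
    have p0 := Cmod_ge_0 (p v + p (- v)%R)%C. have := exp_pos (- v). nra. }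
  have Peven v : P (- v) = P v by rewrite /P Ropp_involutive (Cplus_comm (p (- v))).
  have bP v : Rabs (P v) <= 2 * (K1 + K2) * exp (- Rabs v).
  { case: (Rle_lt_dec 0 v) => hv.
    - rewrite (Rabs_pos_eq v) //. exact: bP0.
    - rewrite (Rabs_left v) // -Peven. apply bP0. lra. }
  have cX := cont_line X sg DX.
  have cy x : continuous (fun t => Re (lam * X (on_line sg t))%C + Re (lam * X (on_line sg (- t)))%C) x.
  { have h : cont (fun t => lam * X (on_line sg t))%C by apply cont_mult; [exact: cont_const | exact: cX].
    have h' := cont_neg _ h.
    apply: (continuous_plus (fun t => Re (lam * X (on_line sg t))%C) (fun t => Re (lam * X (on_line sg (- t)))%C)).
    - exact: (proj1 (h x)).
    - exact: (proj1 (h' x)). }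
  have P0 : Rabs (P 0) <= 4 * Cmod (mkernel sg l 0).
  { apply Rle_trans with (1 := re_le_Cmod _). rewrite Ropp_0 !Cmod_mult Cmod_R Rabs_pos_eq; last lra.
    have -> : (p 0 = mkernel sg l 0)%C by rewrite /p Cmult_0_r Cexp_0 Cmult_1_r.
    have := Cmod_triangle (mkernel sg l 0) (mkernel sg l 0). have := Cmod_ge_0 (mkernel sg l 0 + mkernel sg l 0)%C. nra. }
  have cJ s : cont (mellin_integrand (mkernel sg l) (fun v => mkernel sg l (- v)) s).
  { apply cont_plus; (apply cont_mult; [|exact: cont_Cexp_scal]) => //. exact: (cont_neg _ ck). }
  have HL t e' : 0 < e' -> exists R0, 0 <= R0 /\ forall b, R0 <= b ->
     Rabs (RInt (fun v => P v * cos (v * t)) 0 b - (Re (lam * X (on_line sg t))%C + Re (lam * X (on_line sg (- t)))%C)) < e'.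
  { have J := half_int_scal lam _ _ (cont_plus _ _ (cJ _) (cJ _)) (half_int_plus _ _ _ _ (cJ _) (cJ _) (HX (on_line sg t)) (HX (on_line sg (- t)))).
    move=> he'. have [R0 [p0 h0]] := half_int_re _ _ J e' he'. exists R0; split => // b hb.
    have := h0 b hb.
    have -> : Re (lam * (X (on_line sg t) + X (on_line sg (- t))))%C = Re (lam * X (on_line sg t))%C + Re (lam * X (on_line sg (- t)))%C.
    { rewrite /Re /Im /=. ring. }
    have -> // : RInt (fun v => Re (lam * (mellin_integrand (mkernel sg l) (fun v => mkernel sg l (- v)) (on_line sg t) v + mellin_integrand (mkernel sg l) (fun v => mkernel sg l (- v)) (on_line sg (- t)) v))%C) 0 b = RInt (fun v => P v * cos (v * t)) 0 b.
    apply RInt_ext => v _. rewrite /mellin_integrand /P.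
    have c0 : (Cexp (Ci * RtoC (v * t)) + Cexp (- (Ci * RtoC (v * t))) = RtoC 2 * RtoC (cos (v * t)))%C.
    { rewrite /Cexp /Re /Im /Ci /RtoC /=. set z := v * t.
      have e1 : 0 * z - 1 * 0 = 0 by ring. have e2 : 0 * 0 + 1 * z = z by ring.
      rewrite e1 e2 Ropp_0 exp_0 cos_neg sin_neg /Cplus /Cmult /=. f_equal; ring. }
    have E : (lam * ((mkernel sg l v * Cexp (on_line sg t * RtoC v) + mkernel sg l (- v) * Cexp (- on_line sg t * RtoC v)) +
       (mkernel sg l v * Cexp (on_line sg (- t) * RtoC v) + mkernel sg l (- v) * Cexp (- on_line sg (- t) * RtoC v)))
       = (RtoC 2 * lam * (p v + p (- v)%R)) * RtoC (cos (v * t)))%C.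
    { rewrite /on_line RtoC_opp.
      have -> : ((RtoC sg + Ci * RtoC t) * RtoC v = RtoC sg * RtoC v + Ci * RtoC (v * t))%C by rewrite RtoC_mult; ring.
      have -> : (- (RtoC sg + Ci * RtoC t) * RtoC v = RtoC sg * RtoC (- v) + - (Ci * RtoC (v * t)))%C by rewrite RtoC_mult RtoC_opp; ring.
      have -> : ((RtoC sg + Ci * - RtoC t) * RtoC v = RtoC sg * RtoC v + - (Ci * RtoC (v * t)))%C by rewrite RtoC_mult; ring.
      have -> : (- (RtoC sg + Ci * - RtoC t) * RtoC v = RtoC sg * RtoC (- v) + Ci * RtoC (v * t))%C by rewrite RtoC_mult RtoC_opp; ring.
      rewrite !Cexp_plus /p.
      transitivity (lam * (mkernel sg l v * Cexp (RtoC sg * RtoC v) + mkernel sg l (- v) * Cexp (RtoC sg * RtoC (- v))) * (Cexp (Ci * RtoC (v * t)) + Cexp (- (Ci * RtoC (v * t)))))%C; first ring.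
      rewrite c0. ring. }
    rewrite E. rewrite /Re /Im /RtoC /=. ring. }
  have [T0 [hT0 HT]] := fejer_bound P _ (2 * (K1 + K2)) ltac:(lra) cP cy bP HL eps he.
  exists T0; split => // T hT. apply Rle_trans with (1 := HT T hT).
  have := PI_RGT_0. have := Rabs_pos (P 0). nra.
Qed.

(** * The sign contradiction *)

Lemma on_line_pair sg t : on_line sg t = (sg, t).
Proof. rewrite /on_line /Cplus /Cmult /Ci /RtoC /=. f_equal; ring. Qed.

Lemma cosh_factor_lower g d t : 0 <= d * t -> (d * t) ^ 2 / 4 <= cosh_factor g d t.
Proof.
  move=> h. rewrite /cosh_factor. set x := d * t in h *.
  have E : exp x + exp (- x) = (exp (x / 2) - exp (- (x / 2))) ^ 2 + 2.
  { have -> : exp x = exp (x / 2) * exp (x / 2) by rewrite -exp_plus; f_equal; field.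
    have -> : exp (- x) = exp (- (x / 2)) * exp (- (x / 2)) by rewrite -exp_plus; f_equal; field.
    have : exp (x / 2) * exp (- (x / 2)) = 1 by rewrite -exp_plus Rplus_opp_r exp_0. move=> E. ring_simplify. nra. }
  have h1 := exp_ineq1_le (x / 2).
  have h2 : exp (- (x / 2)) <= 1 by rewrite -exp_0; apply exp_le_mono; lra.
  have h3 : (x / 2) ^ 2 <= (exp (x / 2) - exp (- (x / 2))) ^ 2 by apply pow_incr; lra.
  have := COS_bound (g * d). have -> : x ^ 2 / 4 = (x / 2) ^ 2 by field. lra.
Qed.

(** Keeping g^2 + t^2 is essential: for g = sg and g = 1 - sg it is |s|^2 and |s - 1|^2 on the line,
    so that the weight compensates the poles of F. *)
Lemma cosh_factor_upper g d t : Rabs (d * t) <= 1 -> cosh_factor g d t <= 6 * d ^ 2 * (g ^ 2 + t ^ 2).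
Proof.
  move=> h. rewrite /cosh_factor. set x := d * t in h *.
  have b1 := exp_m1x_bound x. have b2 := exp_m1x_bound (- x). rewrite Rabs_Ropp in b2.
  have h3 : exp (Rabs x) <= 3.
  { apply Rle_trans with (exp 1); [by apply exp_le_mono | exact: exp_le_3]. }
  have px := Rabs_pos x.
  have e2 : exp (Rabs x) * Rabs x * Rabs x <= 3 * x ^ 2.
  { rewrite -(pow2_abs x). have : 0 <= Rabs x * Rabs x by nra. nra. }
  have c := cos_m1_bound (g * d).
  have e3 : Rabs (g * d) * Rabs (g * d) = (g * d) ^ 2 by rewrite -(pow2_abs (g * d)); ring.
  rewrite e3 in c.
  have k1 := Rle_abs (exp x - 1 - x). have k2 := Rle_abs (exp (- x) - 1 - - x). have k3 := Rle_abs (- (cos (g * d) - 1)).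
  rewrite Rabs_Ropp in k3.
  have -> : 6 * d ^ 2 * (g ^ 2 + t ^ 2) = 6 * x ^ 2 + 6 * (g * d) ^ 2 by rewrite /x; ring.
  have := pow2_ge_0 (g * d). lra.
Qed.

Lemma cosh_factor_even g d t : cosh_factor g d (- t) = cosh_factor g d t.
Proof.
  rewrite /cosh_factor. have -> : d * - t = - (d * t) by ring. have -> : - - (d * t) = d * t by ring. ring.
Qed.

Lemma cosh_factor_nonneg g d t : 0 <= cosh_factor g d t.
Proof.
  case: (Rle_lt_dec 0 (d * t)) => h.
  - apply Rle_trans with (2 := cosh_factor_lower g d t h). have := pow2_ge_0 (d * t). lra.
  - rewrite -cosh_factor_even. have h' : 0 <= d * - t by lra. apply Rle_trans with (2 := cosh_factor_lower g d (- t) h').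
    have := pow2_ge_0 (d * - t). lra.
Qed.

Lemma exp_half_lower e x : e = 1 \/ e = -1 -> 1 <= x -> / 2 <= exp_half e x.
Proof.
  move=> he hx. rewrite /exp_half. have h1 := exp_ineq1_le x.
  have h2 := exp_pos (- x).
  have h3 : exp (- x) * exp x = 1 by rewrite -exp_plus Rplus_opp_l exp_0.
  have : exp (- x) <= / 2 by nra.
  case: he => ->; lra.
Qed.

Lemma exp_half_nonneg e x : e = 1 \/ e = -1 -> 0 <= x -> 0 <= exp_half e x.
Proof.
  move=> he hx. rewrite /exp_half. have h1 := exp_ineq1_le x. have h2 := exp_pos (- x).
  have : exp (- x) <= 1 by rewrite -exp_0; apply exp_le_mono; lra.
  case: he => ->; lra.
Qed.

Lemma exp_half_upper e x y : e = 1 \/ e = -1 -> Rabs x <= y -> Rabs (exp_half e x) <= exp y.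
Proof.
  move=> he hx. rewrite /exp_half.
  have h1 : exp x <= exp y by apply exp_le_mono; have := Rle_abs x; lra.
  have h2 : exp (- x) <= exp y by apply exp_le_mono; have := Rle_abs (- x); rewrite Rabs_Ropp; lra.
  have h3 := exp_pos x. have h4 := exp_pos (- x). apply Rabs_le. case: he => ->; lra.
Qed.

Lemma exp_half_parity e x : e = 1 \/ e = -1 -> exp_half e (- x) = e * exp_half e x.
Proof. move=> he. rewrite /exp_half Ropp_involutive. case: he => ->; field. Qed.

Lemma on_line_nonzero sg t : t <> 0 -> on_line sg t <> RtoC 0 /\ on_line sg t <> RtoC 1.
Proof. move=> h. rewrite on_line_pair. by split; case. Qed.

Lemma Cmod_on_line sg t : Cmod (on_line sg t) ^ 2 = sg ^ 2 + t ^ 2 /\ Cmod (on_line sg t - 1)%C ^ 2 = (1 - sg) ^ 2 + t ^ 2.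
Proof. rewrite !Cmod2_alt on_line_pair /Re /Im /RtoC /=. split; ring. Qed.

(** The factor |s| |s - 1| makes F bounded also on the lines through a pole, by the residue
    conditions; t <> 0 excludes the junk value at the pole itself. *)
Lemma F_line_bounded zeta Gamma F sg T0 : is_completed_zeta zeta Gamma F -> 0 <= T0 ->
  exists M, 0 <= M /\ forall t, t <> 0 -> Rabs t <= T0 -> Cmod (F (on_line sg t)) * (Cmod (on_line sg t) * Cmod (on_line sg t - 1)%C) <= M.
Proof.
  move=> HF hT.
  (* Bisection of a segment, as a rectangle of width 0 whose first two sides are dummies. *)
  pose P (a b c d : R) := exists M, forall t, t <> 0 -> c <= t <= d -> Cmod (F (on_line sg t)) * (Cmod (on_line sg t) * Cmod (on_line sg t - 1)%C) <= M.
  have [M HM] : P 0 0 (- T0) T0.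
  { apply (rect_induct P); try lra.
    - move=> a b c d _ _ [M1 H1] _ [M2 H2] _. exists (Rmax M1 M2) => t ht htt.
      case: (Rle_lt_dec t ((c + d) / 2)) => h.
      + apply Rle_trans with (2 := Rmax_l _ _). apply H1 => //; lra.
      + apply Rle_trans with (2 := Rmax_r _ _). apply H2 => //; lra.
    - move=> x y _ hy.
      have dist t : (on_line sg t - on_line sg y)%C = (Ci * RtoC (t - y))%C by rewrite /on_line RtoC_minus; ring.
      have mdist t : Cmod (on_line sg t - on_line sg y)%C = Rabs (t - y) by rewrite dist Cmod_mult Cmod_Ci Cmod_R; ring.
      set s0 := on_line sg y in dist mdist *.
      have rng c d t del : c <= y <= d -> c <= t <= d -> d - c < del -> Rabs (t - y) < del.
      { move=> h1 h2 h3. apply Rabs_def1; lra. }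
      case: (classic (s0 = RtoC 0)) => h0; [|case: (classic (s0 = RtoC 1)) => h1].
      + have [del [hdel Hd]] := residue_eps F 0 _ (proj1 (proj2 (proj2 HF))) 1 ltac:(lra).
        exists (Rmin del 1); split; first by apply Rmin_pos; lra.
        move=> a b c d _ _ _ _ _ hyy _ hdc. exists 4 => t ht htt.
        have r := rng c d t _ hyy htt hdc. have r1 := Rlt_le_trans _ _ _ r (Rmin_l _ _). have r2 := Rlt_le_trans _ _ _ r (Rmin_r _ _).
        have m := mdist t. rewrite h0 in m. have z : (on_line sg t - 0 = on_line sg t)%C by ring. rewrite z in m.
        have := Hd (on_line sg t) (proj1 (on_line_nonzero sg t ht)) ltac:(rewrite z m; exact: r1). rewrite z => k.
        have k1 : Cmod (on_line sg t * F (on_line sg t))%C <= 2.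
        { have -> : (on_line sg t * F (on_line sg t) = (on_line sg t * F (on_line sg t) - - (1)) - 1)%C by ring.
          apply Rle_trans with (1 := Cmod_triangle' _ _). rewrite Cmod_1. lra. }
        have k2 : Cmod (on_line sg t - 1)%C <= 2.
        { apply Rle_trans with (1 := Cmod_triangle' _ _). rewrite Cmod_1. lra. }
        have -> : Cmod (F (on_line sg t)) * (Cmod (on_line sg t) * Cmod (on_line sg t - 1)%C) = Cmod (on_line sg t * F (on_line sg t))%C * Cmod (on_line sg t - 1)%C by rewrite Cmod_mult; ring.
        have := Cmod_ge_0 (on_line sg t * F (on_line sg t))%C. have := Cmod_ge_0 (on_line sg t - 1)%C. nra.
      + have [del [hdel Hd]] := residue_eps F 1 _ (proj2 (proj2 (proj2 HF))) 1 ltac:(lra).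
        exists (Rmin del 1); split; first by apply Rmin_pos; lra.
        move=> a b c d _ _ _ _ _ hyy _ hdc. exists 4 => t ht htt.
        have r := rng c d t _ hyy htt hdc. have r1 := Rlt_le_trans _ _ _ r (Rmin_l _ _). have r2 := Rlt_le_trans _ _ _ r (Rmin_r _ _).
        have m := mdist t. rewrite h1 in m.
        have k := Hd (on_line sg t) (proj2 (on_line_nonzero sg t ht)) ltac:(rewrite m; exact: r1).
        have k1 : Cmod ((on_line sg t - 1) * F (on_line sg t))%C <= 2.
        { have -> : ((on_line sg t - 1) * F (on_line sg t) = ((on_line sg t - 1) * F (on_line sg t) - 1) + 1)%C by ring.
          apply Rle_trans with (1 := Cmod_triangle _ _). rewrite Cmod_1. lra. }
        have k2 : Cmod (on_line sg t) <= 2.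
        { have -> : (on_line sg t = (on_line sg t - 1) + 1)%C by ring.
          apply Rle_trans with (1 := Cmod_triangle _ _). rewrite Cmod_1. lra. }
        have -> : Cmod (F (on_line sg t)) * (Cmod (on_line sg t) * Cmod (on_line sg t - 1)%C) = Cmod ((on_line sg t - 1) * F (on_line sg t))%C * Cmod (on_line sg t) by rewrite Cmod_mult; ring.
        have := Cmod_ge_0 ((on_line sg t - 1) * F (on_line sg t))%C. have := Cmod_ge_0 (on_line sg t). nra.
      + have [l Hl] := ex_derive_cder F s0 (proj1 (proj2 HF) s0 ltac:(by case)).
        have [del [hdel Hd]] := cder_cont _ _ _ Hl 1 ltac:(lra).
        exists (Rmin del 1); split; first by apply Rmin_pos; lra.
        move=> a b c d _ _ _ _ _ hyy _ hdc. exists ((Cmod (F s0) + 1) * ((Cmod s0 + 1) * (Cmod s0 + 2))) => t ht htt.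
        have r := rng c d t _ hyy htt hdc. have r1 := Rlt_le_trans _ _ _ r (Rmin_l _ _). have r2 := Rlt_le_trans _ _ _ r (Rmin_r _ _).
        have m := mdist t.
        have k := Hd (on_line sg t - s0)%C ltac:(rewrite m; exact: r1).
        have es : (s0 + (on_line sg t - s0) = on_line sg t)%C by ring. rewrite es in k.
        have k1 : Cmod (F (on_line sg t)) <= Cmod (F s0) + 1.
        { have -> : (F (on_line sg t) = (F (on_line sg t) - F s0) + F s0)%C by ring.
          apply Rle_trans with (1 := Cmod_triangle _ _). lra. }
        have k2 : Cmod (on_line sg t) <= Cmod s0 + 1.
        { have -> : (on_line sg t = (on_line sg t - s0) + s0)%C by ring.
          apply Rle_trans with (1 := Cmod_triangle _ _). lra. }
        have k3 : Cmod (on_line sg t - 1)%C <= Cmod s0 + 2.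
        { apply Rle_trans with (1 := Cmod_triangle' _ _). rewrite Cmod_1. lra. }
        apply Rmult_le_compat => //; first exact: Cmod_ge_0.
        { apply Rmult_le_pos; exact: Cmod_ge_0. }
        apply Rmult_le_compat => //; exact: Cmod_ge_0. }
  exists (Rmax M 0); split; first exact: Rmax_r.
  move=> t ht htt. apply Rle_trans with (2 := Rmax_l _ _). apply HM => //.
  have := Rle_abs t. have := Rle_abs (- t). rewrite Rabs_Ropp. lra.
Qed.

(** Since 2 b <= T, the triangular weight is at least 1/2 between a and b, where y >= m; the
    possibly negative stretch before T0 costs at most T0 Z. *)
Lemma fejer_integral_lower (y : R -> R) T0 a b T Z m : 0 < T0 -> T0 < a -> a < b -> 2 * b <= T -> 0 <= m -> 0 <= Z ->
  (forall t, continuous y t) -> (forall t, 0 < t < T0 -> - Z <= y t) -> (forall t, T0 <= t -> 0 <= y t) ->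
  (forall t, a <= t <= b -> m <= y t) ->
  m * (b - a) / 2 - T0 * Z <= RInt (fun t => (1 - t / T) * y t) 0 T.
Proof.
  move=> h0 ha hab hT hm hZ hy H1 H2 H3.
  have hT0 : 0 < T by lra.
  have ex p q : ex_RInt (fun t => (1 - t / T) * y t) p q.
  { apply: ex_RInt_continuous => z _. apply: continuous_mult => //. apply: ex_derive_continuous; auto_derive => //. }
  have chi t := fejer_weight_range T t hT0.
  have C1 := RInt_Chasles (fun t => (1 - t / T) * y t) 0 T0 T (ex _ _) (ex _ _).
  have C2 := RInt_Chasles (fun t => (1 - t / T) * y t) T0 a T (ex _ _) (ex _ _).
  have C3 := RInt_Chasles (fun t => (1 - t / T) * y t) a b T (ex _ _) (ex _ _).
  rewrite /plus /= in C1 C2 C3.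
  have kc c p q : p <= q -> (forall t, p < t < q -> c <= (1 - t / T) * y t) -> (q - p) * c <= RInt (fun t => (1 - t / T) * y t) p q.
  { move=> hpq hh. have -> : (q - p) * c = RInt (fun _ => c) p q by rewrite RInt_const.
    apply RInt_le => //. exact: ex_RInt_const. }
  have I1 := kc (- Z) 0 T0 ltac:(lra) ltac:(move=> t ht; have := H1 t ht; have := chi t ltac:(lra); nra).
  have I2 := kc 0 T0 a ltac:(lra) ltac:(move=> t ht; have := H2 t ltac:(lra); have := chi t ltac:(lra); nra).
  have I4 := kc 0 b T ltac:(lra) ltac:(move=> t ht; have := H2 t ltac:(lra); have := chi t ltac:(lra); nra).
  have I3 : (b - a) * (m / 2) <= RInt (fun t => (1 - t / T) * y t) a b.
  { apply kc; first lra. move=> t ht. have h3 := H3 t ltac:(lra).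
    have : / 2 <= 1 - t / T.
    { have : t / T <= / 2; last lra. apply (Rmult_le_reg_r T) => //. have -> : t / T * T = t by field; lra. lra. }
    nra. }
  lra.
Qed.

(* For |t| <= T0 the weight is at most (36 B^2 d^4)^N up to a constant, on [a, b] at least
   (72 B^2 d^4)^N; first [N] is fixed, then [d] tends to 0, and the kernel at 0 is O(d^(4N+1)). *)
Lemma no_constant_sign zeta Gamma F sg lam T0 e : is_zeta zeta -> is_Gamma Gamma -> is_completed_zeta zeta Gamma F ->
  Cmod lam <= 1 -> 0 < T0 -> e = 1 \/ e = -1 ->
  (forall t, T0 <= t -> 0 < Re (lam * F (on_line sg t))%C) ->
  (forall t, T0 <= t -> 0 < e * Re (lam * F (on_line sg (- t)))%C) -> False.
Proof.
  move=> Hz HG HF hlam hT0 he Hp Hn.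
  pose A t := Re (lam * F (on_line sg t))%C.
  have [M [hM HM]] := F_line_bounded zeta Gamma F sg T0 HF ltac:(lra).
  set B := (Rabs sg + T0 + 1) * (Rabs sg + T0 + 2).
  have hsg := Rabs_pos sg.
  have hB : 1 <= B by rewrite /B; nra.
  have sb t : Rabs t <= T0 -> Cmod (on_line sg t) * Cmod (on_line sg t - 1)%C <= B.
  { move=> ht.
    have k1 : Cmod (on_line sg t) <= Rabs sg + T0.
    { rewrite on_line_pair. apply Rle_trans with (1 := Cmod_pair_le _ _). lra. }
    have k2 : Cmod (on_line sg t - 1)%C <= Rabs sg + T0 + 1.
    { apply Rle_trans with (1 := Cmod_triangle' _ _). rewrite Cmod_1. lra. }
    rewrite /B. apply Rmult_le_compat; try exact: Cmod_ge_0; lra. }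
  (* Chosen so that a^4 / 16 >= 72 B^2: at t >= a the product of the two factors is at least twice
     its bound 36 B^2 d^4 for |t| <= T0. Also al t >= 1 there, as [exp_half_lower] requires. *)
  set a := T0 + 2 + 9 * B. set b := a + 1.
  have ha : T0 < a by rewrite /a; lra. have ha11 : 11 <= a by rewrite /a; lra.
  have ha9 : 9 * B <= a by rewrite /a; lra.
  have hA4 : 1152 * B ^ 2 <= a ^ 4.
  { have h2 : (9 * B) ^ 2 <= a ^ 2 by apply pow_incr; lra.
    have h3 : 81 <= a ^ 2 by nra.
    have -> : a ^ 4 = a ^ 2 * a ^ 2 by ring. have hb2 : 0 <= B ^ 2 by apply pow2_ge_0. 
    have h4 : 81 * B ^ 2 <= a ^ 2 by have -> : 81 * B ^ 2 = (9 * B) ^ 2 by ring.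
    have : 81 * (81 * B ^ 2) <= a ^ 2 * a ^ 2 by apply Rmult_le_compat; lra. lra. }
  have contA t : t <> 0 -> continuous A t.
  { move=> ht. have [h0 h1] := on_line_nonzero sg t ht.
    have [l Hl] := ex_derive_cder F _ (proj1 (proj2 HF) (on_line sg t) ltac:(by case)).
    have h := cder_scal lam _ _ _ Hl.
    apply: ex_derive_continuous. eexists. exact: (cder_line_re (fun z => lam * F z)%C (RtoC sg) Ci _ t h). }
  have [m [hm Hm]] : exists m, 0 < m /\ forall t, a <= t <= b -> m <= A t.
  { have [tm [h1 h2]] := continuity_ab_min A a b ltac:(rewrite /b; lra) ltac:(move=> t ht; apply continuity_pt_filterlim; apply contA; lra).
    exists (A tm). split; last exact: h1. apply Hp. lra. }
  set Q := 2 * T0 * exp T0 * M.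
  have hQ : 0 <= Q by rewrite /Q; apply Rmult_le_pos => //; apply Rmult_le_pos; [lra | apply Rlt_le, exp_pos].
  (* The ratio 2 of the two weights is amplified to 2^N until it outweighs m and the bound M of F
     near the real axis. *)
  have [N [hN HN]] : exists N, (1 <= N)%nat /\ Q + 2 <= m / 4 * 2 ^ N.
  { have [n Hn2] := Pow_x_infinity 2 ltac:(rewrite Rabs_pos_eq; lra) ((Q + 2) / (m / 4)).
    exists (S n); split; first lia. have := Hn2 (S n) ltac:(lia). rewrite Rabs_pos_eq; last by apply pow_le; lra.
    move=> h. have -> : Q + 2 = m / 4 * ((Q + 2) / (m / 4)) by field; lra. apply Rmult_le_compat_l; lra. }
  have hNR : 1 <= INR N by apply (le_INR 1 N).
  (* One order beyond the size d^(4 N) of the weight; the surplus factor d makes the kernel at 0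
     negligible. *)
  have [Kf [hKf HKf]] := Theta_near_cusp (4 * N + 1).
  have hpi := PI_RGT_0. have hpi3 := PI_gt_3. have hpi4 := PI_4.
  set L := 16 * PI * (16 ^ N * Kf * (5 * INR N) ^ (4 * N + 1)).
  have hL : 0 <= L.
  { rewrite /L. apply Rmult_le_pos; first lra. apply Rmult_le_pos; last by apply pow_le; lra.
    apply Rmult_le_pos => //. apply pow_le; lra. }
  (* The conditions serve [cosh_factor_upper] for |t| <= T0, the bound al >= 1/2, and the smallness
     of the kernel at 0, in this order. *)
  have [d [hd [hd1 [hd2 hd3]]]] : exists d, 0 < d /\ d * T0 <= 1 /\ 12 * INR N * d <= 1 /\ L * d <= / 2.
  { exists (/ (T0 + 12 * INR N + 2 * L)).
    have hp : 0 < T0 + 12 * INR N + 2 * L by lra.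
    have hi := Rinv_0_lt_compat _ hp.
    have hh : / (T0 + 12 * INR N + 2 * L) * (T0 + 12 * INR N + 2 * L) = 1 by field; lra.
    set q := / _ in hi hh *. repeat split => //; nra. }
  (* The 2 N steps move an angle by at most 2 N d, so every |beta| stays between N d and 5 N d below
     pi/4: inside the domain of theta, yet at distance O(d) from the cusps. *)
  set al := PI / 4 - 3 * INR N * d.
  have hal : / 2 <= al <= 1 by rewrite /al; nra.
  set l := weight_list sg e al d N.
  have he1 : Rabs e <= 1 by case: he => ->; [rewrite Rabs_R1 | rewrite Rabs_left]; lra.
  have near := angles_near_weight_list sg e al d N ltac:(lra) ltac:(lra).
  have hbeta p : In p l -> INR N * d <= PI / 4 - Rabs (snd p) <= 5 * INR N * d.
  { move=> hp. have h := near p hp. have h1 := Rle_abs (Rabs (snd p) - al). have h2 := Rle_abs (- (Rabs (snd p) - al)).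
    rewrite Rabs_Ropp in h2. rewrite /al in h h1 h2. lra. }
  have hgood : small_angles l by move=> p hp; have := hbeta p hp; nra.
  have [W0 W1] := multiplier_weight_list_zero sg e al d N hN.
  have [dk [X [DX [HX EX]]]] := multiplier_continuation sg zeta Gamma F l Hz HG HF hgood W0 W1.
  have hd4 : 0 < d ^ (4 * N) by apply pow_lt.
  have K0 : 16 * PI * Cmod (mkernel sg l 0) <= / 2 * d ^ (4 * N).
  { have := mkernel_0_bound sg l (Kf * (5 * INR N * d) ^ (4 * N + 1)) ltac:(move=> p hp; apply Rle_trans with (1 := HKf _ (hgood p hp)); apply Rmult_le_compat_l => //; apply pow_incr; have := hbeta p hp; nra).
    rewrite W0. have -> : (mkernel sg l 0 + RtoC (/ 2) * 0 = mkernel sg l 0)%C by ring. move=> h.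
    have hE : 0 <= Kf * (5 * INR N * d) ^ (4 * N + 1) by apply Rmult_le_pos => //; apply pow_le; nra.
    have h2 : Cmod (mkernel sg l 0) <= 16 ^ N * (Kf * (5 * INR N * d) ^ (4 * N + 1)).
    { apply Rle_trans with (1 := h). apply Rmult_le_compat_r => //. exact: abs_sum_weight_list. }
    apply Rle_trans with (16 * PI * (16 ^ N * (Kf * (5 * INR N * d) ^ (4 * N + 1)))); first by apply Rmult_le_compat_l; lra.
    have -> : 16 * PI * (16 ^ N * (Kf * (5 * INR N * d) ^ (4 * N + 1))) = (L * d) * d ^ (4 * N).
    { rewrite /L Rpow_mult_distr (pow_add d) pow_1. ring. }
    apply Rmult_le_compat_r; lra. }
  have [T1 [hT1 HT]] := fejer_line sg l lam X hgood hlam dk DX HX (d ^ (4 * N) / 2) ltac:(lra).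
  pose y t := Re (lam * X (on_line sg t))%C + Re (lam * X (on_line sg (- t)))%C.
  pose D t := (cosh_factor sg d t * cosh_factor (1 - sg) d t) ^ N.
  have D0 t : 0 <= D t by apply pow_le, Rmult_le_pos; exact: cosh_factor_nonneg.
  have Deven t : D (- t) = D t by rewrite /D !cosh_factor_even.
  have XA t : t <> 0 -> Re (lam * X (on_line sg t))%C = A t * (D t * exp_half e (al * t)) / 2.
  { move=> ht. have h := EX (on_line sg t) ltac:(by rewrite on_line_pair).
    rewrite multiplier_line line_weight_weight_list -/(D t) in h.
    have -> : (lam * X (on_line sg t) = lam * F (on_line sg t) * RtoC (D t * exp_half e (al * t) / 2))%C.
    { transitivity (lam * (RtoC 2 * X (on_line sg t)) * RtoC (/ 2))%C.
      - rewrite RtoC_inv; last lra. field.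
      - rewrite -h /Rdiv !RtoC_mult. ring. }
    rewrite /A /Re /Im /RtoC /=. field. }
  have ye t : t <> 0 -> y t = D t * exp_half e (al * t) * (A t + e * A (- t)) / 2.
  { move=> ht. rewrite /y XA // XA; last lra. rewrite Deven.
    have -> : al * - t = - (al * t) by ring. rewrite exp_half_parity //. field. }
  have cy t : continuous y t.
  { have cX := cont_line X sg DX.
    have h : cont (fun t => lam * X (on_line sg t))%C by apply cont_mult; [exact: cont_const | exact: cX].
    have h' := cont_neg _ h.
    apply: (continuous_plus (fun t => Re (lam * X (on_line sg t))%C) (fun t => Re (lam * X (on_line sg (- t)))%C)).
    - exact: (proj1 (h t)).
    - exact: (proj1 (h' t)). }
  have ypos t : T0 <= t -> 0 <= y t.
  { move=> ht. rewrite ye; last lra.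
    have c := exp_half_nonneg e (al * t) he ltac:(nra). have p1 : 0 < A t := Hp t ht. have p2 : 0 < e * A (- t) := Hn t ht.
    have q := D0 t. have : 0 <= D t * exp_half e (al * t) by apply Rmult_le_pos. nra. }
  set u := (36 * B ^ 2) ^ N.
  have hu : 1 <= u by apply pow_R1_Rle; nra.
  have ylow t : a <= t <= b -> m / 4 * (2 ^ N * u * d ^ (4 * N)) <= y t.
  { move=> ht. rewrite ye; last lra.
    have alt : / 2 * t <= al * t by apply Rmult_le_compat_r; lra.
    have c := exp_half_lower e (al * t) he ltac:(lra). have p1 := Hm t ht. have p2 : 0 < e * A (- t) := Hn t ltac:(lra).
    have hD : 2 ^ N * u * d ^ (4 * N) <= D t.
    { rewrite /u /D pow_mult -!Rpow_mult_distr. apply pow_incr. split.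
      - have : 0 < d ^ 4 by apply pow_lt. have := pow2_ge_0 B. nra.
      - have hdt : 0 <= d * t by apply Rmult_le_pos; lra.
        have l1 := cosh_factor_lower sg d t hdt. have l2 := cosh_factor_lower (1 - sg) d t hdt.
        have q0 : 0 <= (d * t) ^ 2 / 4 by have := pow2_ge_0 (d * t); lra.
        apply Rle_trans with ((d * t) ^ 2 / 4 * ((d * t) ^ 2 / 4)); last by apply Rmult_le_compat.
        have -> : (d * t) ^ 2 / 4 * ((d * t) ^ 2 / 4) = d ^ 4 * (t ^ 4 / 16) by field.
        have -> : 2 * (36 * B ^ 2) * d ^ 4 = d ^ 4 * (72 * B ^ 2) by ring.
        apply Rmult_le_compat_l; first by apply pow_le; lra.
        have : a ^ 4 <= t ^ 4 by apply pow_incr; lra. lra. }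
    have w0 : 0 <= 2 ^ N * u * d ^ (4 * N).
    { apply Rmult_le_pos; last lra. apply Rmult_le_pos; [apply pow_le; lra | lra]. }
    have : m / 4 * (2 ^ N * u * d ^ (4 * N)) <= m / 4 * D t by apply Rmult_le_compat_l; lra.
    have : D t * / 2 <= D t * exp_half e (al * t) by apply Rmult_le_compat_l; [apply D0 | lra].
    have dd := D0 t. move=> w1 w2.
    have : D t * / 2 * m <= D t * exp_half e (al * t) * (A t + e * A (- t)) by apply Rmult_le_compat; lra.
    lra. }
  set Z := exp T0 * M * (u * d ^ (4 * N)).
  have hZ : 0 <= Z.
  { rewrite /Z. apply Rmult_le_pos; first by apply Rmult_le_pos => //; apply Rlt_le, exp_pos. apply Rmult_le_pos; lra. }
  have AD t : t <> 0 -> Rabs t <= T0 -> Rabs (A t) * D t <= M * (u * d ^ (4 * N)).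
  { move=> ht htt. have [e1 e2] := Cmod_on_line sg t. have [n0 n1] := on_line_nonzero sg t ht.
    set q := Cmod (on_line sg t) * Cmod (on_line sg t - 1)%C.
    have hq0 : 0 < q.
    { apply Rmult_lt_0_compat; apply Cmod_gt_0 => //. move=> h. apply n1. by apply Ceq_of_minus. }
    have hqB : q <= B by apply sb.
    have hF : Cmod (F (on_line sg t)) * q <= M by apply HM.
    have hAF : Rabs (A t) <= Cmod (F (on_line sg t)).
    { apply Rle_trans with (1 := re_le_Cmod _). rewrite Cmod_mult. have := Cmod_ge_0 (F (on_line sg t)). have := Cmod_ge_0 lam. nra. }
    have hdt : Rabs (d * t) <= 1.
    { rewrite Rabs_mult (Rabs_pos_eq d); last lra. apply Rle_trans with (d * T0) => //. apply Rmult_le_compat_l; lra. }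
    have u1 := cosh_factor_upper sg d t hdt. have u2 := cosh_factor_upper (1 - sg) d t hdt.
    rewrite -e1 in u1. rewrite -e2 in u2.
    have hDq : D t <= (36 * q ^ 2 * d ^ 4) ^ N.
    { apply pow_incr. split; first by apply Rmult_le_pos; exact: cosh_factor_nonneg.
      apply Rle_trans with ((6 * d ^ 2 * Cmod (on_line sg t) ^ 2) * (6 * d ^ 2 * Cmod (on_line sg t - 1)%C ^ 2)).
      - apply Rmult_le_compat => //; exact: cosh_factor_nonneg.
      - apply Req_le. rewrite /q. ring. }
    (* One factor q = |s| |s - 1| is spent on the poles of F; the remaining 2 N - 1 are bounded by B
       >= 1. *)
    have E : (36 * q ^ 2 * d ^ 4) ^ N = q * (q ^ (2 * N - 1) * (36 ^ N * d ^ (4 * N))).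
    { clear -hN. move: q => z.
      rewrite (Rpow_mult_distr (36 * z ^ 2)) (Rpow_mult_distr 36) -(pow_mult z) -(pow_mult d). have -> : (2 * N = S (2 * N - 1))%nat by lia.
      have -> : (S (2 * N - 1) - 1 = 2 * N - 1)%nat by lia. rewrite /=. ring. }
    have hqn : q ^ (2 * N - 1) <= B ^ (2 * N).
    { apply Rle_trans with (B ^ (2 * N - 1)); first by apply pow_incr; lra. apply Rle_pow => //. lia. }
    have hw : 0 < 36 ^ N * d ^ (4 * N) by apply Rmult_lt_0_compat => //; apply pow_lt; lra.
    have eu : u * d ^ (4 * N) = B ^ (2 * N) * (36 ^ N * d ^ (4 * N)) by rewrite /u Rpow_mult_distr -pow_mult; ring.
    apply Rle_trans with (Cmod (F (on_line sg t)) * (q * (q ^ (2 * N - 1) * (36 ^ N * d ^ (4 * N))))).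
    { apply Rmult_le_compat => //; [exact: Rabs_pos | lra]. }
    rewrite -Rmult_assoc eu. apply Rmult_le_compat => //.
    - apply Rmult_le_pos; [exact: Cmod_ge_0 | lra].
    - apply Rmult_le_pos; [apply pow_le; lra | lra].
    - apply Rmult_le_compat_r; lra. }
  have yZ t : 0 < t < T0 -> - Z <= y t.
  { move=> ht. have ht0 : t <> 0 by lra. rewrite ye //.
    have a1 := AD t ht0 ltac:(rewrite Rabs_pos_eq; lra).
    have a2 := AD (- t) ltac:(lra) ltac:(rewrite Rabs_Ropp Rabs_pos_eq; lra). rewrite Deven in a2.
    have c : Rabs (exp_half e (al * t)) <= exp T0 by apply exp_half_upper => //; rewrite Rabs_pos_eq; [have : al * t <= 1 * t; [apply Rmult_le_compat_r; lra | lra] | apply Rmult_le_pos; lra].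
    set W := D t * exp_half e (al * t) * (A t + e * A (- t)) / 2.
    have : Rabs W <= Z.
    { have -> : W = / 2 * exp_half e (al * t) * (D t * (A t + e * A (- t))) by rewrite /W; field.
      rewrite (Rabs_mult (/ 2 * _)) (Rabs_mult (/ 2)) (Rabs_mult (D t)) (Rabs_pos_eq (/ 2)); last lra. rewrite (Rabs_pos_eq (D t)) //.
      have tri : Rabs (A t + e * A (- t)) <= Rabs (A t) + Rabs (A (- t)).
      { apply Rle_trans with (1 := Rabs_triang _ _). rewrite Rabs_mult. have := Rabs_pos (A (- t)). nra. }
      have p1 : D t * Rabs (A t + e * A (- t)) <= 2 * (M * (u * d ^ (4 * N))).
      { apply Rle_trans with (D t * (Rabs (A t) + Rabs (A (- t)))); first by apply Rmult_le_compat_l. lra. }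
      have p2 : 0 <= D t * Rabs (A t + e * A (- t)) by apply Rmult_le_pos => //; exact: Rabs_pos.
      have p3 := Rabs_pos (exp_half e (al * t)).
      apply Rle_trans with (/ 2 * exp T0 * (2 * (M * (u * d ^ (4 * N))))).
      - apply Rmult_le_compat => //; [lra | apply Rmult_le_compat_l; lra].
      - rewrite /Z. apply Req_le. field. }
    have := Rle_abs (- W). rewrite Rabs_Ropp. lra. }
  set T := Rmax T1 (2 * b).
  have k1 := HT T (Rmax_l _ _).
  have k2 := fejer_integral_lower y T0 a b T Z (m / 4 * (2 ^ N * u * d ^ (4 * N))) hT0 ha ltac:(rewrite /b; lra) (Rmax_r _ _)
    ltac:(apply Rmult_le_pos; [lra | apply Rmult_le_pos; [apply Rmult_le_pos; [apply pow_le; lra | lra] | lra]]) hZ cy yZ ypos ylow.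
  have k3 := Rle_abs (RInt (fun t => (1 - t / T) * y t) 0 T).
  have eb : b - a = 1 by rewrite /b; ring. rewrite eb in k2.
  have k4 : Rabs (RInt (fun t => (1 - t / T) * y t) 0 T) <= 2 * PI * (4 * Cmod (mkernel sg l 0)) + d ^ (4 * N) / 2 by exact: k1.
  (* By the choice of N the right-hand side is at least u d^(4 N) >= d^(4 N), whereas the Fejer
     bound is at most (1/4 + 1/2) d^(4 N). *)
  have k5 : m / 4 * (2 ^ N * u * d ^ (4 * N)) * 1 / 2 - T0 * Z = ((m / 4 * 2 ^ N) - Q) * (u * d ^ (4 * N)) / 2.
  { rewrite /Z /Q. field. }
  rewrite k5 in k2.
  have hud : d ^ (4 * N) <= u * d ^ (4 * N) by nra.
  have : 2 * (u * d ^ (4 * N)) <= (m / 4 * 2 ^ N - Q) * (u * d ^ (4 * N)) by apply Rmult_le_compat_r; lra.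
  have := Cmod_ge_0 (mkernel sg l 0). lra.
Qed.

Lemma finite_bounded (S : R -> Prop) : Finite_sets.Finite R S -> exists T, 1 <= T /\ forall t, S t -> Rabs t < T.
Proof.
  elim=> [|U _ [T [hT HT]] x _].
  - exists 1; split; first lra. move=> t. by case.
  - exists (Rmax T (Rabs x + 1)). split; first by apply Rle_trans with (2 := Rmax_l _ _).
    move=> t [z hz|z hz].
    + apply Rlt_le_trans with (2 := Rmax_l _ _). exact: HT.
    + case: hz. apply Rlt_le_trans with (2 := Rmax_r _ _). lra.
Qed.

Lemma constant_sign (A : R -> R) T0 : 0 < T0 -> (forall t, t <> 0 -> continuous A t) ->
  (forall t, T0 <= t -> A t <> 0) -> exists e, (e = 1 \/ e = -1) /\ forall t, T0 <= t -> 0 < e * A t.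
Proof.
  move=> hT hc hn.
  have key e : (e = 1 \/ e = -1) -> 0 < e * A T0 -> forall t, T0 <= t -> 0 < e * A t.
  { move=> he h0 t ht. apply Rnot_le_lt => h1.
    (* The intermediate value theorem is applied to a function continuous on all of R, and A may
       fail to be continuous at 0; the reparametrization stays at arguments >= T0. *)
    pose f x := A (T0 + Rabs x).
    have cf : continuity f.
    { move=> x. apply continuity_pt_filterlim.
      apply (continuous_comp (fun x => T0 + Rabs x) A).
      - apply: (continuous_plus (fun _ => T0) (fun x => Rabs x)); [exact: continuous_const | exact: continuous_Rabs].
      - apply hc. have := Rabs_pos x. lra. }
    have [z [_ hz]] := IVT_cor f 0 (t - T0) cf ltac:(lra)
      ltac:(rewrite /f Rabs_R0 Rplus_0_r Rabs_pos_eq; [have -> : T0 + (t - T0) = t by ring | lra];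
            case: he h0 h1 => ->; nra).
    apply (hn (T0 + Rabs z)) => //. have := Rabs_pos z. lra. }
  have h0 := hn T0 (Rle_refl _).
  case: (Rlt_le_dec 0 (A T0)) => h.
  - exists 1. split; first by left. apply key; [by left | lra].
  - exists (-1). split; first by right. apply key; [by right | lra].
Qed.

(** The unit lam treats both parts at once, since Im F = Re (- i F). Finitely many zeros would force
    a constant sign on each of the two far ends of the line. *)
Lemma real_part_zeros_infinite zeta Gamma F lam sg : is_zeta zeta -> is_Gamma Gamma -> is_completed_zeta zeta Gamma F ->
  Cmod lam = 1 ->
  ~ Finite_sets.Finite R (fun t : R => on_line sg t <> RtoC 0 /\ on_line sg t <> RtoC 1 /\ Re (lam * F (on_line sg t))%C = 0).
Proof.
  move=> Hz HG HF hlam Hfin. have [T0 [hT0 HT]] := finite_bounded _ Hfin.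
  pose A t := Re (lam * F (on_line sg t))%C.
  have contA t : t <> 0 -> continuous A t.
  { move=> ht. have [h0 h1] := on_line_nonzero sg t ht.
    have [l Hl] := ex_derive_cder F _ (proj1 (proj2 HF) (on_line sg t) ltac:(by case)).
    have h := cder_scal lam _ _ _ Hl.
    apply: ex_derive_continuous. eexists. exact: (cder_line_re (fun z => lam * F z)%C (RtoC sg) Ci _ t h). }
  have nz t : T0 <= Rabs t -> A t <> 0.
  { move=> ht hA. have ht0 : t <> 0 by move=> h; rewrite h Rabs_R0 in ht; lra.
    have [h0 h1] := on_line_nonzero sg t ht0. have := HT t ltac:(by split). lra. }
  have [e1 [he1 H1]] := constant_sign A T0 ltac:(lra) contA ltac:(move=> t ht; apply nz; rewrite Rabs_pos_eq; lra).
  have contA' t : t <> 0 -> continuous (fun t => A (- t)) t.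
  { move=> ht. apply (continuous_comp (fun t => - t) A); last by apply contA; lra.
    apply: ex_derive_continuous. auto_derive => //. }
  have [e2 [he2 H2]] := constant_sign (fun t => A (- t)) T0 ltac:(lra) contA' ltac:(move=> t ht; apply nz; rewrite Rabs_Ropp Rabs_pos_eq; lra).
  have E c t : Re (RtoC c * lam * F (on_line sg t))%C = c * A t by rewrite /A /Re /Im /RtoC /=; ring.
  (* The sign e1 at + infinity is absorbed into lam; the relative sign e1 e2 of the two ends decides
     between cosh and sinh. *)
  apply (no_constant_sign zeta Gamma F sg (RtoC e1 * lam)%C T0 (e1 * e2) Hz HG HF).
  - rewrite Cmod_mult hlam Cmod_R. case: he1 => ->; [rewrite Rabs_R1 | rewrite Rabs_left]; lra.
  - lra.
  - case: he1 => ->; case: he2 => ->; [left|right|right|left]; ring.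
  - move=> t ht. rewrite E. exact: H1.
  - move=> t ht. rewrite E. have := H2 t ht. case: he1 => ->; lra.
Qed.

Theorem mainTheorem1 :
  forall (zeta Gamma F : C -> C),
    is_zeta zeta -> is_Gamma Gamma -> is_completed_zeta zeta Gamma F ->
    forall sigma : R,
      ~ Finite_sets.Finite R (fun t : R =>
          (sigma + Ci * t)%C <> RtoC 0 /\ (sigma + Ci * t)%C <> RtoC 1 /\
          Re (F (sigma + Ci * t)%C) = 0%R)
      /\
      ~ Finite_sets.Finite R (fun t : R =>
          (sigma + Ci * t)%C <> RtoC 0 /\ (sigma + Ci * t)%C <> RtoC 1 /\
          Im (F (sigma + Ci * t)%C) = 0%R).
Proof.
  move=> zeta Gamma F Hz HG HF sigma. split => Hfin.
  - apply (real_part_zeros_infinite zeta Gamma F (RtoC 1) sigma Hz HG HF Cmod_1).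
    apply: eq_ind Hfin _ _. apply functional_extensionality => t. by rewrite Cmult_1_l.
  - apply (real_part_zeros_infinite zeta Gamma F (- Ci)%C sigma Hz HG HF); first by rewrite Cmod_opp Cmod_Ci.
    apply: eq_ind Hfin _ _. apply functional_extensionality => t.
    have -> // : Im (F (sigma + Ci * t)%C) = Re (- Ci * F (sigma + Ci * t))%C by rewrite /Re /Im /Ci /=; ring.
Qed.
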